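(* Let $n\geq 3$ and $2\leq s<\infty$ be integers, let $\{3^{n-2},4\}$ denote the $n$-orthoplex, and let $\rho_0,\dots,\rho_n$ be the distinguished generators of $G(2^{\{3^{n-2},4\},\mathcal{G}(s)})$. Put $\tilde{\rho}_0:=\rho_0\rho_1\rho_0$ and $H:=H(2^{\{3^{n-2},4\},\mathcal{G}(s)})=\langle\tilde{\rho}_0,\rho_1,\dots,\rho_n\rangle$. Then the incidence system $\mathcal{H}(2^{\{3^{n-2},4\},\mathcal{G}(s)})=\Gamma(H;(H_i)_{i\in\{0,\dots,n\}})$ is a regular hypertope whose automorphism group $H$ has order $(4s)^{n-1}(2s)\,n!$ and is the quotient of the Coxeter group with generators $\tilde{\rho}_0,\rho_1,\dots,\rho_n$ and Coxeter relations $$\tilde{\rho}_0^2=\rho_i^2=id\ (1\le i\le n),\quad (\tilde{\rho}_0\rho_2)^3=id,\quad (\rho_i\rho_{i+1})^3=id\ (1\leq i\leq n-2),\quad (\rho_{n-1}\rho_n)^4=id,$$ with all other pairs of distinct generators commuting, by the single extra relation $$(\tilde{\rho}_0\rho_2\rho_3\cdots\rho_{n-1}\rho_n\rho_{n-1}\cdots\rho_3\rho_2\rho_1)^{2s}=id.$$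
   Context: C-groups and polytopes: a C-group of rank $m$ is a group $G$ with generating involutions $\rho_0,\dots,\rho_{m-1}$ satisfying $\langle\rho_i\mid i\in I\rangle\cap\langle\rho_j\mid j\in J\rangle=\langle\rho_k\mid k\in I\cap J\rangle$ for all $I,J\subseteq\{0,\dots,m-1\}$; it is a string C-group if $(\rho_i\rho_j)^2=id$ whenever $|i-j|\geq 2$. Abstract regular polytopes $\mathcal{P}$ of rank $m$ are in one-to-one correspondence with string C-groups $G(\mathcal{P})$ of rank $m$: the $i$-faces are the right cosets of $\langle\rho_j\mid j\neq i\rangle$, and vertices are the $0$-faces. Construction of $2^{\mathcal{P},\mathcal{G}(s)}$: let $\mathcal{P}$ be a centrally symmetric regular $n$-polytope with group $G(\mathcal{P})=\langle\tau_0,\dots,\tau_{n-1}\rangle$, i.e. $G(\mathcal{P})$ has a proper central involution $\alpha$ fixing no vertex. Let $F_0$ be the base vertex, stabilized by $\langle\tau_1,\dots,\tau_{n-1}\rangle$. Let $W$ be the Coxeter group generated by involutions $\sigma_F$, one for each vertex $F$ of $\mathcal{P}$, with defining relations $\sigma_F^2=id$, $(\sigma_F\sigma_{F\alpha})^s=id$, and $(\sigma_F\sigma_{F'})^2=id$ for $F'\notin\{F,F\alpha\}$. The group $G(\mathcal{P})$ acts on $W$ by $\tau^{-1}\sigma_F\tau=\sigma_{F\tau}$. Then $2^{\mathcal{P},\mathcal{G}(s)}$ is the regular $(n+1)$-polytope with group $G(2^{\mathcal{P},\mathcal{G}(s)}):=W\rtimes G(\mathcal{P})=\langle\rho_0,\dots,\rho_n\rangle$,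 where $\rho_0:=\sigma_{F_0}$ and $\rho_i:=\tau_{i-1}$ for $1\leq i\leq n$. For the $n$-orthoplex, $G(\mathcal{P})$ is the Coxeter group $[3^{n-2},4]$ ($n-2$ threes followed by a $4$), of order $2^nn!$, there are $2n$ vertices, and $\alpha=(\tau_0\tau_1\cdots\tau_{n-1})^n$. Hypertopes and halving: for a group $H$ with subgroups $(H_i)_{i\in I}$, $\Gamma(H;(H_i)_{i\in I})$ is the incidence system whose elements of type $i$ are the right cosets of $H_i$, two elements being incident iff the cosets intersect. A flag is a set of pairwise incident elements and a chamber is a flag containing an element of every type. A regular hypertope is an incidence system in which every flag lies in a chamber (a geometry) and which is thin (every flag missing exactly one type lies in exactly two chambers), residually connected (every residue of rank at least $2$ has connected incidence graph) and flag-transitive (type-preserving automorphisms are transitive on flags of each given type). Its automorphism group here means the group of type-preserving automorphisms. For a regular $(n+1)$-polytope with group $\langle\rho_0,\dots,\rho_n\rangle$, the halving group is $\langle\tilde{\rho}_0,\rho_1,\dots,\rho_n\rangle$ with $\tilde{\rho}_0=\rho_0\rho_1\rho_0$; $H_i$ is the subgroup generated by all these generators except the $i$-th one ($\tilde{\rho}_0$ being number $0$). *)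

(* Defs.v *)
From HB Require Import structures.
From mathcomp Require Import all_boot generic_quotient.
From mathcomp Require Import mathcomp_extra boolp classical_sets cardinality.
From mathcomp Require Import zify.
From Stdlib Require Import Relations.

Set Implicit Arguments.
Unset Strict Implicit.
Unset Printing Implicit Defensive.

Local Open Scope classical_set_scope.
Local Open Scope quotient_scope.
Local Open Scope group_scope.

(** * Subgroups of arbitrary (possibly infinite) groups *)

Definition subgroup_set (G : groupType) (S : set G) : Prop :=
  S 1 /\ forall x y, S x -> S y -> S (x / y).

Definition gen (G : groupType) (A : set G) : set G :=
  smallest (@subgroup_set G) A.

Definition normal_closure (G : groupType) (A : set G) : set G :=
  gen [set x | exists a g, A a /\ x = a ^ g].

Definition rcoset (G : groupType) (A : set G) (g : G) : set G :=
  [set x * g | x in A].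

Section SubgroupTheory.
Variable G : groupType.
Implicit Types (S A : set G) (x y g h : G).

Lemma subgroup1 S : subgroup_set S -> S 1.
Proof. by case. Qed.

Lemma subgroupV S x : subgroup_set S -> S x -> S x^-1.
Proof. by move=> [S1 SF] Sx; rewrite -div1g; exact: SF. Qed.

Lemma subgroupM S x y : subgroup_set S -> S x -> S y -> S (x * y).
Proof.
by move=> sS Sx Sy; rewrite -[y]invgK; apply: sS.2 => //; exact: subgroupV.
Qed.

Lemma gen_subgroup A : subgroup_set (gen A).
Proof.
split=> [S [[S1 _] _] //|x y Ax Ay S [sS AS]].
by apply: sS.2; [exact: Ax|exact: Ay].
Qed.

Lemma sub_gen A : A `<=` gen A.
Proof. exact: sub_smallest. Qed.

Lemma gen_group_closed A : group_closed [pred x | x \in gen A].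
Proof.
have [A1 AF] := gen_subgroup A.
split=> [|x y]; first exact: mem_set.
by move=> /set_mem Ax /set_mem Ay; apply: mem_set; exact: AF.
Qed.

Lemma rcosetE A g x : rcoset A g x <-> A (x / g).
Proof.
split=> [[y Ay <-]|Axg]; first by rewrite mulgK.
by exists (x / g) => //; rewrite mulgVK.
Qed.

Lemma rcosetM A g h : rcoset (rcoset A g) h = rcoset A (g * h).
Proof.
apply/seteqP; split=> x /=; rewrite !rcosetE /= invgM mulgA => //.
Qed.

Lemma rcoset1 A : rcoset A 1 = A.
Proof. by apply/seteqP; split=> x; rewrite rcosetE divg1. Qed.

End SubgroupTheory.

(** The subgroup generated by the family [f], as a group in its own right. *)

Definition subgroup_gen (G : groupType) (I : Type) (f : I -> G) : Type :=
  {x : G | x \in gen (range f)}.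

HB.instance Definition _ (G : groupType) (I : Type) (f : I -> G) :=
  SubChoice.on (subgroup_gen f).
HB.instance Definition _ (G : groupType) (I : Type) (f : I -> G) :=
  SubChoice_isSubGroup.Build G [pred x | x \in gen (range f)] (subgroup_gen f)
    (@gen_group_closed G (range f)).

Definition subgroup_gen_elt (G : groupType) (I : Type) (f : I -> G) (i : I) :
    subgroup_gen f :=
  exist _ (f i) (mem_set (sub_gen (imageT f i))).

(** * Group presentations *)

(** A letter [(i, b)] is the generator [i] if [b = false], and its formal
    inverse if [b = true]. *)
Definition letter (I : Type) : Type := (I * bool)%type.
Definition word (I : Type) : Type := seq (letter I).

Definition inv_letter (I : Type) (a : letter I) : letter I := (a.1, ~~ a.2).
Definition inv_word (I : Type) (w : word I) : word I :=
  rev (map (@inv_letter I) w).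

Inductive word_congr (I : Type) (R : set (word I)) : word I -> word I -> Prop :=
| word_congr_refl u : word_congr R u u
| word_congr_sym u v : word_congr R u v -> word_congr R v u
| word_congr_trans v u w :
    word_congr R u v -> word_congr R v w -> word_congr R u w
| word_congr_cat u u' v v' :
    word_congr R u u' -> word_congr R v v' -> word_congr R (u ++ v) (u' ++ v')
| word_congr_inv a : word_congr R [:: a; inv_letter a] [::]
| word_congr_rel r : R r -> word_congr R r [::].

Section Presentation.
Variables (I : choiceType) (R : set (word I)).

HB.instance Definition _ := Choice.on (letter I).
HB.instance Definition _ := Choice.on (word I).

Definition word_equiv : rel (word I) := fun u v => `[< word_congr R u v >].

Lemma word_equiv_is_equiv : equiv_class_of word_equiv.
Proof.
split=> [u|u v|v u w]; first exact/asboolP/word_congr_refl.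
- by apply/asboolP/asboolP; exact: word_congr_sym.
- by move=> /asboolP uv /asboolP vw; apply/asboolP; exact: word_congr_trans vw.
Qed.

Canonical word_equiv_rel := EquivRelPack word_equiv_is_equiv.

(** The group presented by the generators [I] and the relators [R]. *)
Definition presented_group : Type := {eq_quot word_equiv_rel}.

HB.instance Definition _ := Choice.on presented_group.
HB.instance Definition _ := EqQuotient.on presented_group.

Definition word_class (w : word I) : presented_group := \pi_presented_group w.

Lemma word_classP u v : word_class u = word_class v <-> word_congr R u v.
Proof.
by split=> [/eqmodP/asboolP|uv] //; apply/eqmodP/asboolP.
Qed.

Lemma word_class_repr x : word_class (repr x) = x.
Proof. exact: reprK. Qed.

Lemma inv_letterK : involutive (@inv_letter I).
Proof. by case=> i b; rewrite /inv_letter /= negbK. Qed.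

Lemma inv_wordK : involutive (@inv_word I).
Proof.
by move=> w; rewrite /inv_word map_rev revK mapK //; exact: inv_letterK.
Qed.

Lemma inv_word_cat u v : inv_word (u ++ v) = inv_word v ++ inv_word u :> word I.
Proof. by rewrite /inv_word map_cat rev_cat. Qed.

Lemma word_congr_mulV w : word_congr R (w ++ inv_word w) [::].
Proof.
elim: w => [|a w IHw]; first exact: word_congr_refl.
rewrite -cat1s inv_word_cat catA -(catA [:: a]).
apply: word_congr_trans (word_congr_inv R a).
rewrite -[X in word_congr R _ X]/([:: a] ++ inv_word [:: a]).
apply: word_congr_cat; last exact: word_congr_refl.
rewrite -[X in word_congr R _ X]cats0.
by apply: word_congr_cat => //; exact: word_congr_refl.
Qed.

Lemma word_congr_Vmul w : word_congr R (inv_word w ++ w) [::].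
Proof. by rewrite -{2}[w]inv_wordK; exact: word_congr_mulV. Qed.

Lemma word_congr_invw u v :
  word_congr R u v -> word_congr R (inv_word u) (inv_word v).
Proof.
move=> uv; have h : word_congr R (inv_word u ++ u ++ inv_word v) (inv_word v).
  rewrite catA -[X in word_congr R _ X]cat0s.
  by apply: word_congr_cat (word_congr_Vmul u) (word_congr_refl _ _).
apply: word_congr_trans h; rewrite -[X in word_congr R X _]cats0.
apply: word_congr_cat; first exact: word_congr_refl.
apply: word_congr_sym; apply: word_congr_trans (word_congr_mulV v).
exact: word_congr_cat uv (word_congr_refl _ _).
Qed.

Definition pres_mul (x y : presented_group) : presented_group :=
  word_class (repr x ++ repr y).
Definition pres_one : presented_group := word_class [::].
Definition pres_inv (x : presented_group) : presented_group :=
  word_class (inv_word (repr x)).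

Lemma repr_word_class w : word_congr R (repr (word_class w)) w.
Proof. by apply/word_classP; rewrite word_class_repr. Qed.

Lemma pres_mulE u v :
  pres_mul (word_class u) (word_class v) = word_class (u ++ v).
Proof. by apply/word_classP/word_congr_cat; exact: repr_word_class. Qed.

Lemma pres_invE u : pres_inv (word_class u) = word_class (inv_word u).
Proof. by apply/word_classP/word_congr_invw; exact: repr_word_class. Qed.

Lemma pres_mulA : associative pres_mul.
Proof.
move=> x y z; rewrite -(word_class_repr x) -(word_class_repr y).
by rewrite -(word_class_repr z) !pres_mulE catA.
Qed.

Lemma pres_mul1 : left_id pres_one pres_mul.
Proof. by move=> x; rewrite -(word_class_repr x) pres_mulE. Qed.

Lemma pres_mulr1 : right_id pres_one pres_mul.
Proof. by move=> x; rewrite -(word_class_repr x) pres_mulE cats0. Qed.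

Lemma pres_mulV : left_inverse pres_one pres_inv pres_mul.
Proof.
move=> x; rewrite -(word_class_repr x) pres_invE pres_mulE.
exact/word_classP/word_congr_Vmul.
Qed.

Lemma pres_mulrV : right_inverse pres_one pres_inv pres_mul.
Proof.
move=> x; rewrite -(word_class_repr x) pres_invE pres_mulE.
exact/word_classP/word_congr_mulV.
Qed.

HB.instance Definition _ := isGroup.Build presented_group
  pres_mulA pres_mul1 pres_mulr1 pres_mulV pres_mulrV.

Definition pres_gen (i : I) : presented_group := word_class [:: (i, false)].

End Presentation.

(** The value of a word under an assignment of its generators in a group, and
    the universal property of the presented group. *)

Definition eval_letter (I : Type) (G : groupType) (f : I -> G) (a : letter I) :
    G :=
  if a.2 then (f a.1)^-1 else f a.1.

Definition eval_word (I : Type) (G : groupType) (f : I -> G) (w : word I) : G :=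
  \prod_(a <- w) eval_letter f a.

Definition pres_lift (I : choiceType) (R : set (word I)) (G : groupType)
    (f : I -> G) (x : presented_group R) : G :=
  eval_word f (repr x).

Section PresentationTheory.
Variables (I : choiceType) (R : set (word I)).
Local Notation P := (presented_group R).
Local Notation gn := (@pres_gen I R).

Lemma word_classM u v : word_class R (u ++ v) = word_class R u * word_class R v.
Proof. by rewrite [RHS]pres_mulE. Qed.

Lemma word_classV u : word_class R (inv_word u) = (word_class R u)^-1.
Proof. by rewrite [RHS]pres_invE. Qed.

Lemma word_class_eval w : word_class R w = eval_word gn w.
Proof.
rewrite /eval_word; elim: w => [|[i b] w IHw]; first by rewrite big_nil.
rewrite -cat1s word_classM IHw big_cons; congr (_ * _).
by case: b => //; rewrite /eval_letter /= -word_classV.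
Qed.

Lemma pres_rel r : R r -> eval_word gn r = 1.
Proof.
by move=> Rr; rewrite -word_class_eval; apply/word_classP/word_congr_rel.
Qed.

Section Lift.
Variables (G : groupType) (f : I -> G).
Hypothesis fR : forall r, R r -> eval_word f r = 1.

Lemma eval_word_congr u v : word_congr R u v -> eval_word f u = eval_word f v.
Proof.
rewrite /eval_word; elim=> {u v} //.
- by move=> v u w _ -> _ ->.
- by move=> u u' v v' _ IHu _ IHv; rewrite !big_cat IHu IHv.
- case=> i b; rewrite !big_cons !big_nil mulg1 /eval_letter /=.
  by case: b; rewrite /= ?mulVg ?mulgV.
- by move=> r Rr; rewrite big_nil; exact: fR.
Qed.

Lemma pres_lift_class w : pres_lift f (word_class R w) = eval_word f w.
Proof. exact/eval_word_congr/repr_word_class. Qed.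

Lemma pres_liftM : {morph @pres_lift I R G f : x y / x * y}.
Proof.
move=> x y; rewrite -(word_class_repr x) -(word_class_repr y) -word_classM.
by rewrite !pres_lift_class /eval_word big_cat.
Qed.

Lemma pres_lift_gen i : pres_lift f (gn i) = f i.
Proof. by rewrite pres_lift_class /eval_word big_seq1. Qed.

End Lift.

Lemma pres_ind_morph (H : groupType) (p q : P -> H) :
  {morph p : x y / x * y} -> {morph q : x y / x * y} ->
  (forall i, p (gn i) = q (gn i)) -> p =1 q.
Proof.
move=> pM qM pq x.
have m1 (m : P -> H) : {morph m : y z / y * z} -> m 1 = 1.
  by move=> mM; apply: (@mulgI _ (m 1)); rewrite -mM !mulg1.
have mV (m : P -> H) : {morph m : y z / y * z} -> {morph m : y / y^-1}.
  by move=> mM y; apply/esym/mulg1_eq; rewrite -mM mulgV m1.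
rewrite -(word_class_repr x) word_class_eval /eval_word.
rewrite (big_morph p pM (m1 _ pM)) (big_morph q qM (m1 _ qM)).
by apply: eq_bigr => -[i []] _; rewrite /eval_letter /= ?mV // pq.
Qed.

End PresentationTheory.

(** * Coxeter groups *)

(** [M i j] is the order imposed on [i j]; [M i j = 0] imposes no relation.  The
    relation [i^2 = 1] is the one given by [M i i = 1]. *)
Definition coxeter_rel (I : Type) (M : I -> I -> nat) : set (word I) :=
  [set w | exists i j, w = flatten (nseq (M i j) [:: (i, false); (j, false)])].

Definition coxeter_group (I : choiceType) (M : I -> I -> nat) : groupType :=
  presented_group (coxeter_rel M).

Definition coxeter_gen (I : choiceType) (M : I -> I -> nat) (i : I) :
    coxeter_group M :=
  pres_gen (coxeter_rel M) i.

Section CoxeterTheory.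
Variables (I : choiceType) (M : I -> I -> nat).

Lemma eval_coxeter_rel (G : groupType) (f : I -> G) m i j :
  eval_word f (flatten (nseq m [:: (i, false); (j, false)])) = (f i * f j) ^+ m.
Proof.
rewrite /eval_word; elim: m => [|m IHm]; first by rewrite big_nil.
by rewrite /= !big_cons IHm expgS /eval_letter /= mulgA.
Qed.

Lemma coxeter_genX i j : (coxeter_gen M i * coxeter_gen M j) ^+ M i j = 1.
Proof. by rewrite -eval_coxeter_rel; apply: pres_rel; exists i, j. Qed.

End CoxeterTheory.

(** * Semidirect products *)

Record right_action (G W : groupType) := RightAction {
  ract :> W -> G -> W;
  ract1 : forall w, ract w 1 = w;
  ractA : forall w g h, ract w (g * h) = ract (ract w g) h;
  ractM : forall g, {morph ract^~ g : v w / v * w} }.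

(** The semidirect product of [W] by [G]; the pair [(g, w)] stands for the
    product [g w], and [g^-1 w g = to w g]. *)
Definition semidirect (G W : groupType) (to : right_action G W) : Type :=
  (G * W)%type.

Section Semidirect.
Variables (G W : groupType) (to : right_action G W).
Local Notation semidirect := (semidirect to).

HB.instance Definition _ := Choice.on semidirect.

Definition sd_mul (x y : semidirect) : semidirect :=
  (x.1 * y.1, to x.2 y.1 * y.2).
Definition sd_one : semidirect := (1, 1).
Definition sd_inv (x : semidirect) : semidirect :=
  (x.1^-1, to x.2^-1 x.1^-1).

Lemma ract_one g : to 1 g = 1.
Proof. by apply: (@mulgI _ (to 1 g)); rewrite -ractM !mulg1. Qed.

Lemma sd_mulA : associative sd_mul.
Proof.
by move=> [g u] [h v] [k w]; rewrite /sd_mul /= !mulgA ractA ractM.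
Qed.

Lemma sd_mul1 : left_id sd_one sd_mul.
Proof. by move=> [g w]; rewrite /sd_mul /= ract_one !mul1g. Qed.

Lemma sd_mulr1 : right_id sd_one sd_mul.
Proof. by move=> [g w]; rewrite /sd_mul /= ract1 !mulg1. Qed.

Lemma sd_mulV : left_inverse sd_one sd_inv sd_mul.
Proof.
by move=> [g w]; rewrite /sd_mul /sd_inv /= -ractA !mulVg ract1 mulVg.
Qed.

Lemma sd_mulrV : right_inverse sd_one sd_inv sd_mul.
Proof.
by move=> [g w]; rewrite /sd_mul /sd_inv /= -ractM !mulgV ract_one.
Qed.

HB.instance Definition _ := isGroup.Build semidirect
  sd_mulA sd_mul1 sd_mulr1 sd_mulV sd_mulrV.

Definition sd_inl (g : G) : semidirect := (g, 1).
Definition sd_inr (w : W) : semidirect := (1, w).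

Lemma sd_inrJ w g : sd_inr w ^ sd_inl g = sd_inr (to w g).
Proof.
rewrite /conjg /mul /= /inv /= /sd_mul /= /sd_inl /sd_inr /=.
by rewrite invg1 !ract_one !mul1g mulg1 mulVg.
Qed.

End Semidirect.

(** * The group of the polytope [2^{P, G(s)}] *)

Section Twisting.
(** [V] is the stabilizer of the base vertex in the group [G] of [P], and [a] the
    central involution.  The vertices are the right cosets of [V]. *)
Variables (G : groupType) (V : set G) (a : G).
Hypothesis a_central : forall g, commute a g.
Variable s : nat.

Definition vertex : Type := {F : set G | `[< exists g, F = rcoset V g >]}.

HB.instance Definition _ := SubChoice.on vertex.

Lemma base_vertex_subproof : `[< exists g, V = rcoset V g >].
Proof. by apply/asboolP; exists 1; rewrite rcoset1. Qed.

Definition base_vertex : vertex := exist _ V base_vertex_subproof.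

Lemma vertex_act_subproof (F : vertex) (g : G) :
  `[< exists h, rcoset (val F) g = rcoset V h >].
Proof.
by case: F => F /= /asboolP[h ->]; apply/asboolP; exists (h * g); rewrite rcosetM.
Qed.

Definition vertex_act (F : vertex) (g : G) : vertex :=
  exist _ (rcoset (val F) g) (vertex_act_subproof F g).

Definition vertex_coxeter (F F' : vertex) : nat :=
  if F' == F then 1%N else if F' == vertex_act F a then s else 2%N.

Definition vertex_group : groupType := coxeter_group vertex_coxeter.

Lemma vertex_act1 F : vertex_act F 1 = F.
Proof. by apply: val_inj; rewrite /= rcoset1. Qed.

Lemma vertex_actM F g h : vertex_act F (g * h) = vertex_act (vertex_act F g) h.
Proof. by apply: val_inj; rewrite /= rcosetM. Qed.

Lemma vertex_act_inj g : injective (vertex_act^~ g).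
Proof.
move=> F F' /(congr1 (vertex_act^~ g^-1)).
by rewrite -!vertex_actM mulgV !vertex_act1.
Qed.

Lemma vertex_coxeter_act F F' g :
  vertex_coxeter (vertex_act F g) (vertex_act F' g) = vertex_coxeter F F'.
Proof.
rewrite /vertex_coxeter (inj_eq (@vertex_act_inj g)) -vertex_actM -a_central.
by rewrite vertex_actM (inj_eq (@vertex_act_inj g)).
Qed.

Definition sigma (F : vertex) : vertex_group := coxeter_gen vertex_coxeter F.

Definition vertex_group_act (w : vertex_group) (g : G) : vertex_group :=
  pres_lift (fun F => sigma (vertex_act F g)) w.

Lemma vertex_group_act_rel g r : coxeter_rel vertex_coxeter r ->
  eval_word (fun F => sigma (vertex_act F g)) r = 1.
Proof.
move=> [F [F' ->]]; rewrite eval_coxeter_rel -(vertex_coxeter_act F F' g).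
exact: coxeter_genX.
Qed.

Lemma vertex_group_act_gen F g :
  vertex_group_act (sigma F) g = sigma (vertex_act F g).
Proof. by apply: pres_lift_gen; exact: vertex_group_act_rel. Qed.

Lemma vertex_group_act_morph g : {morph vertex_group_act^~ g : v w / v * w}.
Proof. by apply: pres_liftM; exact: vertex_group_act_rel. Qed.

Lemma vertex_group_act1 w : vertex_group_act w 1 = w.
Proof.
apply: (pres_ind_morph (p := vertex_group_act^~ 1) (q := id)) => //.
  exact: vertex_group_act_morph.
by move=> F; rewrite [LHS]vertex_group_act_gen vertex_act1.
Qed.

Lemma vertex_group_actM w g h :
  vertex_group_act w (g * h) = vertex_group_act (vertex_group_act w g) h.
Proof.
apply: (pres_ind_morph (p := vertex_group_act^~ (g * h))
  (q := fun w => vertex_group_act (vertex_group_act w g) h)).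
- exact: vertex_group_act_morph.
- by move=> u v; rewrite !vertex_group_act_morph.
move=> F; rewrite [LHS]vertex_group_act_gen [X in vertex_group_act X h]
  vertex_group_act_gen.
by rewrite [RHS]vertex_group_act_gen vertex_actM.
Qed.

Definition vertex_group_ract : right_action G vertex_group :=
  RightAction vertex_group_act1 vertex_group_actM vertex_group_act_morph.

Definition twist_group : groupType := semidirect vertex_group_ract.

(** [rho_0 = sigma_{F_0}], where [F_0] is the base vertex, and
    [rho_i = tau_{i-1}] for [0 < i]. *)
Definition twist_gen (n : nat) (tau : 'I_n -> G) (i : 'I_n.+1) : twist_group :=
  if unlift ord0 i is Some j then sd_inl vertex_group_ract (tau j)
  else sd_inr vertex_group_ract (sigma base_vertex).

End Twisting.

(** * Incidence systems and regular hypertopes *)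

Record incidence_system (I : Type) := IncidenceSystem {
  element :> Type;
  type_of : element -> I;
  incident : element -> element -> Prop;
  incident_refl : forall x, incident x x;
  incident_sym : forall x y, incident x y -> incident y x;
  incident_type : forall x y, incident x y -> type_of x = type_of y -> x = y }.

Section Hypertope.
Variables (I : Type) (X : incidence_system I).
Implicit Types F C : set X.

Definition flag F : Prop := forall x y, F x -> F y -> incident x y.

Definition types F : set I := @type_of I X @` F.

Definition chamber C : Prop := flag C /\ types C = setT.

Definition geometry : Prop :=
  forall F, flag F -> exists C, chamber C /\ F `<=` C.

Definition thin : Prop :=
  forall F i, flag F -> types F = ~` [set i] ->
    exists C C', C <> C' /\ [set D | chamber D /\ F `<=` D] = [set C; C'].

Definition residue F : set X :=
  [set x | ~ F x /\ forall y, F y -> incident x y].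

Definition connected_in (S : set X) : Prop :=
  forall x y, S x -> S y ->
    clos_refl_trans X (fun u v => S u /\ S v /\ incident u v) x y.

(** The residue of a flag has rank at least 2 when the flag misses at least two
    types. *)
Definition residually_connected : Prop :=
  forall F, flag F ->
    (exists i j, i <> j /\ ~ types F i /\ ~ types F j) ->
    connected_in (residue F).

Definition type_automorphism (f : X -> X) : Prop :=
  [/\ bijective f,
      forall x, type_of (f x) = type_of x &
      forall x y, incident (f x) (f y) <-> incident x y].

Definition flag_transitive : Prop :=
  forall F F', flag F -> flag F' -> types F = types F' ->
    exists f, type_automorphism f /\ f @` F = F'.

Definition regular_hypertope : Prop :=
  [/\ geometry, thin, residually_connected & flag_transitive].

(** [act] is an isomorphism from [H] onto the group of type-preserving
    automorphisms, the latter acting on the right. *)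
Definition automorphism_group_via (H : groupType) (act : H -> X -> X) : Prop :=
  [/\ forall g h x, act (g * h) x = act h (act g x),
      injective act &
      forall f, type_automorphism f <-> exists h, f = act h].

End Hypertope.

Section CosetSystem.
Variables (H : groupType) (I : Type) (K : I -> set H).
Hypothesis K_subgroup : forall i, subgroup_set (K i).

Definition coset_element : Type :=
  {x : I * set H | exists h, x.2 = rcoset (K x.1) h}.

Definition coset_type (x : coset_element) : I := (sval x).1.
Definition coset_incident (x y : coset_element) : Prop :=
  (sval x).2 `&` (sval y).2 !=set0.

Lemma coset_incident_refl x : coset_incident x x.
Proof.
case: x => -[i A] /= [h Ah]; rewrite /coset_incident /= setIid Ah.
by exists h; apply/rcosetE; rewrite mulgV; exact: subgroup1.
Qed.

Lemma coset_incident_sym x y : coset_incident x y -> coset_incident y x.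
Proof. by rewrite /coset_incident setIC. Qed.

Lemma coset_incident_type x y :
  coset_incident x y -> coset_type x = coset_type y -> x = y.
Proof.
case: x y => -[i A] /= [g Ag] [[j B] /= [h Bh]].
rewrite /coset_incident /coset_type /= => -[z [/= Az Bz]] ij.
apply: eq_exist; subst j; congr (_, _); subst A B.
have cz k : rcoset (K i) k z -> rcoset (K i) k = rcoset (K i) z.
  move=> /rcosetE zk; apply/seteqP; split=> x /rcosetE xh; apply/rcosetE.
    have -> : x / z = (x / k) * (z / k)^-1 by rewrite invgF divgKA.
    by apply: subgroupM => //; exact: subgroupV.
  have -> : x / k = (x / z) * (z / k) by rewrite divgKA.
  exact: subgroupM.
by rewrite (cz g) // (cz h).
Qed.

(** The coset incidence system of [H] with respect to the subgroups [K i]. *)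
Definition coset_system : incidence_system I :=
  @IncidenceSystem I coset_element coset_type coset_incident
    coset_incident_refl coset_incident_sym coset_incident_type.

Lemma coset_translate_subproof (h : H) (x : coset_element) :
  exists g, rcoset (sval x).2 h = rcoset (K (sval x).1) g.
Proof. by case: x => -[i A] /= [g ->]; exists (g * h); rewrite rcosetM. Qed.

Definition coset_translate (h : H) (x : coset_system) : coset_system :=
  exist _ ((sval x).1, rcoset (sval x).2 h) (coset_translate_subproof h x).

End CosetSystem.

(** * Halving *)

Section Halving.
Variables (U : groupType) (n : nat) (rho : 'I_n.+1 -> U).

Definition halving_family (i : 'I_n.+1) : U :=
  if i == ord0 then rho ord0 * rho (inord 1) * rho ord0 else rho i.

Definition halving_group : groupType := subgroup_gen halving_family.

Definition halving_gen (i : 'I_n.+1) : halving_group :=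
  subgroup_gen_elt halving_family i.

Definition halving_sub (i : 'I_n.+1) : set halving_group :=
  gen [set halving_gen j | j in [set j | j != i]].

Lemma halving_sub_subgroup i : subgroup_set (halving_sub i).
Proof. exact: gen_subgroup. Qed.

Definition halving_system : incidence_system 'I_n.+1 :=
  coset_system halving_sub_subgroup.

Definition halving_translate (h : halving_group) :
    halving_system -> halving_system :=
  coset_translate h.

End Halving.

(** * The orthoplex *)

Section OrthoplexCenter.
Variables (G : groupType) (m : nat) (t : nat -> G).
Hypothesis t2 : forall k, k <= m -> t k * t k = 1.
Hypothesis t3 : forall k, k.+1 < m -> t k * t k.+1 * t k = t k.+1 * t k * t k.+1.
Hypothesis t4 : 0 < m -> (t m.-1 * t m) ^+ 4 = 1.
Hypothesis tC : forall i j, i.+1 < j -> j <= m -> commute (t i) (t j).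

Let c := \prod_(0 <= k < m.+1) t k.

Local Lemma tV k : k <= m -> (t k)^-1 = t k.
Proof. by move=> km; apply: mulg1_eq; exact: t2. Qed.

Local Lemma commute_range x i j : (forall k, i <= k < j -> commute x (t k)) ->
  commute x (\prod_(i <= k < j) t k).
Proof.
move=> h; rewrite big_seq_cond; apply: commute_prod => k.
by rewrite mem_index_iota andbT; exact: h.
Qed.

Local Lemma cshift i : i.+1 < m -> c * t i = t i.+1 * c.
Proof.
move=> im; rewrite /c.
have -> : \prod_(0 <= k < m.+1) t k = (\prod_(0 <= k < i) t k) *
    (t i * t i.+1 * \prod_(i.+2 <= k < m.+1) t k).
  rewrite (big_cat_nat _ (n := i)) //=; last by lia.
  by rewrite (@big_ltn _ _ _ i) ?(@big_ltn _ _ _ i.+1) ?mulgA //; lia.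
set A := \prod_(0 <= k < i) _; set B := \prod_(i.+2 <= k < _) _.
have BC : commute (t i) B by apply: commute_range => k ?; apply: tC; lia.
have AC : commute (t i.+1) A.
  by apply: commute_range => k ?; apply/esym/tC; lia.
rewrite -!mulgA -BC [RHS]mulgA AC -!mulgA; congr (A * _).
by rewrite !mulgA t3.
Qed.

Let P k := \prod_(0 <= j < k) t j.
Let Q k := \prod_(1 <= j < k.+1) t j.

(** The transposition as a palindrome in two ways:
    [t 0 ... t k ... t 0 = t k ... t 0 ... t k]. *)
Local Lemma palindrome k : k < m -> t k ^ (P k)^-1 = t 0 ^ Q k.
Proof.
elim: k => [|k IHk] km; first by rewrite /P /Q !big_geq // invg1 !conjg1.
have CP : commute (t k.+1) (P k).
  by apply: commute_range => j ?; apply/esym/tC; lia.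
rewrite /Q big_nat_recr //= -/(Q k) conjgM -IHk; last by lia.
rewrite /P big_nat_recr //= -/(P k) invgM conjgM.
have -> : t k.+1 ^ (t k)^-1 = t k ^ t k.+1.
  rewrite /conjg invgK (@tV k); last by lia.
  by rewrite (@tV k.+1) ?mulgA ?t3 //; lia.
by rewrite -!conjgM; congr (_ ^ _); apply/commuteV.
Qed.

Local Lemma cwrap : 0 < m -> c ^+ 2 * t m.-1 = t 0 * c ^+ 2.
Proof.
move=> m0; suff e : t m.-1 ^ c^-1 = t 0 ^ c.
  rewrite expg2; move: e; rewrite /conjg invgK => e.
  have /(congr1 (fun x => c * x * c)) := e.
  by rewrite !mulgA mulgVK mulgV mul1g.
have cl : c = P m.-1 * t m.-1 * t m.
  by rewrite /c big_nat_recr //= -{1}(prednK m0) big_nat_recr.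
have cr : c = t 0 * Q m.-1 * t m.
  by rewrite /c big_nat_recr //= big_ltn // /Q prednK.
have tm2 := t2 (leqnn m).
have tn2 : t m.-1 * t m.-1 = 1 by apply: t2; lia.
have -> : t 0 ^ c = (t 0 ^ Q m.-1) ^ t m.
  have t00 : t 0 ^ t 0 = t 0 by rewrite /conjg mulgA mulVg mul1g.
  by rewrite cr !conjgM t00.
rewrite -palindrome; last by lia.
have CP : commute (t m) (P m.-1).
  by apply: commute_range => j ?; apply/esym/tC; lia.
have -> : (t m.-1 ^ (P m.-1)^-1) ^ t m = (t m.-1 ^ t m) ^ (P m.-1)^-1.
  by rewrite -!conjgM; congr (_ ^ _); apply/esym/commuteV.
rewrite cl !invgM !conjgM; congr (_ ^ _).
rewrite /conjg !invgK !tV //; last by lia.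
have := t4 m0; rewrite !expgS expg0 mulg1 => t4'.
have h : t m.-1 * t m * t m.-1 * t m = t m * t m.-1 * t m * t m.-1.
  rewrite -[LHS](@mulg1_eq _ (t m.-1 * t m * t m.-1 * t m)); last first.
    by rewrite -[RHS]t4' !mulgA.
  by rewrite !invgM !tV ?mulgA //; lia.
by rewrite !mulgA h -(mulgA _ (t m.-1) (t m.-1)) tn2 mulg1.
Qed.

Lemma center_nat k : k <= m -> commute (c ^+ m.+1) (t k).
Proof.
have cXshift d i : i + d < m -> c ^+ d * t i = t (i + d) * c ^+ d.
  elim: d => [|d IHd] idm; first by rewrite addn0 mul1g mulg1.
  rewrite expgS -mulgA IHd; last by lia.
  by rewrite !mulgA cshift ?addnS // -?addnS //; lia.
have cs i : i < m -> commute (c ^+ m.+1) (t i).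
  move=> im; have -> : m.+1 = (i + (2 + (m.-1 - i)))%N by lia.
  rewrite /commute !expgnDr -!mulgA cXshift; last by lia.
  have -> : (i + (m.-1 - i) = m.-1)%N by lia.
  have cw x : c * (c * (t m.-1 * x)) = t 0 * (c * (c * x)).
    by rewrite !mulgA -expg2 cwrap ?expg2 ?mulgA //; lia.
  by rewrite cw (mulgA (c ^+ i)) (cXshift i 0) ?add0n -?mulgA //; lia.
rewrite leq_eqVlt => /predU1P[->|]; last exact: cs.
have -> : t m = (\prod_(0 <= j < m) t j)^-1 * c.
  by rewrite /c big_nat_recr //= mulKg.
apply: commuteM; last exact/esym/commuteX.
by apply/commuteV/commute_range => j jm; apply: cs; lia.
Qed.

End OrthoplexCenter.

(** The Coxeter matrix of [3^{n-2}, 4]. *)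
Definition orthoplex_coxeter (n : nat) (i j : 'I_n) : nat :=
  if i == j then 1%N
  else if (i.+1 == j :> nat) || (j.+1 == i :> nat) then
    if maxn i j == n.-1 then 4%N else 3%N
  else 2%N.

Definition orthoplex_group (n : nat) : groupType :=
  coxeter_group (@orthoplex_coxeter n).

Definition orthoplex_gen (n : nat) (i : 'I_n) : orthoplex_group n :=
  coxeter_gen (@orthoplex_coxeter n) i.

Definition orthoplex_stab (n : nat) : set (orthoplex_group n) :=
  gen [set orthoplex_gen i | i in [set i : 'I_n | 0 < i]].

Arguments orthoplex_stab : clear implicits.

Definition orthoplex_central (n : nat) : orthoplex_group n :=
  (\prod_(i < n) orthoplex_gen i) ^+ n.

Lemma orthoplex_central_gen n (i : 'I_n) :
  commute (orthoplex_central n) (orthoplex_gen i).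
Proof.
case: n i => [[]//|m] i.
pose t k : orthoplex_group m.+1 := oapp (@orthoplex_gen m.+1) 1 (insub k).
have tE (j : 'I_m.+1) : t j = orthoplex_gen j by rewrite /t valK.
have tO k (km : k <= m) : {j : 'I_m.+1 | t k = orthoplex_gen j & k = j :> nat}.
  by exists (Ordinal (km : k < m.+1)) => //; rewrite -tE.
rewrite /orthoplex_central -(tE i) (eq_bigr (fun j : 'I_m.+1 => t j)); last first.
  by move=> j _; rewrite tE.
have t2 k : k <= m -> t k * t k = 1.
  move=> /tO[j -> _]; rewrite -[LHS]expg1.
  by have := coxeter_genX (@orthoplex_coxeter m.+1) j j;
    rewrite /orthoplex_coxeter eqxx.
have tX k l : k <= m -> l <= m -> k != l ->
    (t k * t l) ^+ (if (k.+1 == l) || (l.+1 == k) then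
      if maxn k l == m then 4 else 3 else 2) = 1.
  move=> /tO[j -> ->] /tO[j' -> ->] jj'.
  by have := coxeter_genX (@orthoplex_coxeter m.+1) j j';
    rewrite /orthoplex_coxeter -val_eqE /= (negPf jj').
have tV k : k <= m -> (t k)^-1 = t k by move=> km; apply: mulg1_eq; exact: t2.
rewrite -(big_mkord xpredT t).
apply: center_nat => // [k km|m0|j l jl lm|].
- have := tX k k.+1; rewrite eqxx /= (_ : maxn k k.+1 = k.+1); last by lia.
  rewrite (ltn_eqF km) => /(_ _ _ _); rewrite !expgS expg0 mulg1 => h.
  have e : t k * t k.+1 * t k * (t k.+1 * t k * t k.+1) = 1.
    by rewrite -!mulgA in h *; apply: h; lia.
  by rewrite -(mulg1_eq e) !invgM !tV ?mulgA //; lia.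
- have := tX m.-1 m; rewrite prednK // eqxx /= (_ : maxn m.-1 m = m); last by lia.
  by rewrite eqxx; apply; lia.
- have := tX j l; rewrite (_ : (j.+1 == l) || (l.+1 == j) = false); last by lia.
  rewrite expg2 => h.
  have e : t j * t l * (t j * t l) = 1 by apply: h; lia.
  by rewrite /commute -(mulg1_eq e) invgM !tV //; lia.
- by have := ltn_ord i; lia.
Qed.

Lemma orthoplex_centralP n g : commute (orthoplex_central n) g.
Proof.
suff h : g ^ orthoplex_central n = g by rewrite /commute [RHS]conjgC h.
apply: (pres_ind_morph (p := fun g => g ^ orthoplex_central n) (q := id)) => //.
  by move=> x y; exact: conjMg.
by move=> i; apply/conjg_fixP/commgP/esym/orthoplex_central_gen.
Qed.

Definition orthoplex_twist_group (n s : nat) : groupType :=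
  twist_group (orthoplex_stab n) (@orthoplex_centralP n) s.

Definition orthoplex_twist_gen (n s : nat) (i : 'I_n.+1) :
    orthoplex_twist_group n s :=
  twist_gen (orthoplex_stab n) (@orthoplex_centralP n) s (@orthoplex_gen n) i.

(** The Coxeter diagram of the halving group: the path [1, ..., n] with last
    branch labelled 4, and the node 0 attached to the node 2. *)
Definition halving_coxeter (n : nat) (i j : 'I_n.+1) : nat :=
  let lo := minn i j in
  let hi := maxn i j in
  if i == j then 1%N
  else if (lo == 0%N) && (hi == 2) then 3%N
  else if (0 < lo) && (hi == lo.+1) then if hi == n then 4%N else 3%N
  else 2%N.

(** [g_0 g_2 g_3 ... g_{n-1} g_n g_{n-1} ... g_2 g_1] *)
Definition halving_word (G : groupType) (n : nat) (g : 'I_n.+1 -> G) : G :=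
  g ord0 * (\prod_(2 <= k < n.+1) g (inord k))
         * (\prod_(1 <= k < n) g (inord (n - k))).

(* Main.v *)
From HB Require Import structures.
From mathcomp Require Import all_boot fingroup perm.
From mathcomp Require Import boolp classical_sets cardinality.
From mathcomp Require Import zify.
From Stdlib Require Import Relation_Operators.
Require Import Defs.

Set Implicit Arguments.
Unset Strict Implicit.
Unset Printing Implicit Defensive.

Local Open Scope classical_set_scope.
Local Open Scope group_scope.

(** Write [U = W x| O] for the group of the polytope, [O] being the group of
    signed permutations of the axes, and [e_0, ..., e_{n-1}] and their negatives
    for the vertices of the orthoplex; thus [rho_0 = sigma_{e_0}].

    The group [O].  List the vertices as
    [e_0, ..., e_{n-1}, - e_{n-1}, ..., - e_0].  Consecutive vertices are
    exchanged by a generator, and the products of generators along this walk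
    are coset representatives for the stabilizers of initial segments of the
    list ([walk_step]).  Hence the stabilizer of the first [l] vertices is
    generated by the generators from the [l]-th on, [O] has order [2^n n!], and
    membership in a parabolic subgroup can be read off from the action on the
    vertices ([tail_set_block]).  The group [W] is the product of one dihedral
    group of order [2 s] for each axis ([prod_axis_coord]).

    Order.  Every element of [U] lies in [H] or in [H rho_0]
    ([twist_cover]), and the number of vertex reflections in an element of [H] is
    even, so [H] has index two in [U].

    Presentation.  Conjugation by [rho_0] exchanges the first two generators of
    [H] and fixes the others.  Let [Q] be the group presented by the relations in
    question.  They are invariant under this exchange, so [Q] has an extension by
    an involution [theta] inducing it.  Sending [rho_0] to [theta] and the other
    generators to those of [Q] extends to [U] ([twist_image]): up to the action
    of [O] there are only three kinds of pairs of vertices to check, and for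
    antipodal ones the relation is the power of the long word ([theta_image_rel]).
    A word that is trivial in [H] is therefore trivial in [Q].

    Hypertope.  A coset system of a group generated by involutions is a regular
    hypertope, on which the group acts as the full automorphism group, as soon as
    the intersections of the maximal parabolic subgroups are generated by the
    expected generators and pairwise meeting cosets of them have a common element
    ([coset_hypertope], [coset_automorphism_group]).  Both conditions are proved by
    induction on the largest type [m] involved ([cospan_cap], [cosets_meet]): a
    generator [l] with [2 <= l] separates the diagram, so that the subgroup
    without it is a product of two commuting parts.  What remains are statements
    on few types, settled inside [U]: for [2 <= m] the subgroup without the
    generator [m] keeps the face [e_0, ..., e_{m-1}] ([cospan_block]), and
    conjugation by [rho_0] exchanges the types [0] and [1]. *)

(** * Generated subgroups *)

Section GeneratedSubgroups.
Variable G : groupType.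
Implicit Types (A B S : set G) (x y z : G).

Lemma gen_min A S : subgroup_set S -> A `<=` S -> gen A `<=` S.
Proof. by move=> sS AS x; apply. Qed.

Lemma gen_sub A B : A `<=` B -> gen A `<=` gen B.
Proof.
by move=> AB; apply: gen_min (gen_subgroup B) _; apply: subset_trans (@sub_gen _ B).
Qed.

Lemma gen1 A : gen A 1.
Proof. exact: subgroup1 (gen_subgroup A). Qed.

Lemma genM A x y : gen A x -> gen A y -> gen A (x * y).
Proof. exact: subgroupM (gen_subgroup A). Qed.

Lemma genV A x : gen A x -> gen A x^-1.
Proof. exact: subgroupV (gen_subgroup A). Qed.

Lemma genF A x y : gen A x -> gen A y -> gen A (x / y).
Proof. by move=> Ax Ay; exact: (gen_subgroup A).2. Qed.

Lemma genMl A x y : gen A x -> gen A (x * y) -> gen A y.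
Proof. by move=> Ax Axy; rewrite -(mulKg x y); apply: genM => //; exact: genV. Qed.

Lemma centralizer_subgroup_set x : subgroup_set [set y | commute x y].
Proof.
split=> [|y z xy xz]; first exact: commute1.
by apply: commuteM => //; exact: commuteV.
Qed.

Lemma gen_commute A x y : (forall a, A a -> commute x a) -> gen A y -> commute x y.
Proof. by move=> cA; apply: (gen_min (centralizer_subgroup_set x)). Qed.

Section Involutions.
Variable A : set G.
Hypothesis A2 : forall a, A a -> a * a = 1.

(** Induction along products of generators: involutions need no inverses. *)
Lemma gen_invol_ind (P : G -> Prop) : P 1 ->
  (forall x a, gen A x -> A a -> P x -> P (x * a)) -> forall x, gen A x -> P x.
Proof.
move=> P1 PM x Ax.
suff [h _] : (forall y, gen A y -> P y -> P (y * x)) /\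
    (forall y, gen A y -> P y -> P (y * x^-1)).
  by rewrite -[x]mul1g; apply: h => //; exact: gen1.
suff [] : gen A x /\ ((forall y, gen A y -> P y -> P (y * x)) /\
    (forall y, gen A y -> P y -> P (y * x^-1))) by [].
pose S := [set x | gen A x /\ ((forall y, gen A y -> P y -> P (y * x)) /\
    (forall y, gen A y -> P y -> P (y * x^-1)))].
apply: (gen_min (S := S)) Ax => [|a Aa].
  split=> [|u v [Au [Pu Pu']] [Av [Pv Pv']]].
    split; first exact: gen1.
    by split=> y _; rewrite ?invg1 mulg1.
  split; first exact: genF.
  split=> y Ay Py; rewrite ?invgF mulgA.
    by apply: Pv'; [exact: genM|exact: Pu].
  by apply: Pu'; [exact: genM|exact: Pv].
have aV : a^-1 = a by apply: mulg1_eq; exact: A2.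
split; first exact: sub_gen.
by rewrite aV; split=> y Ay Py; exact: PM.
Qed.

Lemma gen_invol_indl (P : G -> Prop) : P 1 ->
  (forall x a, gen A x -> A a -> P x -> P (a * x)) -> forall x, gen A x -> P x.
Proof.
move=> P1 PM x Ax; rewrite -[x]invgK.
apply: (gen_invol_ind (P := fun x => P x^-1)) (genV Ax) => [|y a Ay Aa Py].
  by rewrite invg1.
by rewrite invgM (mulg1_eq (A2 Aa)); apply: PM => //; exact: genV.
Qed.

End Involutions.

End GeneratedSubgroups.

(** * Flags of coset systems whose diagram is a path forked at one end *)

Section ForkedDiagram.
Variables (n : nat) (G : groupType) (r : 'I_n.+1 -> G).
Implicit Types (S : pred 'I_n.+1) (J : {set 'I_n.+1}) (i j k l m : 'I_n.+1).
Hypothesis r2 : forall i, r i * r i = 1.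

Definition span S : set G := gen [set r j | j in [set j | S j]].
Definition cospan i : set G := span (fun j => j != i).

Lemma span_sub S S' : (forall i, S i -> S' i) -> span S `<=` span S'.
Proof. by move=> SS'; apply: gen_sub => _ [j /= Sj <-]; exists j => //; exact: SS'. Qed.

Lemma span_gen S i : S i -> span S (r i).
Proof. by move=> Si; apply: sub_gen; exists i. Qed.

Lemma span_ind S (P : G -> Prop) : P 1 ->
  (forall x i, span S x -> S i -> P x -> P (x * r i)) -> forall x, span S x -> P x.
Proof.
move=> P1 PM; have S2 a : [set r j | j in [set j | S j]] a -> a * a = 1.
  by move=> [i _ <-].
by apply: (gen_invol_ind S2 (P := P)) => // x _ Sx [i Si <-]; exact: PM.
Qed.

Hypothesis rC : forall l, 2 <= l -> forall i j, i < l -> l < j -> commute (r i) (r j).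

(** A missing generator [l] with [2 <= l] separates the diagram, so the
    generators before it commute with those after it. *)
Lemma span_split l S x : 2 <= l -> ~~ S l -> span S x ->
  exists a b, [/\ span (fun k => S k && (k < l)) a, span (fun k => l < k) b & x = a * b].
Proof.
move=> l2 Sl; move: x; apply: span_ind => [|x i _ Si [a [b [Sa Sb ->]]]].
  by exists 1, 1; split; rewrite ?mulg1 //; exact: gen1.
case: (ltngtP i l) => il.
- exists (a * r i), b; split=> //.
    by apply: genM => //; apply: (@span_gen (fun k => S k && (k < l))); rewrite Si.
  rewrite -!mulgA; congr (_ * _).
  by apply/esym; apply: gen_commute Sb => _ [j /= lj <-]; exact: rC il lj.
- exists a, (b * r i); split=> //; last by rewrite mulgA.
  by apply: genM => //; exact: (@span_gen (fun k => l < k)).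
- by move: Sl; rewrite -(val_inj il) Si.
Qed.

Hypothesis r_span : forall x, span xpredT x.
(** The four conditions below concern at most three types each; all other
    intersections and incidences reduce to them. *)
Hypothesis cap_up : forall l m x, l < m -> 2 <= m ->
  span (fun k => l < k) x -> cospan m x -> span (fun k => (l < k) && (k != m)) x.
Hypothesis cap01 : forall i j x, i = 0%N :> nat -> j = 1%N :> nat ->
  cospan i x -> cospan j x -> span (fun k => j < k) x.
Hypothesis cap1m : forall i m x, i = 1%N :> nat -> 2 <= m ->
  cospan i x -> cospan m x -> span (fun k => (k != i) && (k != m)) x.
Hypothesis triangle : forall i j m g h, i = 0%N :> nat -> j = 1%N :> nat -> 2 <= m ->
  cospan i g -> cospan j h -> cospan m (g / h) ->
  exists v, span (fun k => j < k) v /\ cospan m (v / h).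

(** Induction on a finite set of types, removing the largest type [m] and
    keeping track of the second largest one, [l]. *)
Lemma max_decomp (P : {set 'I_n.+1} -> Prop) : P finset.set0 ->
  (forall m, P [set m]%SET) ->
  (forall l m J, l \in J -> (forall j, j \in J -> j <= l) -> l < m -> P J ->
    P (m |: J)%SET) ->
  forall J, P J.
Proof.
move=> P0 P1 PU J.
suff h (p : nat) : forall J, (forall j, j \in J -> j < p) -> P J.
  by apply: (h n.+1) => j _.
elim: p => [|p IHp] {}J Jk.
  suff -> : J = finset.set0 by [].
  by apply/setP=> j; rewrite !inE; apply/negP => /Jk.
have [m /andP[Jm /eqP mp]|nJp] := pickP [pred m in J | m == p :> nat]; last first.
  apply: IHp => j Jj; have := Jk _ Jj; rewrite ltnS leq_eqVlt => /predU1P[jp|//].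
  by have := nJp j; rewrite /= Jj jp eqxx.
have J'p j : j \in (J :\ m)%SET -> j < p.
  rewrite !inE => /andP[jm /Jk]; rewrite ltnS leq_eqVlt => /predU1P[jp|//].
  by case/eqP: jm; apply: val_inj; rewrite /= mp.
rewrite -(finset.setD1K Jm).
have [->|[l0 Jl0]] := set_0Vmem (J :\ m)%SET; first by rewrite finset.setU0.
case: (arg_maxnP (fun j : 'I_n.+1 => j : nat) Jl0) => l Jl lmax.
apply: (PU l) => //; first by rewrite mp; exact: J'p.
exact: IHp.
Qed.

Lemma small_max l J : l < 2 -> l \in J -> (forall j, j \in J -> j <= l) ->
  J = [set l]%SET \/ l = 1%N :> nat /\ exists2 i : 'I_n.+1, i = 0%N :> nat & J = [set i; l]%SET.
Proof.
move=> l2 Jl lmax.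
have [z Jz|nJ] := pickP [pred j in J | j != l]; last first.
  left; apply/setP=> k; rewrite !inE; apply/idP/eqP => [Jk|-> //].
  by have := nJ k; rewrite /= Jk => /negbFE/eqP.
have {Jz} /andP[Jz zl] := Jz.
have zl' : z <> l :> nat by move/val_inj/eqP; rewrite (negPf zl).
right; have := lmax _ Jz => zlm; split; first by lia.
exists z; first by lia.
apply/setP=> k; rewrite !inE; apply/idP/orP => [Jk|[/eqP->|/eqP->]//].
have kl := lmax _ Jk; case: (k =P l) => [|kl']; first by right.
have kl'' : k <> l :> nat by move/val_inj.
by left; apply/eqP/val_inj => /=; lia.
Qed.

(** An element of the intersection for the types up to [l] splits at [l] into a
    part before [l], which lies in [cospan m], and a part after [l], to which
    [cap_up] applies.  When [l] is [0] or [1] there is nothing to split, and the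
    hypotheses on small types are used directly. *)
Lemma cospan_cap J x : (forall j, j \in J -> cospan j x) -> span (fun k => k \notin J) x.
Proof.
elim/max_decomp: J x => [x _|m x xm|l m J Jl lmax lm IHJ x xJ].
- by apply: span_sub (r_span x) => i _; rewrite inE.
- by apply: span_sub (xm m _) => [i|]; rewrite !inE.
have Jx : span (fun k => k \notin J) x.
  by apply: IHJ => j Jj; apply: xJ; rewrite !inE Jj orbT.
have Kmx : cospan m x by apply: xJ; rewrite !inE eqxx.
have [l2|l2] := leqP 2 l.
  have [|a [b [Sa Sb xab]]] := span_split l2 _ Jx; first by rewrite Jl.
  have Kma : cospan m a.
    apply: span_sub Sa => k /andP[_ kl]; rewrite -val_eqE /=; lia.
  have m2 : 2 <= m by lia.
  rewrite xab; apply: genM.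
    apply: span_sub Sa => k /andP[kJ kl]; rewrite !inE negb_or kJ andbT -val_eqE /=; lia.
  have Kmb : cospan m b by apply: genMl Kma _; rewrite -xab.
  apply: span_sub (cap_up lm m2 Sb Kmb) => k /andP[lk km].
  by rewrite !inE negb_or km /=; apply/negP => /lmax; lia.
have [Jl1|[l1 [i i0 Jil]]] := small_max l2 Jl lmax.
  have Klx : cospan l x by apply: xJ; rewrite !inE Jl orbT.
  have [l0|l1] := posnP l; last first.
    have l1' : l = 1%N :> nat by lia.
    apply: span_sub (cap1m l1' _ Klx Kmx); last by lia.
    by move=> k; rewrite Jl1 !inE negb_or andbC.
  have lx : span (fun k => l < k) x.
    apply: span_sub Klx => k; rewrite -val_eqE /=; lia.
  have [m2|m2] := leqP 2 m.
    apply: span_sub (cap_up lm m2 lx Kmx) => k /andP[lk km].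
    by rewrite Jl1 !inE negb_or km -val_eqE /=; lia.
  apply: span_sub (cap01 l0 _ Klx Kmx); last by lia.
  by move=> k mk; rewrite Jl1 !inE negb_or -!val_eqE /=; lia.
have Klx : cospan l x by apply: xJ; rewrite !inE Jl orbT.
have Kix : cospan i x by apply: xJ; rewrite Jil !inE eqxx orbT.
apply: span_sub (cap_up lm _ (cap01 i0 l1 Kix Klx) Kmx); last by lia.
by move=> k /andP[lk km]; rewrite Jil !inE !negb_or km -!val_eqE /=; lia.
Qed.

(** Let [x] be common to the cosets of the types up to [l], and [z] to those of
    types [l] and [m].  When [2 <= l], split [z / x] at [l]: its part before [l]
    lies in [cospan m], and its part after [l] lies in [cospan j] for each
    [j <= l], so the latter moves [x] into the last coset without leaving the
    others.  When the types are [0], [1] and [m], this is [triangle]. *)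
Lemma cosets_meet J (y : 'I_n.+1 -> G) :
  (forall i j, i \in J -> j \in J -> exists z, cospan i (z / y i) /\ cospan j (z / y j)) ->
  exists z, forall j, j \in J -> cospan j (z / y j).
Proof.
elim/max_decomp: J => [_|m ym|l m J Jl lmax lm IHJ yJ].
- by exists 1 => j; rewrite inE.
- have [z [zm _]] := ym m m (set11 m) (set11 m).
  by exists z => j; rewrite inE => /eqP ->.
have [|x xJ] := IHJ; first by move=> i j Ji Jj; apply: yJ; rewrite !inE ?Ji ?Jj orbT.
have mm : m \in (m |: J)%SET by rewrite !inE eqxx.
have [z [zl zm]] : exists z, cospan l (z / y l) /\ cospan m (z / y m).
  by apply: yJ; rewrite ?mm // !inE Jl orbT.
have [l2|l2] := leqP 2 l.
  have zx : cospan l (z / x).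
    have -> : z / x = (z / y l) / (x / y l) by rewrite invgF divgKA.
    by apply: genF => //; exact: xJ.
  have [|a [b [Sa Sb zab]]] := span_split l2 _ zx; first by rewrite eqxx.
  (* [b], the part of [z / x] after [l], lies in [cospan j] for all [j <= l] *)
  exists (b * x) => j; rewrite !inE => /predU1P[->|Jj].
    have -> : b * x / y m = a^-1 * (z / y m) by rewrite -(mulgVK x z) zab !mulgA mulVg mul1g.
    apply: genM zm; apply: genV; apply: span_sub Sa => k /andP[_ kl].
    rewrite -val_eqE /=; lia.
  rewrite -mulgA; apply: genM (xJ j Jj).
  apply: span_sub Sb => k; have := lmax j Jj; rewrite -val_eqE /=; lia.
have [Jl1|[l1 [i i0 Jil]]] := small_max l2 Jl lmax.
  by exists z => j; rewrite Jl1 !inE => /pred2P[]->.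
have Ji : i \in J by rewrite Jil !inE eqxx.
have [z' [zi' zm']] : exists z, cospan i (z / y i) /\ cospan m (z / y m).
  by apply: yJ; rewrite ?mm // !inE Ji orbT.
have xF j u : cospan j (x / y j) -> cospan j (u / y j) -> cospan j (u / x).
  move=> xj uj; have -> : u / x = (u / y j) / (x / y j) by rewrite invgF divgKA.
  exact: genF.
have [||v [Sv mv]] := triangle (m := m) i0 l1 _ (xF _ _ (xJ i Ji) zi') (xF _ _ (xJ l Jl) zl).
- by lia.
- have -> : z' / x / (z / x) = (z' / y m) / (z / y m) by rewrite !invgF !divgKA.
  exact: genF.
exists (v * x) => j; rewrite !inE => /predU1P[->|].
  have -> : v * x / y m = (v / (z / x)) * (z / y m).
    by rewrite invgF !mulgA mulgVK.
  exact: genM.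
rewrite -mulgA => Jj; apply: genM (xJ j Jj).
apply: span_sub Sv => k; have := lmax j Jj; rewrite -val_eqE /=; lia.
Qed.

End ForkedDiagram.

(** * The hypertope of a group generated by involutions *)

Section CosetHypertope.
Variables (n : nat) (G : groupType) (r : 'I_n.+1 -> G).
Local Notation I := 'I_n.+1.
Local Notation K := (cospan r).
Implicit Types (i j k : I) (x y z g : G) (J : set I).
Hypothesis r2 : forall i, r i * r i = 1.
Hypothesis r_neq1 : forall i, r i <> 1.
Hypothesis r_span : forall x, span r xpredT x.
(** The intersection property and the incidence property of the family [K]. *)
Hypothesis cap : forall (J : {set I}) x,
  (forall j, j \in J -> K j x) -> span r (fun k => k \notin J) x.
Hypothesis meet : forall (J : {set I}) (y : I -> G),
  (forall i j, i \in J -> j \in J -> exists z, K i (z / y i) /\ K j (z / y j)) ->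
  exists z, forall j, j \in J -> K j (z / y j).
Hypothesis Ksub : forall i, subgroup_set (K i).

Local Notation X := (coset_system Ksub).
Implicit Types (u v : X) (F : set X).

Definition coset_elt i x : X :=
  exist (fun z : I * set G => exists h, z.2 = rcoset (K z.1) h)
    (i, rcoset (K i) x) (ex_intro _ x erefl).

Lemma cospanV i x : K i x -> K i x^-1. Proof. exact: subgroupV. Qed.
Lemma cospanM i x y : K i x -> K i y -> K i (x * y). Proof. exact: subgroupM. Qed.
Lemma cospan1 i : K i 1. Proof. exact: subgroup1. Qed.
Lemma cospan_gen i j : j != i -> K i (r j). Proof. exact: span_gen. Qed.

Lemma cospanFC i x y : K i (x / y) -> K i (y / x).
Proof. by move=> /cospanV; rewrite invgF. Qed.

Lemma cospanF_trans i y x z : K i (x / y) -> K i (y / z) -> K i (x / z).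
Proof. by move=> xy /(cospanM xy); rewrite divgKA. Qed.

Lemma coset_eltE i x y : coset_elt i x = coset_elt i y <-> K i (x / y).
Proof.
split=> [[/(congr1 (fun A => A x))]|xy].
  rewrite propeqE => -[h _]; apply/rcosetE/h/rcosetE.
  by rewrite mulgV; exact: cospan1.
apply: eq_exist; congr (_, _); apply/seteqP; split=> z /rcosetE zx; apply/rcosetE.
  exact: cospanF_trans xy.
exact: cospanF_trans (cospanFC xy).
Qed.

Lemma coset_eltP u : exists x, u = coset_elt (type_of u) x.
Proof.
case: u => -[i A] [h Ah]; exists h; apply: eq_exist.
by congr (_, _); exact: Ah.
Qed.

Lemma incident_coset_elt i j x y : incident (coset_elt i x) (coset_elt j y) <->
  exists z, K i (z / x) /\ K j (z / y).
Proof.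
split=> [[z [/= /rcosetE zx /rcosetE zy]]|[z [zx zy]]]; exists z => //.
by split; apply/rcosetE.
Qed.

Lemma incident_same i j x : incident (coset_elt i x) (coset_elt j x).
Proof. by apply/incident_coset_elt; exists x; rewrite mulgV; split; exact: cospan1. Qed.

Lemma meet_set J (y : I -> G) :
  (forall i j, J i -> J j -> incident (coset_elt i (y i)) (coset_elt j (y j))) ->
  exists z, forall j, J j -> K j (z / y j).
Proof.
move=> yJ; have [|z zJ] := @meet [set i | `[< J i >]]%SET y.
  by move=> i j; rewrite !finset.inE => /asboolP Ji /asboolP Jj; exact/incident_coset_elt/yJ.
by exists z => j Jj; apply: zJ; rewrite finset.inE; apply/asboolP.
Qed.

Lemma cap_set J x : (forall j, J j -> K j x) -> span r (fun k => `[< ~ J k >]) x.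
Proof.
move=> xJ; have h : span r (fun k => k \notin [set i | `[< J i >]]%SET) x.
  by apply: cap => j; rewrite finset.inE => /asboolP; exact: xJ.
apply: span_sub h => k; rewrite finset.inE => h; apply/asboolP => Jk.
by move/asboolP: h; apply; exact: Jk.
Qed.

Lemma span_pred0 (S : pred I) x : (forall k, ~~ S k) -> span r S x -> x = 1.
Proof.
move=> S0; have h : span r S `<=` [set 1].
  apply: gen_min => [|a [i /= Si _]]; last by have := S0 i; rewrite Si.
  by split=> // u v /= -> ->; rewrite mulgV.
exact: h.
Qed.

Lemma span_pred1 (S : pred I) i x : (forall k, S k -> k = i) -> span r S x -> x = 1 \/ x = r i.
Proof.
move=> S0; move: x; apply: span_ind => //; first by left.
move=> x k _ /S0 -> [->|->]; first by right; rewrite mul1g.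
by left.
Qed.

Lemma cap_all x : (forall j, K j x) -> x = 1.
Proof. by move=> xK; apply: span_pred0 (@cap_set setT x _) => // k; apply/asboolPn => h; apply: h. Qed.

Lemma cap_all_but i x : (forall j, j <> i -> K j x) -> x = 1 \/ x = r i.
Proof.
move=> xK; have := @cap_set (~` [set i]) x; move=> /(_ (fun j ji => xK j ji)).
by apply: span_pred1 => k /asboolP/contrapT.
Qed.

Lemma gen_notin_cospan i : ~ K i (r i).
Proof.
move=> ri; apply: (@r_neq1 i); apply: cap_all => j.
by have [<-//|ij] := eqVneq i j; exact: cospan_gen.
Qed.

Lemma coset_elt_reflect i j x : j <> i -> coset_elt j (r i * x) = coset_elt j x.
Proof. by move=> /eqP ji; apply/coset_eltE; rewrite mulgK; apply: cospan_gen; rewrite eq_sym. Qed.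

Lemma coset_elt_reflect_neq i x : coset_elt i (r i * x) <> coset_elt i x.
Proof. by move=> /coset_eltE; rewrite mulgK; exact: gen_notin_cospan. Qed.

Definition coset_flag J x : set X := [set coset_elt j x | j in J].

Lemma types_coset_flag J x : types (coset_flag J x) = J.
Proof.
apply/seteqP; split=> [_ [_ [j Jj <-] <-] //|j Jj].
by exists (coset_elt j x) => //; exists j.
Qed.

Lemma coset_flag_flag J x : flag (coset_flag J x).
Proof. by move=> _ _ [i _ <-] [j _ <-]; exact: incident_same. Qed.

(** A flag is a family of pairwise meeting cosets, so [meet] gives a point
    common to all of them. *)
Lemma flag_coset_flag F : flag F -> exists x, F = coset_flag (types F) x.
Proof.
move=> fF; have /choice[y yF] : forall i, exists y, types F i -> F (coset_elt i y).
  move=> i; have [[u Fu ui]|nFi] := pselect (types F i); last by exists 1.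
  by have [y uy] := coset_eltP u; exists y => _; rewrite -ui -uy.
have [|z zF] := @meet_set (types F) y; first by move=> i j /yF Fi /yF Fj; exact: fF.
exists z; apply/seteqP; split=> [u Fu|_ [i Fi <-]].
  have Fi : types F (type_of u) by exists u.
  exists (type_of u) => //; have /coset_eltE -> := zF _ Fi.
  by apply: incident_type => //; apply: fF => //; exact: yF.
by have /coset_eltE -> := zF _ Fi; exact: yF.
Qed.

Lemma coset_flag_sub J J' x y : coset_flag J x `<=` coset_flag J' y ->
  forall j, J j -> K j (y / x).
Proof.
move=> xy j Jj; have [k _ e] : coset_flag J' y (coset_elt j x) by apply: xy; exists j.
by have kj : k = j := congr1 (@type_of _ _) e; subst k; apply/coset_eltE.
Qed.

Lemma chamber_coset_flag x : chamber (coset_flag setT x).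
Proof. by split; [exact: coset_flag_flag|exact: types_coset_flag]. Qed.

Lemma coset_geometry : geometry X.
Proof.
move=> F /flag_coset_flag[x ->]; exists (coset_flag setT x).
split; first exact: chamber_coset_flag.
by move=> _ [j _ <-]; exists j.
Qed.

(** The chambers containing the flag at [x] without type [i] are given by the
    elements of the intersection of the remaining subgroups, which is
    [{1, r i}]. *)
Lemma coset_thin : thin X.
Proof.
move=> F i /flag_coset_flag[x Fx] Fi; rewrite Fi in Fx.
exists (coset_flag setT x), (coset_flag setT (r i * x)); split.
  move=> e; apply: (@gen_notin_cospan i).
  have /coset_flag_sub/(_ i Logic.I) : coset_flag setT x `<=` coset_flag setT (r i * x) by rewrite e.
  by rewrite mulgK.
apply/seteqP; split=> [D [[fD tD] FD]|_ [|] ->].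
- have [y Dy] := flag_coset_flag fD; rewrite tD in Dy.
  have [j ji|yx|yx] := @cap_all_but i (y / x).
  + by rewrite Fx Dy in FD; exact: coset_flag_sub FD _ ji.
  + by left; rewrite Dy (divg1_eq yx).
  + by right; rewrite Dy -(mulgVK x y) yx.
- by split; [exact: chamber_coset_flag|rewrite Fx => _ [j _ <-]; exists j].
- split; [exact: chamber_coset_flag|rewrite Fx => _ [j ji <-]].
  by exists j => //; exact: coset_elt_reflect.
Qed.

(** The residue of the flag of type [J] at [x] consists of the cosets at [g x],
    with [g] a product of generators of types outside [J].  Multiplying [g] by
    one generator leaves all but one of these cosets in place, so two types
    outside [J] are enough to follow [g] step by step. *)
Lemma coset_residually_connected : residually_connected X.
Proof.
move=> F /flag_coset_flag[x Fx] [i1 [i2 [i12 [Ji1 Ji2]]]].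
move: (types F) => J in Fx Ji1 Ji2; rewrite Fx => {F Fx}.
set S := residue _.
have SP u : S u -> exists k g, [/\ ~ J k, span r (fun k => `[< ~ J k >]) g & u = coset_elt k (g * x)].
  move=> [Fu iu]; have Ju : ~ J (type_of u).
    move=> Ju; apply: Fu; exists (type_of u) => //.
    by apply: incident_type => //; apply: incident_sym; apply: iu; exists (type_of u).
  have [y uy] := coset_eltP u.
  have [|z zJ] := @meet_set (J `|` [set type_of u]) (fun j => if `[< J j >] then x else y).
    move=> i j; case: asboolP => [Ji _|nJi [//|->]]; case: asboolP => [Jj _|nJj [//|->]].
    - exact: incident_same.
    - by rewrite -uy; apply: incident_sym; apply: iu; exists i.
    - by rewrite -uy; apply: iu; exists j.
    - exact: incident_same.
  exists (type_of u), (z / x); split=> //.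
    by apply: cap_set => j Jj; have := zJ j (or_introl Jj); case: asboolP.
  rewrite mulgVK uy /=; apply/coset_eltE; apply: cospanFC.
  by have := zJ (type_of u) (or_intror erefl); case: asboolP.
have SE k g : ~ J k -> span r (fun k => `[< ~ J k >]) g -> S (coset_elt k (g * x)).
  move=> Jk Sg; split=> [[j Jj] e|_ [j Jj <-]].
    by apply: Jk; rewrite -[k]/(type_of (coset_elt k (g * x))) -e.
  have -> : coset_elt j x = coset_elt j (g * x); last exact: incident_same.
  apply/coset_eltE; apply: cospanFC; rewrite mulgK; apply: span_sub Sg => l /asboolP Jl.
  by apply/eqP => lj; apply: Jl; rewrite lj.
pose conn := clos_refl_trans X (fun u v => S u /\ S v /\ incident u v).
have same g i j : ~ J i -> ~ J j -> span r (fun k => `[< ~ J k >]) g ->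
    conn (coset_elt i (g * x)) (coset_elt j (g * x)).
  move=> Ji Jj Sg; apply: rt_step.
  by split; [exact: SE|split; [exact: SE|exact: incident_same]].
have to1 g : span r (fun k => `[< ~ J k >]) g -> forall k, ~ J k ->
    conn (coset_elt k (g * x)) (coset_elt k x) /\ conn (coset_elt k x) (coset_elt k (g * x)).
  have A2 a : [set r j | j in [set j | `[< ~ J j >]]] a -> a * a = 1 by move=> [j _ <-].
  move: g; apply: (gen_invol_indl A2 (P := fun g => forall k, ~ J k ->
    conn (coset_elt k (g * x)) (coset_elt k x) /\ conn (coset_elt k x) (coset_elt k (g * x)))).
    by move=> k _; rewrite mul1g; split; exact: rt_refl.
  move=> g _ Sg [m /asboolP Jm <-] IHg k Jk.
  have Smg : span r (fun k => `[< ~ J k >]) (r m * g).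
    by apply: genM => //; apply: (span_gen (S := fun k => `[< ~ J k >])); apply/asboolP.
  have [j Jj jm] : exists2 j, ~ J j & j <> m.
    have [e|/eqP] := eqVneq i1 m; [exists i2 => //|exists i1 => //].
    by move=> e2; apply: i12; rewrite e e2.
  have [gj jg] := IHg j Jj.
  have e : coset_elt j (r m * g * x) = coset_elt j (g * x).
    by rewrite -mulgA; exact: coset_elt_reflect.
  have s1 : span r (fun k => `[< ~ J k >]) 1 by exact: gen1.
  have := same _ _ _ Jk Jj s1; have := same _ _ _ Jj Jk s1; rewrite !mul1g => jk1 kj1.
  have jkg := same _ _ _ Jj Jk Smg; have kjg := same _ _ _ Jk Jj Smg.
  split.
    apply: rt_trans kjg _; rewrite e.
    exact: rt_trans gj jk1.
  apply: rt_trans jkg; rewrite e.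
  exact: rt_trans kj1 jg.
move=> u v Su Sv; have [i [g [Ji Sg ->]]] := SP u Su.
have [j [h [Jj Sh ->]]] := SP v Sv.
apply: rt_trans (to1 g Sg i Ji).1 _.
apply: rt_trans (to1 h Sh j Jj).2.
have s1 : span r (fun k => `[< ~ J k >]) 1 by exact: gen1.
by have := same _ _ _ Ji Jj s1; rewrite !mul1g.
Qed.

Lemma coset_translate_elt h i x :
  coset_translate h (coset_elt i x) = coset_elt i (x * h) :> X.
Proof. by apply: eq_exist; rewrite /= rcosetM. Qed.

Lemma coset_translateM g h u :
  coset_translate (g * h) u = coset_translate h (coset_translate g u) :> X.
Proof. by have [x ->] := coset_eltP u; rewrite !coset_translate_elt mulgA. Qed.

Lemma coset_translate1 u : coset_translate 1 u = u :> X.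
Proof. by have [x ux] := coset_eltP u; rewrite ux coset_translate_elt mulg1. Qed.

Lemma coset_translate_automorphism h : type_automorphism (coset_translate h : X -> X).
Proof.
split=> //.
  exists (coset_translate h^-1 : X -> X) => u.
    by rewrite -coset_translateM mulgV coset_translate1.
  by rewrite -coset_translateM mulVg coset_translate1.
move=> u v; have [x ux] := coset_eltP u; have [y vy] := coset_eltP v.
rewrite ux vy !coset_translate_elt !incident_coset_elt; split=> -[z [zx zy]].
  exists (z / h); rewrite !invgM !mulgA in zx zy.
  by split; rewrite -?mulgA in zx zy *.
by exists (z * h); rewrite !mulgKA.
Qed.

Lemma coset_flag_transitive : flag_transitive X.
Proof.
move=> F F' /flag_coset_flag[x ->] /flag_coset_flag[y ->]; rewrite !types_coset_flag => <-.
exists (coset_translate (x^-1 * y)); split; first exact: coset_translate_automorphism.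
have e j : coset_translate (x^-1 * y) (coset_elt j x) = coset_elt j y :> X.
  by rewrite coset_translate_elt mulVKg.
apply/seteqP; split=> [_ [_ [j Jj <-] <-]|_ [j Jj <-]]; first by rewrite e; exists j.
by exists (coset_elt j x) => //; exists j.
Qed.

Theorem coset_hypertope : regular_hypertope X.
Proof.
split; [exact: coset_geometry|exact: coset_thin|exact: coset_residually_connected|].
exact: coset_flag_transitive.
Qed.

(** An automorphism fixing a chamber fixes the chambers adjacent to it, since
    by thinness there is only one candidate for the image of each. *)
Lemma fix_chamber_adjacent (f : X -> X) x i : type_automorphism f ->
  (forall j, f (coset_elt j x) = coset_elt j x) ->
  forall j, f (coset_elt j (r i * x)) = coset_elt j (r i * x).
Proof.
move=> [/bij_inj fI ft finc] fx j.
have [->{j}|/eqP ji] := eqVneq j i; last by rewrite coset_elt_reflect.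
have [y] := coset_eltP (f (coset_elt i (r i * x))); rewrite ft /= => fy.
(* [y] represents the image of the one element that is not known to be fixed;
   that image is incident with the rest of the chamber at [x] *)
have h k : k != i -> incident (coset_elt k x) (coset_elt i y).
  move=> /eqP ki; have := incident_same k i (r i * x).
  by rewrite (coset_elt_reflect x ki) => /finc; rewrite fx fy.
have [|z zP] := @meet_set setT (fun j => if j == i then y else x).
  move=> k l _ _; case: (k =P i) => [->|/eqP ki]; case: (l =P i) => [->|/eqP li].
  - exact: incident_same.
  - by apply: incident_sym; exact: h.
  - exact: h.
  - exact: incident_same.
have [k ki|zx|zx] := @cap_all_but i (z / x).
- by have := zP k Logic.I; case: eqP.
- have := zP i Logic.I; rewrite eqxx (divg1_eq zx) => /coset_eltE; rewrite -fy -[LHS]fx.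
  by move/fI/esym/coset_elt_reflect_neq.
- have := zP i Logic.I; rewrite eqxx => /coset_eltE; rewrite fy => <-.
  by rewrite -zx mulgVK.
Qed.

Lemma fix_chamber_id (f : X -> X) : type_automorphism f ->
  (forall j, f (coset_elt j 1) = coset_elt j 1) -> f = id.
Proof.
move=> fA f1; apply/funext => u; have [x ->] := coset_eltP u.
have A2 a : [set r j | j in [set j | xpredT j]] a -> a * a = 1 by move=> [j _ <-].
move: (type_of u); have := r_span x; move: x.
apply: (gen_invol_indl A2 (P := fun x => forall j, f (coset_elt j x) = coset_elt j x)) => //.
by move=> x _ _ [i _ <-] fx; exact: fix_chamber_adjacent.
Qed.

(** A flag-transitive group of automorphisms is the full group, because an
    automorphism that fixes a chamber is the identity. *)
Theorem coset_automorphism_group :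
  automorphism_group_via (fun h => coset_translate h : X -> X).
Proof.
split=> [g h u|g h /= e|f]; first exact: coset_translateM.
  apply: divg1_eq; apply: cap_all => j; apply/coset_eltE.
  by rewrite -[g]mul1g -[h]mul1g -!coset_translate_elt e.
split=> [fA|[h ->]]; last exact: coset_translate_automorphism.
have fl : flag (f @` coset_flag setT 1).
  move=> _ _ [u Fu <-] [v Fv <-]; case: fA => _ _ ->.
  exact: (@coset_flag_flag setT 1).
have tl : types (f @` coset_flag setT 1) = setT.
  apply/seteqP; split=> // j _; exists (f (coset_elt j 1)); last by case: fA.
  by exists (coset_elt j 1) => //; exists j.
have [x fx] := flag_coset_flag fl; rewrite tl in fx.
have fE j : f (coset_elt j 1) = coset_elt j x.
  have : coset_flag setT x (f (coset_elt j 1)).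
    by rewrite -fx; exists (coset_elt j 1) => //; exists j.
  move=> [k _ e]; rewrite -e; congr (coset_elt _ x).
  by have := congr1 (@type_of _ _) e; case: fA => _ -> _.
exists x; have h : (fun u => coset_translate x^-1 (f u) : X) = id.
  apply: fix_chamber_id => [|j]; last by rewrite fE coset_translate_elt mulgV.
  have [[b bl br] t inc] := fA; have [[b' bl' br'] t' inc'] := coset_translate_automorphism x^-1.
  split=> [|u|u v].
  - by exists (b \o b') => u /=; rewrite ?bl' ?br ?bl ?br'.
  - by rewrite t' t.
  - by rewrite inc' inc.
apply/funext => u; have /(congr1 (coset_translate x)) := congr1 (fun f => f u) h.
by rewrite -coset_translateM mulVg coset_translate1.
Qed.

End CosetHypertope.

(** * The orthoplex group and its action on vertices *)

Lemma pres_gen_span (I : choiceType) (R : set (word I)) (x : presented_group R) :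
  gen (range (pres_gen R)) x.
Proof.
rewrite -(word_class_repr x) word_class_eval /eval_word.
have [s1 sF] := gen_subgroup (range (pres_gen R)).
elim/big_ind: _ => // [y z|[i b] _]; first exact: genM.
have ri : gen (range (pres_gen R)) (pres_gen R i) by apply: sub_gen; exists i.
by case: b; rewrite /eval_letter //=; exact: genV.
Qed.

Lemma pres_ind (I : choiceType) (R : set (word I)) (S : set (presented_group R)) :
  subgroup_set S -> (forall i, S (pres_gen R i)) -> forall x, S x.
Proof.
by move=> sS Si x; apply: gen_min sS _ _ (pres_gen_span x) => _ [i _ <-].
Qed.

Lemma morph1 (G H : groupType) (f : G -> H) : {morph f : x y / x * y} -> f 1 = 1.
Proof. by move=> fM; apply: (@mulgI _ (f 1)); rewrite -fM !mulg1. Qed.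

Lemma morphV (G H : groupType) (f : G -> H) :
  {morph f : x y / x * y} -> {morph f : x / x^-1}.
Proof. by move=> fM x; apply/esym/mulg1_eq; rewrite -fM mulgV morph1. Qed.

Lemma morphX (G H : groupType) (f : G -> H) m :
  {morph f : x y / x * y} -> {morph f : x / x ^+ m}.
Proof.
move=> fM x; elim: m => [|m IHm]; first by rewrite !expg0 morph1.
by rewrite !expgS fM IHm.
Qed.

(** The vertices [e_0, ..., e_{n-1}, -e_{n-1}, ..., -e_0] of the orthoplex are
    numbered by [0, ..., 2 n - 1] in this order.  A generator [i] with
    [i + 1 < n] exchanges the axes [i] and [i + 1]; for [i = n - 1] the two
    exchanges below coincide and negate the last axis. *)
Definition reflect n i p : nat :=
  if p == i then i.+1 else if p == i.+1 then i
  else if p == n.*2.-1 - i then n.*2.-2 - i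
  else if p == n.*2.-2 - i then n.*2.-1 - i else p.

(** Stated with additions only, so that nested applications of [reflect] are
    within reach of linear arithmetic. *)
Variant reflect_spec n i p : nat -> Type :=
| ReflectUp of p = i : reflect_spec n i p i.+1
| ReflectDown of p = i.+1 : reflect_spec n i p i
| ReflectUp' q of p + i.+2 = n.*2 & q = p.+1 : reflect_spec n i p q
| ReflectDown' q of p + i.+1 = n.*2 & p = q.+1 : reflect_spec n i p q
| ReflectFix of p <> i & p <> i.+1 & p + i.+2 <> n.*2 & p + i.+1 <> n.*2 :
    reflect_spec n i p p.

Lemma reflectP n i p : i < n -> reflect_spec n i p (reflect n i p).
Proof.
move=> ni; rewrite /reflect; case: (p =P i) => [->|h1]; first by constructor 1.
case: (p =P i.+1) => [|h2]; first by constructor 2.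
case: (p =P n.*2.-1 - i) => [|h3]; first by constructor 4; lia.
case: (p =P n.*2.-2 - i) => [|h4]; first by constructor 3; lia.
by constructor 5; lia.
Qed.

Ltac reflect_cases := repeat match goal with |- context [reflect ?n ?i ?p] =>
  lazymatch p with context [reflect] => fail | _ =>
    case: (@reflectP n i p ltac:(lia)) => *; try (exfalso; lia) end end.

Section Reflections.
Variable n : nat.

Lemma reflectK i p : i < n -> reflect n i (reflect n i p) = p.
Proof. by move=> ni; reflect_cases; lia. Qed.

Lemma reflect_lt i p : i < n -> p < n.*2 -> reflect n i p < n.*2.
Proof. by move=> ni pn; reflect_cases; lia. Qed.

Lemma reflect_anti i p : i < n -> p < n.*2 ->
  reflect n i (n.*2.-1 - p) = n.*2.-1 - reflect n i p.
Proof. by move=> ni pn; reflect_cases; lia. Qed.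

Lemma reflectC i j p : i.+1 < j -> j < n ->
  reflect n i (reflect n j p) = reflect n j (reflect n i p).
Proof. by move=> ij jn; reflect_cases; lia. Qed.

Lemma reflect_braid3 i p : i.+2 < n -> reflect n i (reflect n i.+1 (reflect n i p)) =
  reflect n i.+1 (reflect n i (reflect n i.+1 p)).
Proof. by move=> ni; reflect_cases; lia. Qed.

Lemma reflect_braid4 i p : i.+2 = n ->
  reflect n i (reflect n i.+1 (reflect n i (reflect n i.+1 p))) =
  reflect n i.+1 (reflect n i (reflect n i.+1 (reflect n i p))).
Proof. by move=> ni; reflect_cases; lia. Qed.

Definition reflect_ord (i : 'I_n) (x : 'I_n.*2) : 'I_n.*2 :=
  Ordinal (reflect_lt (ltn_ord i) (ltn_ord x)).

Lemma reflect_ordK i : involutive (reflect_ord i).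
Proof. by move=> x; apply: val_inj; exact: reflectK. Qed.

Definition reflect_perm (i : 'I_n) : {perm 'I_n.*2} := perm (inv_inj (reflect_ordK i)).

Lemma reflect_permE i x : reflect_perm i x = reflect n i x :> nat.
Proof. by rewrite permE. Qed.

Lemma reflect_perm2 i : reflect_perm i * reflect_perm i = 1.
Proof. by apply/permP => x; apply: val_inj; rewrite permM perm1 /= !reflect_permE reflectK. Qed.

Lemma reflect_perm_rel r :
  coxeter_rel (@orthoplex_coxeter n) r -> eval_word reflect_perm r = 1.
Proof.
move=> [i [j ->]]; rewrite eval_coxeter_rel /orthoplex_coxeter.
have [<-|ij] := eqVneq i j; first by rewrite expg1 reflect_perm2.
have {}ij : i <> j :> nat by move/val_inj/eqP; rewrite (negPf ij).
apply/permP => x; apply: val_inj; rewrite perm1 /=.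
case: ifP => [|ij1]; last first.
  rewrite expg2 !permM !reflect_permE.
  have in' := ltn_ord i; have jn' := ltn_ord j.
  have [ij'|ji'] : i.+1 < j \/ j.+1 < i by lia.
    by rewrite (@reflectC i j) // !reflectK.
  by rewrite -(@reflectC j i) // !reflectK.
move=> ij1; have in' := ltn_ord i; have jn' := ltn_ord j.
have {}ij1 : (j = i.+1 :> nat) \/ (i = j.+1 :> nat) by lia.
case: eqP => ijn; rewrite !expgS expg0 mulg1 !permM !reflect_permE.
  case: ij1 => e; rewrite e.
    by rewrite (@reflect_braid4 i) ?reflectK //; lia.
  by rewrite -(@reflect_braid4 j) ?reflectK //; lia.
case: ij1 => e; rewrite e.
  by rewrite [X in reflect _ _ (reflect _ _ (reflect _ _ X))]reflect_braid3 ?reflectK //; lia.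
by rewrite reflect_braid3 ?reflectK //; lia.
Qed.

End Reflections.

Section OrthoplexCosets.
Variable n : nat.
Local Notation O := (orthoplex_group n).
Implicit Types (g h v : O) (x y : 'I_n.*2) (i j k l m p : nat).

(** The generators of the orthoplex group, extended by [1] beyond the rank. *)
Definition orthoplex_nat_gen k : O := oapp (@orthoplex_gen n) 1 (insub k).
Local Notation t := orthoplex_nat_gen.

Lemma orthoplex_nat_genE (i : 'I_n) : t i = orthoplex_gen i.
Proof. by rewrite /t valK. Qed.

Lemma orthoplex_nat_genP k : (k < n /\ exists2 i : 'I_n, i = k :> nat & t k = orthoplex_gen i) \/
  (n <= k /\ t k = 1).
Proof.
rewrite /t; case: insubP => [i ki ik|]; first by left; split=> //; exists i.
by rewrite -leqNgt => nk; right.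
Qed.

Lemma nat_genX i j : i < n -> j < n -> (t i * t j) ^+
  (if i == j then 1%N else if (i.+1 == j) || (j.+1 == i) then
    if maxn i j == n.-1 then 4 else 3 else 2) = 1.
Proof.
move=> ni nj; have := coxeter_genX (@orthoplex_coxeter n) (Ordinal ni) (Ordinal nj).
by rewrite (orthoplex_nat_genE (Ordinal ni) : t i = _) (orthoplex_nat_genE (Ordinal nj) : t j = _).
Qed.

Lemma nat_gen2 k : t k * t k = 1.
Proof.
have [nk|nk] := ltnP k n; first by have := nat_genX nk nk; rewrite eqxx expg1.
by have [[]|[_ ->]] := orthoplex_nat_genP k; [lia|rewrite mulg1].
Qed.

Lemma nat_genK k : involutive (fun g => g * t k).
Proof. by move=> g; rewrite -mulgA nat_gen2 mulg1. Qed.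

Lemma nat_genV k : (t k)^-1 = t k.
Proof. by apply: mulg1_eq; exact: nat_gen2. Qed.

Lemma nat_gen_commute i j : i.+1 < j -> commute (t i) (t j).
Proof.
move=> ij; have [nj|nj] := ltnP j n; last first.
  by have [[]|[_ ->]] := orthoplex_nat_genP j; [lia|exact: commute1].
have := nat_genX (i := i) _ nj; rewrite (_ : (i == j) = false); last by lia.
rewrite (_ : _ || _ = false); last by lia.
move=> /(_ ltac:(lia)); rewrite expg2 => h.
by rewrite /commute -(mulg1_eq h) invgM !nat_genV.
Qed.

Lemma nat_gen_braid3 i : i.+2 < n -> t i * t i.+1 * t i = t i.+1 * t i * t i.+1.
Proof.
move=> ni; have := @nat_genX i i.+1 ltac:(lia) ltac:(lia).
rewrite (_ : (i == i.+1) = false); last by lia.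
rewrite eqxx /= (_ : maxn _ _ == _ = false); last by lia.
rewrite !expgS expg0 mulg1 => h.
have {h}h : t i * t i.+1 * t i * (t i.+1 * t i * t i.+1) = 1 by rewrite !mulgA in h *.
by rewrite -(mulg1_eq h) !invgM !nat_genV mulgA.
Qed.

Lemma nat_gen_braid4 i : i.+2 = n -> t i * t i.+1 * t i * t i.+1 = t i.+1 * t i * t i.+1 * t i.
Proof.
move=> ni; have := @nat_genX i i.+1 ltac:(lia) ltac:(lia).
rewrite (_ : (i == i.+1) = false); last by lia.
rewrite eqxx /= (_ : maxn _ _ == _); last by lia.
rewrite !expgS expg0 mulg1 => h.
have {h}h : t i * t i.+1 * t i * t i.+1 * (t i * t i.+1 * t i * t i.+1) = 1.
  by rewrite !mulgA in h *.
by rewrite -(mulg1_eq h) !invgM !nat_genV !mulgA.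
Qed.

(** The vertices [0, 1, ..., 2 n - 1] in this order form a walk along edges of
    the orthoplex, except for the step between the antipodes [n - 1] and [n];
    its [j]-th step is made by the generator [walk j]. *)
Definition walk_idx j : nat := if j < n then j else n.*2.-2 - j.
Definition walk j : O := t (walk_idx j).
Definition walk_prod l p : O := \prod_(l <= j < p) walk j.

(** The subgroup that evidently fixes the first [l] vertices. *)
Definition tail_set l : set O := gen [set t k | k in [set k | l <= k < n]].

Lemma walk_prodSr l p : l <= p -> walk_prod l p.+1 = walk_prod l p * walk p.
Proof. by move=> lp; rewrite /walk_prod big_nat_recr. Qed.

Lemma walk_prod_cat l m p : l <= m -> m <= p ->
  walk_prod l p = walk_prod l m * walk_prod m p.
Proof. by move=> lm mp; rewrite /walk_prod (big_cat_nat _ (n := m)). Qed.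

Lemma walk_prod_commute i l p : (forall j, l <= j -> j < p -> commute (t i) (walk j)) ->
  commute (t i) (walk_prod l p).
Proof.
move=> h; rewrite /walk_prod big_seq_cond; apply: commute_prod => j.
by rewrite mem_index_iota andbT => /andP[]; exact: h.
Qed.

Lemma walk_commute i j : i.+1 < walk_idx j \/ (walk_idx j).+1 < i -> commute (t i) (walk j).
Proof. by case=> ij; [exact: nat_gen_commute|apply/commute_sym; exact: nat_gen_commute]. Qed.

Lemma walk_lt j : j < n -> walk j = t j.
Proof. by rewrite /walk /walk_idx => ->. Qed.

Lemma walk_ge i j : i < n -> j + i.+2 = n.*2 -> walk j = t i.
Proof. by move=> ni ij; rewrite /walk /walk_idx; case: ifP => jn; congr t; lia. Qed.

(** The letters [t i] and [t i.+1] occur consecutively in the walk, so the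
    braid relation carries [t i] across them, and it commutes with the rest. *)
Lemma walk_shift l i p : l <= i -> i.+1 < p -> p + i.+2 < n.*2 ->
  walk_prod l p * t i = t i.+1 * walk_prod l p.
Proof.
move=> li ip pi; have i2n : i.+2 < n by lia.
rewrite (@walk_prod_cat l i.+2) //; last by lia.
rewrite !walk_prodSr ?walk_lt //; [|lia|lia|lia].
have cY : commute (t i) (walk_prod i.+2 p).
  apply: walk_prod_commute => j ij jp; apply: walk_commute; rewrite /walk_idx.
  by case: ifP; lia.
have cX : commute (t i.+1) (walk_prod l i).
  by apply: walk_prod_commute => j ij jp; rewrite walk_lt; [apply/commute_sym/nat_gen_commute|]; lia.
rewrite -!mulgA -cY !mulgA cX -(mulgA _ _ (t i)) -!mulgA; congr (_ * _).
by rewrite !mulgA nat_gen_braid3.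
Qed.

(** The coset enumeration: if the endpoint [p] of the walk is moved by the
    generator, the walk is prolonged or shortened by one letter, and otherwise
    the braid and commutation relations carry the generator to the front of the
    walk, where it becomes a generator of index larger than [l]. *)
Lemma walk_step l i p : i < n -> l <= i -> l <= p -> p + l < n.*2 ->
  exists2 v, tail_set l.+1 v & walk_prod l p * t i = v * walk_prod l (reflect n i p).
Proof.
move=> ni li lp pl; have tt k : l < k -> k < n -> tail_set l.+1 (t k).
  by move=> lk kn; apply: sub_gen; exists k => //=; rewrite lk.
case: (reflectP p ni) => [->|->|q pi ->|q pi pq|p1 p2 p3 p4].
- by exists 1; [exact: gen1|rewrite walk_prodSr // walk_lt // mul1g].
- by exists 1; [exact: gen1|rewrite walk_prodSr // walk_lt // mul1g nat_genK].
- by exists 1; [exact: gen1|rewrite walk_prodSr // (walk_ge ni) // mul1g].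
- exists 1; [exact: gen1|rewrite pq walk_prodSr; last by lia].
  by rewrite (walk_ge ni) ?nat_genK ?mul1g //; lia.
have [pi|pi|pi] := ltngtP p i; last by [].
  exists (t i); first by apply: tt => //; lia.
  apply/commute_sym; apply: walk_prod_commute => j lj jp.
  by rewrite walk_lt; [apply/commute_sym/nat_gen_commute|]; lia.
have [ppi|ppi] := ltnP (p + i.+2) n.*2.
  by exists (t i.+1); [apply: tt; lia|rewrite walk_shift //; lia].
exists (t i); first by apply: tt => //; lia.
(* the walk passes [t i] and [t i.-1] consecutively on its way back, from step
   [a] on *)
pose a := n.*2 - i.+2.
have e1 : walk a = t i by apply: walk_ge => //; rewrite /a; lia.
have e2 : walk a.+1 = t i.-1 by apply: walk_ge; rewrite /a; lia.
rewrite (@walk_prod_cat l a.+2); [|rewrite /a; lia|rewrite /a; lia].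
rewrite !walk_prodSr ?e1 ?e2; [|rewrite /a; lia|rewrite /a; lia].
have cY : commute (t i) (walk_prod a.+2 p).
  apply: walk_prod_commute => j ij jp; apply: walk_commute; rewrite /walk_idx.
  by move: ij; rewrite /a; case: ifP; lia.
rewrite -!mulgA -cY !mulgA; congr (_ * _).
have [ni1|ni1] := ltnP i.+1 n.
  have X : walk_prod l a * t i.-1 = t i * walk_prod l a.
    by rewrite walk_shift ?prednK //; rewrite /a; lia.
  rewrite -X -!mulgA; congr (_ * _).
  have i0 : 0 < i by lia.
  by have := @nat_gen_braid3 i.-1; rewrite prednK // !mulgA => ->.
have an : a = i.-1.+1 by rewrite /a; lia.
rewrite an walk_prodSr; last by lia.
rewrite walk_lt; last by lia.
have cX : commute (t i) (walk_prod l i.-1).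
  by apply: walk_prod_commute => j lj jp; rewrite walk_lt; [apply/commute_sym/nat_gen_commute|]; lia.
rewrite !mulgA cX -!mulgA; congr (_ * _).
have i0 : 0 < i by lia.
by have := @nat_gen_braid4 i.-1; rewrite prednK // !mulgA => ->; [|lia].
Qed.

Lemma reflect_range l i p : i < n -> l <= i -> l <= p -> p + l < n.*2 ->
  (l <= reflect n i p) && (reflect n i p + l < n.*2).
Proof. by move=> ni li lp pl; reflect_cases; lia. Qed.

Lemma tail_setS l : tail_set l.+1 `<=` tail_set l.
Proof.
apply: gen_sub => _ [k /= /andP[lk kn] <-]; exists k => //=; rewrite kn andbT; lia.
Qed.

Lemma tail_walk l g : l < n -> tail_set l g -> exists v p,
  [/\ tail_set l.+1 v, l <= p, p + l < n.*2 & g = v * walk_prod l p].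
Proof.
move=> ln; have A2 a : [set t k | k in [set k | l <= k < n]] a -> a * a = 1.
  by move=> [k _ <-]; exact: nat_gen2.
move: g; apply: (gen_invol_ind A2 (P := fun g => exists v p,
  [/\ tail_set l.+1 v, l <= p, p + l < n.*2 & g = v * walk_prod l p])).
  exists 1, l; split=> //; [exact: gen1|lia|].
  by rewrite /walk_prod big_geq // mulg1.
move=> _ _ _ [i /= /andP[li ni] <-] [v [p [lv lp pl ->]]].
have [v' lv' e] := walk_step ni li lp pl.
have /andP[lr rl] := reflect_range ni li lp pl.
exists (v * v'), (reflect n i p); split=> //; first exact: genM.
by rewrite -mulgA e mulgA.
Qed.

Lemma tail_set0 g : tail_set 0 g.
Proof.
apply: pres_ind (gen_subgroup _) _ g => i; apply: sub_gen; exists i => //=.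
by rewrite orthoplex_nat_genE.
Qed.

Lemma orthoplex_stabE : orthoplex_stab n = tail_set 1.
Proof.
apply/seteqP; split; apply: gen_sub => _ [k /= kn <-].
  by exists k => /=; rewrite ?kn ?ltn_ord // orthoplex_nat_genE.
have /andP[k0 kn'] := kn.
by exists (Ordinal kn') => //=; rewrite -orthoplex_nat_genE.
Qed.

(** * The stabilizers of vertices *)

Definition vertex_perm g : {perm 'I_n.*2} := pres_lift (@reflect_perm n) g.

Lemma vertex_permM g h : vertex_perm (g * h) = vertex_perm g * vertex_perm h.
Proof. exact: (pres_liftM (@reflect_perm_rel n)). Qed.

Definition move g x : 'I_n.*2 := vertex_perm g x.

Lemma moveM g h x : move (g * h) x = move h (move g x).
Proof. by rewrite /move vertex_permM permM. Qed.

Lemma move1 x : move 1 x = x.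
Proof. by rewrite /move (morph1 vertex_permM) perm1. Qed.

Lemma moveK g : cancel (move g) (move g^-1).
Proof. by move=> x; rewrite -moveM mulgV move1. Qed.

Lemma moveVK g : cancel (move g^-1) (move g).
Proof. by move=> x; rewrite -moveM mulVg move1. Qed.

Lemma move_gen i x : i < n -> move (t i) x = reflect n i x :> nat.
Proof.
move=> ni; rewrite (orthoplex_nat_genE (Ordinal ni) : t i = _).
rewrite /move /vertex_perm [pres_lift _ _](pres_lift_gen (@reflect_perm_rel n)).
exact: reflect_permE.
Qed.

Lemma move_subgroup (S : set 'I_n.*2) :
  subgroup_set [set g | forall x, S (move g x) <-> S x].
Proof.
split=> [x|g h Sg Sh x]; first by rewrite move1.
by rewrite /= moveM -(Sh (move h^-1 _)) moveVK; exact: Sg.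
Qed.

Lemma tail_set_fix l g x : tail_set l g -> (x < l \/ n.*2 <= x + l) -> move g x = x.
Proof.
move=> lg xl; move: g lg; pose S := [set g | move g x = x].
have sS : subgroup_set S.
  split=> [|g h]; first exact: move1.
  by rewrite /S /= => gx hx; rewrite moveM gx -{1}hx moveK.
apply: (gen_min sS) => _ [k /= /andP[lk kn] <-]; apply: val_inj.
by rewrite /= move_gen //; have := ltn_ord x; reflect_cases; lia.
Qed.

Lemma move_walk l p x y : l <= p -> x = l :> nat -> y = p :> nat ->
  move (walk_prod l p) x = y.
Proof.
move=> lp xl yp; apply: val_inj; rewrite /= yp; have := ltn_ord y; rewrite {}yp => pn.
move: p lp pn; elim=> [|p IHp].
  rewrite leqn0 => /eqP l0 _; rewrite /walk_prod big_geq ?l0 // move1; lia.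
rewrite leq_eqVlt => /predU1P[<- _|lp pn]; first by rewrite /walk_prod big_geq // move1 xl.
rewrite walk_prodSr // moveM /walk move_gen; last by rewrite /walk_idx; case: ifP; lia.
rewrite IHp //; last by lia.
rewrite /walk_idx; case: ifP => pn'; reflect_cases; lia.
Qed.

(** The endpoint of the walk is determined by the action, as the walk is
    preceded by an element fixing its origin. *)
Lemma tail_set_walk l g (x : 'I_n.*2) : l < n -> x = l :> nat -> tail_set l g ->
  exists2 v, tail_set l.+1 v & [/\ l <= move g x, move g x + l < n.*2 &
    g = v * walk_prod l (move g x)].
Proof.
move=> ln xl lg; have [v [p [lv lp pl ge]]] := tail_walk ln lg.
have pn : p < n.*2 by lia.
have gx : move g x = Ordinal pn.
  rewrite ge moveM (tail_set_fix lv); last by left; rewrite xl.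
  exact: move_walk.
by exists v => //; rewrite gx.
Qed.

Lemma tail_set_stab l g (x : 'I_n.*2) : l < n -> x = l :> nat -> tail_set l g ->
  move g x = x -> tail_set l.+1 g.
Proof.
move=> ln xl lg gx; have [v lv [_ _ ->]] := tail_set_walk ln xl lg.
by rewrite gx xl /walk_prod big_geq // mulg1.
Qed.

Lemma move_rev g x : move g (rev_ord x) = rev_ord (move g x).
Proof.
pose S := [set g | forall x, move g (rev_ord x) = rev_ord (move g x)].
suff : S g by apply.
have := tail_set0 g; move: g; apply: gen_min => [|_ [k /= kn <-] x0].
  split=> [y|g h Sg Sh y]; first by rewrite !move1.
  rewrite !moveM Sg; apply: (can_inj (moveK h)).
  by rewrite moveVK Sh moveVK.
have r0 (y : 'I_n.*2) : rev_ord y = (n.*2.-1 - y)%N :> nat by rewrite /=; lia.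
by apply: val_inj; rewrite /= move_gen // r0 reflect_anti // move_gen //; lia.
Qed.

(** Membership in a parabolic subgroup can be read off from the action.  The
    walk from [l] to the image of [l] does not leave the first [m] vertices, so
    it avoids the generator [m.-1]; dividing by it leaves an element that also
    fixes the vertex [l]. *)
Lemma tail_set_block l m g : l < m -> m <= n -> tail_set l g ->
  (forall x, move g x < m <-> x < m) ->
  gen [set t k | k in [set k | (l <= k < n) && (k != m.-1)]] g.
Proof.
move=> lm mn; have [d ld] : exists d, m = (l + d).+1 by exists (m - l).-1; lia.
elim: d => [|d IHd] in l lm ld g * => lg gm.
  have l2n : l < n.*2 by lia.
  have [v lv [le1 _ ->]] := @tail_set_walk l g (Ordinal l2n) ltac:(lia) erefl lg.
  have := gm (Ordinal l2n); rewrite /= lm => -[_ /(_ isT) le2].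
  rewrite /walk_prod big_geq; last by lia.
  rewrite mulg1; apply: gen_sub lv => _ [k /= /andP[lk kn] <-]; exists k => //=.
  by rewrite kn; lia.
have l2n : l < n.*2 by lia.
have [v lv [le1 _ ge]] := @tail_set_walk l g (Ordinal l2n) ltac:(lia) erefl lg.
have := gm (Ordinal l2n); rewrite /= lm => -[_ /(_ isT) le2].
set p := nat_of_ord (move g _) in le1 le2 ge.
have sm := @move_subgroup [set x : 'I_n.*2 | x < m].
have Rs : gen [set t k | k in [set k | (l <= k < n) && (k != m.-1)]] (walk_prod l p).
  rewrite /walk_prod big_seq; elim/big_ind: _ => [||j]; [exact: gen1|by move=> ? ?; exact: genM|].
  rewrite mem_index_iota => /andP[lj jp]; rewrite walk_lt; last by lia.
  by apply: sub_gen; exists j => //=; lia.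
have Rm x : move (walk_prod l p) x < m <-> x < m.
  move: x; apply: gen_min sm _ _ Rs => _ [k /= /andP[/andP[lk kn] km] <-] x.
  by rewrite move_gen //; reflect_cases; lia.
have vm x : move v x < m <-> x < m by have := gm x; rewrite {1}ge moveM Rm.
rewrite ge; apply: genM Rs.
apply: gen_sub (IHd l.+1 _ _ _ lv vm) => [_ [k /= /andP[/andP[lk kn] km] <-]||]; [|lia|lia].
by exists k => //=; lia.
Qed.

Lemma move_prod_gen m (x y : 'I_n.*2) : m <= n -> y = x.+1 :> nat -> n <= x ->
  move (\prod_(0 <= j < m) t j) x = if n.*2.-1 - x <= m then y else x.
Proof.
move=> mn yx nx; elim: m mn => [|m IHm] mn.
  by rewrite big_geq // move1; case: ifP => //; have := ltn_ord y; lia.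
rewrite big_nat_recr //= moveM IHm; last by lia.
apply: val_inj; rewrite /= move_gen //.
by have := ltn_ord y; case: ifP => h1; case: ifP => h2; reflect_cases; lia.
Qed.

(** One Coxeter element sends [e_0] to [-e_{n-1}] and each [-e_k] to [-e_{k-1}],
    so its [n]-th power sends [e_0] to [-e_0]. *)
Lemma move_central (x : 'I_n.*2) : x = 0%N :> nat -> move (orthoplex_central n) x = rev_ord x.
Proof.
move=> x0; have n0 : 0 < n by have := ltn_ord x; lia.
have -> : orthoplex_central n = (\prod_(0 <= j < n) t j) ^+ n.
  by rewrite big_mkord /orthoplex_central; congr (_ ^+ _); apply: eq_bigr => i _; rewrite orthoplex_nat_genE.
set c := \prod_(_ <= _ < _) _.
have h d : d < n -> move (c ^+ d.+1) x = n + d :> nat.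
  elim: d => [|d IHd] dn.
    have n2 : n < n.*2 by lia.
    rewrite expg1 addn0 (_ : c = walk_prod 0 n).
      by rewrite (@move_walk 0 n x (Ordinal n2)).
    by rewrite /walk_prod; apply: eq_big_nat => j jn; rewrite walk_lt.
  have dn' : d < n by lia.
  have dd : n + d.+1 < n.*2 by lia.
  rewrite expgSr moveM (@move_prod_gen n _ (Ordinal dd)) //=; rewrite ?IHd //; try lia.
  by case: ifP => //=; lia.
apply: val_inj; rewrite /= x0.
have -> : c ^+ n = c ^+ n.-1.+1 by rewrite prednK.
by rewrite h; lia.
Qed.

End OrthoplexCosets.

(** * Finite cardinality by explicit enumeration *)

(** Keeping the enumeration by a finite type makes products and transports
    along injections immediate. *)
Definition has_card (T : Type) (A : set T) (m : nat) : Prop :=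
  exists (F : finType) (f : F -> T), [/\ injective f, range f = A & #|F| = m].

(** * Dihedral groups *)

Section Dihedral.
Variable s : nat.
Hypothesis s_ge2 : 2 <= s.

Definition dihedral_coxeter (b b' : bool) : nat := if b == b' then 1%N else s.
Definition dihedral : groupType := coxeter_group dihedral_coxeter.
Definition dihedral_gen b : dihedral := coxeter_gen dihedral_coxeter b.
Local Notation d := dihedral_gen.

Lemma dihedral_gen2 b : d b * d b = 1.
Proof. by have := coxeter_genX dihedral_coxeter b b; rewrite /dihedral_coxeter eqxx expg1. Qed.

Lemma dihedral_genX b : (d b * d (~~ b)) ^+ s = 1.
Proof. by have := coxeter_genX dihedral_coxeter b (~~ b); rewrite /dihedral_coxeter; case: b. Qed.

Definition dihedral_elt (x : bool * 'I_s) : dihedral :=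
  d true ^+ x.1 * (d false * d true) ^+ x.2.

(** Multiplying an alternating word by a generator on the right reverses the
    rotation part and toggles the reflection part. *)
Lemma dihedral_elt_surj (x : dihedral) : exists y, dihedral_elt y = x.
Proof.
pose c := d false * d true; have cs : c ^+ s = 1 := dihedral_genX false.
have aV : (d true)^-1 = d true by apply: mulg1_eq; exact: dihedral_gen2.
have fV : (d false)^-1 = d false by apply: mulg1_eq; exact: dihedral_gen2.
have ca i : i <= s -> c ^+ i * d true = d true * c ^+ (s - i).
  move=> si; have -> : c ^+ (s - i) = c ^- i.
    by apply/esym/mulg1_eq; rewrite -expgnDr subnKC.
  rewrite -expVgn; have -> : c^-1 = c ^ d true.
    by rewrite /c /conjg invgM aV fV -!mulgA dihedral_gen2 mulg1.
  by rewrite -conjXg -conjgC.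
have cX i : exists j : 'I_s, c ^+ i = c ^+ j.
  have s0 : 0 < s by lia.
  exists (Ordinal (ltn_pmod i s0)) => /=.
  by rewrite {1}(divn_eq i s) expgnDr mulnC expgnA cs expg1n mul1g.
have ba (b : bool) : d true ^+ b * d true = d true ^+ (~~ b).
  by case: b; rewrite ?expg1 ?expg0 ?mul1g // dihedral_gen2.
have A2 a : range d a -> a * a = 1 by move=> [b _ <-]; exact: dihedral_gen2.
move: x (pres_gen_span x).
apply: (gen_invol_ind A2 (P := fun x => exists y, dihedral_elt y = x)).
  have [j j0] := cX 0; exists (false, j).
  by rewrite /dihedral_elt /= expg0 mul1g -/c -j0.
move=> _ _ _ [e _ <-] [[b i] <-]; rewrite /dihedral_elt /= -/c.
have is' := ltn_ord i; case: e.
  have [j ij] := cX (s - i); exists (~~ b, j).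
  by rewrite /= -ij -mulgA ca; [rewrite mulgA ba|lia].
have [j ij] := cX (s - i.+1); exists (~~ b, j).
have -> : d false = c * d true by rewrite /c -mulgA dihedral_gen2 mulg1.
by rewrite /= -ij -mulgA (mulgA (c ^+ i)) -expgSr ca ?mulgA ?ba.
Qed.

(** The dihedral group acts on the vertices of a [2 s]-gon by [x |-> 1 - x] and
    [x |-> - 1 - x], and no element but [1] fixes a vertex. *)
Definition polygon_flip x : nat := if x <= 1 then 1 - x else s.*2.+1 - x.

Lemma polygon_flip_lt x : x < s.*2 -> polygon_flip x < s.*2.
Proof. by rewrite /polygon_flip; case: ifP; lia. Qed.

Definition polygon_flip_ord (x : 'I_s.*2) : 'I_s.*2 := Ordinal (polygon_flip_lt (ltn_ord x)).

Lemma polygon_flip_ordK : involutive polygon_flip_ord.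
Proof.
move=> x; apply: val_inj => /=; have := ltn_ord x; rewrite /polygon_flip.
by case: ifP; case: ifP; lia.
Qed.

Definition polygon_perm (b : bool) : {perm 'I_s.*2} :=
  if b then perm (inv_inj polygon_flip_ordK) else perm (@rev_ord_inj s.*2).

Lemma polygon_perm2 b : polygon_perm b * polygon_perm b = 1.
Proof.
by apply/permP => x; rewrite permM perm1 /polygon_perm; case: b; rewrite !permE ?polygon_flip_ordK ?rev_ordK.
Qed.

Lemma polygon_rotation i x :
  ((polygon_perm false * polygon_perm true) ^+ i) x = (x + i.*2) %% s.*2 :> nat.
Proof.
elim: i => [|i IHi]; first by rewrite expg0 perm1 addn0 modn_small.
rewrite expgSr permM; set y := fun_of_perm _ x in IHi *.
have -> : x + i.+1.*2 = x + i.*2 + 2 by lia.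
rewrite -modnDml -IHi permM /polygon_perm !permE /= /polygon_flip.
have := ltn_ord y; case: ifP => h yn.
  have -> : y + 2 = s.*2 + (y + 2 - s.*2) by lia.
  by rewrite modnDl modn_small; lia.
by rewrite modn_small; lia.
Qed.

Lemma polygon_perm_rel r :
  coxeter_rel dihedral_coxeter r -> eval_word polygon_perm r = 1.
Proof.
have h : (polygon_perm false * polygon_perm true) ^+ s = 1.
  apply/permP => x; apply: val_inj; rewrite perm1 /= polygon_rotation.
  by rewrite modnDr modn_small.
move=> [b [b' ->]]; rewrite eval_coxeter_rel /dihedral_coxeter.
case: b b' => [] []; [exact: (polygon_perm2 true)| |exact: h|exact: (polygon_perm2 false)].
have hx i : (polygon_perm true * polygon_perm false) ^+ i *
    (polygon_perm false * polygon_perm true) ^+ i = 1.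
  elim: i => [|i IHi]; first by rewrite mulg1.
  rewrite expgSr [X in _ * X]expgS mulgA -(mulgA (_ ^+ i)).
  rewrite (mulgA (polygon_perm true * _)) -(mulgA (polygon_perm true)).
  by rewrite polygon_perm2 mulg1 polygon_perm2 mulg1.
by have := hx s; rewrite h mulg1.
Qed.

Definition polygon_value (x : dihedral) : nat :=
  pres_lift polygon_perm x (Ordinal (ltac:(lia) : 0 < s.*2)).

Lemma polygon_liftM : {morph @pres_lift _ (coxeter_rel dihedral_coxeter) _ polygon_perm : x y / x * y}.
Proof. exact: pres_liftM polygon_perm_rel. Qed.

Lemma polygon_value_elt x : polygon_value (dihedral_elt x) = x.1 + x.2.*2.
Proof.
case: x => b i; rewrite /polygon_value /dihedral_elt /= polygon_liftM permM.
have G e : pres_lift polygon_perm (d e) = polygon_perm e := pres_lift_gen polygon_perm_rel e.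
have Pb (x : 'I_s.*2) : x = 0%N :> nat -> (polygon_perm true ^+ b) x = b :> nat.
  move=> x0; case: b; last by rewrite expg0 perm1.
  by rewrite -[_ ^+ _]/(polygon_perm true) /polygon_perm permE /= /polygon_flip x0.
rewrite !(morphX _ polygon_liftM) polygon_liftM !G polygon_rotation Pb // modn_small //.
by have := ltn_ord i; case: (b) => /=; lia.
Qed.

Lemma dihedral_elt_inj : injective dihedral_elt.
Proof.
move=> [b i] [b' i'] /(congr1 polygon_value); rewrite !polygon_value_elt /= => e.
by congr (_, _); [case: b b' e => [] []|apply: val_inj; case: b b' e => [] []] => //=; lia.
Qed.

Lemma dihedral_card : has_card [set: dihedral] (s * 2).
Proof.
exists (bool * 'I_s)%type, dihedral_elt; split; first exact: dihedral_elt_inj.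
  by apply/seteqP; split=> // x _; have [y <-] := dihedral_elt_surj x; exists y.
by rewrite card_prod card_bool card_ord mulnC.
Qed.

Lemma polygon_value_gen b : polygon_value (d b) = if b then 1%N else s.*2.-1.
Proof.
rewrite /polygon_value [pres_lift _ _](pres_lift_gen polygon_perm_rel).
by rewrite /polygon_perm; case: b; rewrite permE /= ?subn1.
Qed.

Lemma polygon_value1 : polygon_value 1 = 0.
Proof. by rewrite /polygon_value (morph1 polygon_liftM) perm1. Qed.

Lemma dihedral_gen_neq1 b : d b <> 1.
Proof.
by move=> /(congr1 polygon_value); rewrite polygon_value_gen polygon_value1; case: b; lia.
Qed.

Lemma dihedral_gen_neq : d false <> d true.
Proof. by move=> /(congr1 polygon_value); rewrite !polygon_value_gen; lia. Qed.

End Dihedral.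

(** * The group generated by the vertex reflections *)

(** Factors at the same index are not assumed to commute. *)
Lemma prodg_split_commute (I : eqType) (G : groupType) (r : seq I) (f h : I -> G) :
  uniq r -> (forall i j, i != j -> commute (f i) (h j)) ->
  \prod_(i <- r) (f i * h i) = (\prod_(i <- r) f i) * \prod_(i <- r) h i.
Proof.
move=> ur fh; elim: r ur => [|i r IHr] /=; first by rewrite !big_nil mulg1.
move=> /andP[ir ur]; rewrite !big_cons IHr // !mulgA; congr (_ * _); rewrite -!mulgA.
congr (_ * _); rewrite big_seq; apply: commute_prod => j jr.
by apply/commute_sym/fh; apply: contraNneq ir => <-.
Qed.

Lemma prodg_only (I : eqType) (G : groupType) (r : seq I) (f : I -> G) i :
  uniq r -> i \in r -> (forall j, j != i -> f j = 1) -> \prod_(j <- r) f j = f i.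
Proof.
move=> ur ir f1; have H (t : seq I) : i \notin t -> \prod_(j <- t) f j = 1.
  move=> it; rewrite big_seq big1 // => j jt; apply: f1.
  by apply: contraNneq it => <-.
case/splitPr: ir ur => p q; rewrite cat_uniq /= negb_or -andbA.
case/and5P=> _ ip _ iq _; rewrite big_cat big_cons /= !H ?mul1g ?mulg1 //.
Qed.

Section VertexGroup.
Variables (n s : nat).
Hypothesis n_gt0 : 0 < n.
Local Notation O := (orthoplex_group n).
Local Notation V := (orthoplex_stab n).
Local Notation alpha := (orthoplex_central n).
Local Notation W := (vertex_group V alpha s).
Local Notation sg := (sigma (V := V) alpha s).
Local Notation D := (dihedral s).
Local Notation d := (dihedral_gen s).
Implicit Types (F : vertex V) (g h : O) (x y : 'I_n.*2) (k : 'I_n).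

Definition point0 : 'I_n.*2 := Ordinal (etrans (double_gt0 n) n_gt0).

Lemma orthoplex_stabP g : V g <-> move g point0 = point0.
Proof.
rewrite orthoplex_stabE; split=> [Vg|g0]; first by apply: tail_set_fix Vg _; left.
exact: tail_set_stab (tail_set0 g) g0.
Qed.

Lemma rcoset_stabP g h : rcoset V g h <-> move h point0 = move g point0.
Proof.
rewrite rcosetE orthoplex_stabP moveM; split=> [e|->]; last exact: moveK.
by rewrite -{2}e moveVK.
Qed.

(** The number of a vertex, a vertex being a coset of the stabilizer of the
    first one. *)
Definition point_of F : 'I_n.*2 := move (xget 1 (val F)) point0.

Lemma vertexP F : exists g, F = vertex_act (base_vertex V) g.
Proof. by case: F => A hA; have [g Ag] := asboolP _ hA; exists g; apply: val_inj. Qed.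

Lemma point_of_base g : point_of (vertex_act (base_vertex V) g) = move g point0.
Proof.
apply/rcoset_stabP; apply: (@xgetPex _ 1 (rcoset V g)).
by exists g; apply/rcoset_stabP.
Qed.

Lemma point_of_act F g : point_of (vertex_act F g) = move g (point_of F).
Proof. by have [h ->] := vertexP F; rewrite -vertex_actM !point_of_base moveM. Qed.

Lemma point_of_inj : injective point_of.
Proof.
move=> F F'; have [g ->] := vertexP F; have [h ->] := vertexP F'.
rewrite !point_of_base => gh; apply: val_inj => /=.
by apply/seteqP; split=> z /rcoset_stabP zg; apply/rcoset_stabP; rewrite zg gh.
Qed.

Lemma vertex_actP F g : vertex_act F g = F <-> move g (point_of F) = point_of F.
Proof. by rewrite -point_of_act; split=> [->//|/point_of_inj]. Qed.

Definition vertex_at x : vertex V := vertex_act (base_vertex V) (walk_prod n 0 x).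

Lemma vertex_atK : cancel vertex_at point_of.
Proof. by move=> x; rewrite point_of_base; exact: move_walk. Qed.

Lemma point_ofK : cancel point_of vertex_at.
Proof. by move=> F; apply: point_of_inj; rewrite vertex_atK. Qed.

Lemma point_of_base_vertex : point_of (base_vertex V) = point0.
Proof. by rewrite -[base_vertex V]vertex_act1 point_of_base move1. Qed.

Lemma point_of_antipode F : point_of (vertex_act F alpha) = rev_ord (point_of F).
Proof.
have [g ->] := vertexP F; rewrite -vertex_actM -orthoplex_centralP.
by rewrite !point_of_base moveM move_central // move_rev.
Qed.

Lemma rev_ord_neq x : rev_ord x != x.
Proof. by apply/eqP => /(congr1 val) /=; have := ltn_ord x; lia. Qed.

Lemma vertex_coxeterE F F' : vertex_coxeter alpha s F F' =
  if point_of F' == point_of F then 1%N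
  else if point_of F' == rev_ord (point_of F) then s else 2.
Proof.
by rewrite /vertex_coxeter -point_of_antipode !(inj_eq point_of_inj).
Qed.

(** The reflections in the vertices on the [k]-th axis generate a dihedral
    group, and [W] is the direct product of these [n] groups. *)
Definition axis x : nat := if x < n then x : nat else n.*2.-1 - x.

Lemma axis_eq x y : axis x = axis y -> y = x \/ y = rev_ord x.
Proof.
rewrite /axis => e; have := ltn_ord x; have := ltn_ord y => yn xn.
have [yx|yx] : y = x :> nat \/ y = (n.*2 - x.+1)%N :> nat.
  by move: e; case: ifP; case: ifP; lia.
  by left; apply: val_inj.
by right; apply: val_inj.
Qed.

Lemma axis_rev x : axis (rev_ord x) = axis x.
Proof. by rewrite /axis /=; have := ltn_ord x; case: ifP; case: ifP; lia. Qed.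

Lemma sign_rev x : (rev_ord x < n) = ~~ (x < n).
Proof. by have := ltn_ord x => /=; lia. Qed.

Definition coord_gen k F : D :=
  if axis (point_of F) == k then d (point_of F < n) else 1.

Lemma coord_rel k r : coxeter_rel (vertex_coxeter alpha s) r ->
  eval_word (coord_gen k) r = 1.
Proof.
move=> [F [F' ->]]; rewrite eval_coxeter_rel vertex_coxeterE /coord_gen.
have [->|nFF'] := eqVneq (point_of F') (point_of F).
  by rewrite expg1; case: ifP => _; rewrite ?dihedral_gen2 ?mulg1.
have [->|nFF''] := eqVneq (point_of F') (rev_ord (point_of F)).
  rewrite axis_rev sign_rev; case: ifP => _; first exact: dihedral_genX.
  by rewrite mulg1 expg1n.
rewrite expg2; case: eqP => [e1|_]; case: eqP => [e2|_]; rewrite ?mulg1 ?mul1g ?dihedral_gen2 //.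
have [e|e] : point_of F' = point_of F \/ point_of F' = rev_ord (point_of F).
- by apply: axis_eq; rewrite e1 e2.
- by rewrite e eqxx in nFF'.
- by rewrite e eqxx in nFF''.
Qed.

Definition coord k (w : W) : D := pres_lift (coord_gen k) w.

Lemma coordM k : {morph coord k : u v / u * v}.
Proof. exact: pres_liftM (@coord_rel k). Qed.

Lemma coord_sigma k F : coord k (sg F) = coord_gen k F.
Proof. exact: (pres_lift_gen (@coord_rel k)). Qed.

Lemma axis_point_subproof k : k < n.*2.
Proof. by have := ltn_ord k; lia. Qed.

Definition axis_point k : 'I_n.*2 := Ordinal (axis_point_subproof k).
Definition signed_point k (b : bool) : 'I_n.*2 :=
  if b then axis_point k else rev_ord (axis_point k).

Lemma axis_signed k b : axis (signed_point k b) = k.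
Proof.
by rewrite /signed_point; case: b; rewrite ?axis_rev /axis /= ltn_ord.
Qed.

Lemma sign_signed k b : (signed_point k b < n) = b.
Proof. by rewrite /signed_point; case: b; rewrite ?sign_rev /= ltn_ord. Qed.

Lemma signed_pointP x : exists k b, x = signed_point k b.
Proof.
have xn := ltn_ord x; have ax : axis x < n by rewrite /axis; case: ifP; lia.
have [|e|e] := @axis_eq (signed_point (Ordinal ax) true) x.
- by rewrite axis_signed.
- by exists (Ordinal ax), true.
- by exists (Ordinal ax), false.
Qed.

Definition axis_emb_gen k b : W := sg (vertex_at (signed_point k b)).

Lemma sigma2 F : sg F * sg F = 1.
Proof.
have := coxeter_genX (vertex_coxeter alpha s) F F.
by rewrite vertex_coxeterE eqxx expg1.
Qed.

Lemma sigmaV F : (sg F)^-1 = sg F.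
Proof. by apply: mulg1_eq; exact: sigma2. Qed.

Lemma sigma_commute F F' : point_of F' <> rev_ord (point_of F) -> commute (sg F) (sg F').
Proof.
move=> /eqP FF'; have := coxeter_genX (vertex_coxeter alpha s) F F'.
rewrite vertex_coxeterE (negPf FF'); case: eqP => [/point_of_inj -> //|_].
rewrite expg2 => h; have := mulg1_eq h.
by rewrite invgM !sigmaV => e; exact: esym.
Qed.

Lemma axis_emb_rel k r : coxeter_rel (dihedral_coxeter s) r ->
  eval_word (axis_emb_gen k) r = 1.
Proof.
move=> [b [b' ->]]; rewrite eval_coxeter_rel /dihedral_coxeter.
have [->|bb'] := eqVneq b b'; first by rewrite expg1 sigma2.
have := coxeter_genX (vertex_coxeter alpha s) (vertex_at (signed_point k b)) (vertex_at (signed_point k b')).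
rewrite vertex_coxeterE !vertex_atK.
have e : signed_point k b' = rev_ord (signed_point k b).
  by case: b b' bb' => [] [] //= _; rewrite rev_ordK.
rewrite /axis_emb_gen e.
by rewrite (negPf (rev_ord_neq _)) eqxx.
Qed.

Definition axis_emb k (x : D) : W := pres_lift (axis_emb_gen k) x.

Lemma axis_embM k : {morph axis_emb k : u v / u * v}.
Proof. exact: pres_liftM (@axis_emb_rel k). Qed.

Lemma axis_emb_dihedral k b : axis_emb k (d b) = axis_emb_gen k b.
Proof. exact: (pres_lift_gen (@axis_emb_rel k)). Qed.

Lemma axis_emb_commute k k' (x y : D) : k != k' -> commute (axis_emb k x) (axis_emb k' y).
Proof.
move=> kk'; have C1 b : commute (axis_emb_gen k b) (axis_emb k' y).
  apply: (pres_ind (S := [set y : D | commute (axis_emb_gen k b) (axis_emb k' y)])).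
    split=> [|u v] /=; first by rewrite (morph1 (@axis_embM k')); exact: commute1.
    by move=> cu cv; rewrite axis_embM (morphV (@axis_embM k')); apply: commuteM => //; exact: commuteV.
  move=> b' /=; rewrite axis_emb_dihedral; apply: sigma_commute; rewrite !vertex_atK.
  move=> /(congr1 axis); rewrite axis_rev !axis_signed => /val_inj e.
  by rewrite e eqxx in kk'.
apply: (pres_ind (S := [set x : D | commute (axis_emb k x) (axis_emb k' y)])).
  split=> [|u v] /=; first by rewrite (morph1 (@axis_embM k)); exact/commute_sym/commute1.
  move=> /commute_sym cu /commute_sym cv; rewrite axis_embM (morphV (@axis_embM k)).
  by apply/commute_sym/commuteM => //; exact: commuteV.
by move=> b /=; rewrite axis_emb_dihedral.
Qed.

Lemma coord_axis_emb k k' (x : D) : coord k (axis_emb k' x) = if k == k' then x else 1.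
Proof.
have E b : coord k (axis_emb_gen k' b) = if k == k' then d b else 1.
  rewrite coord_sigma /coord_gen !vertex_atK axis_signed sign_signed.
  by rewrite -[(k' : nat) == k]/(k' == k) eq_sym.
case: eqP E => [_|_] E.
  move: x; apply: (pres_ind_morph (p := fun x : D => coord k (axis_emb k' x)) (q := id)) => //.
    by move=> u v; rewrite axis_embM coordM.
  by move=> b; rewrite [axis_emb _ _]axis_emb_dihedral E.
move: x; apply: (pres_ind_morph (p := fun x : D => coord k (axis_emb k' x)) (q := fun=> 1)).
- by move=> u v; rewrite axis_embM coordM.
- by move=> u v; rewrite mulg1.
- by move=> b; rewrite [axis_emb _ _]axis_emb_dihedral E.
Qed.

(** Both sides are multiplicative in [w], the factors of different axes commuting,
    so it is enough to compare them on the reflections. *)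
Lemma prod_axis_coord w : \prod_(k < n) axis_emb k (coord k w) = w.
Proof.
apply: (pres_ind_morph (p := fun w => \prod_(k < n) axis_emb k (coord k w)) (q := id)) => //.
  move=> u v; under eq_bigr => k _ do rewrite coordM axis_embM.
  by apply: prodg_split_commute => [|k k']; [exact: index_enum_uniq|exact: axis_emb_commute].
move=> F; have [k [b Fkb]] := signed_pointP (point_of F).
rewrite (prodg_only (i := k)); [|exact: index_enum_uniq|exact: mem_index_enum|].
  rewrite [coord _ _]coord_sigma /coord_gen Fkb axis_signed sign_signed eqxx.
  by rewrite axis_emb_dihedral /axis_emb_gen -Fkb point_ofK.
move=> j jk; rewrite [coord _ _]coord_sigma /coord_gen Fkb axis_signed.
by rewrite -[(k : nat) == j]/(k == j) eq_sym (negPf jk) (morph1 (@axis_embM j)).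
Qed.

Lemma coord_prod k (f : 'I_n -> D) : coord k (\prod_(j < n) axis_emb j (f j)) = f k.
Proof.
rewrite (big_morph _ (@coordM k) (morph1 (@coordM k))).
rewrite (prodg_only (i := k)); [|exact: index_enum_uniq|exact: mem_index_enum|].
  by rewrite coord_axis_emb eqxx.
by move=> j jk; rewrite coord_axis_emb eq_sym (negPf jk).
Qed.

Hypothesis s_ge2 : 2 <= s.

Lemma vertex_group_card : has_card [set: W] ((s * 2) ^ n).
Proof.
have [A [f [fI fD fc]]] := dihedral_card s_ge2.
exists {ffun 'I_n -> A}, (fun a : {ffun 'I_n -> A} => \prod_(k < n) axis_emb k (f (a k))).
split; last by rewrite card_ffun card_ord fc.
  move=> a b ab; apply/ffunP => k; apply: fI.
  by have := congr1 (coord k) ab; rewrite !coord_prod.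
apply/seteqP; split=> // w _.
have /choice[a aw] : forall k, exists x : A, f x = coord k w.
  move=> k; have : range f (coord k w) by rewrite fD.
  by move=> [x _ <-]; exists x.
exists (finfun a) => //; rewrite -[RHS]prod_axis_coord.
by apply: eq_bigr => k _; rewrite ffunE aw.
Qed.

Lemma sigma_inj : injective sg.
Proof.
move=> F F' e; apply: point_of_inj.
have [k [b Fkb]] := signed_pointP (point_of F).
have := congr1 (coord k) e; rewrite !coord_sigma /coord_gen Fkb axis_signed sign_signed eqxx.
case: eqP => [|_ /dihedral_gen_neq1]; last by move/(_ s_ge2).
have [k' [b' ->]] := signed_pointP (point_of F'); rewrite axis_signed sign_signed.
move=> /val_inj ->; case: b b' {Fkb} => [] [] // /esym; last by move/esym/(dihedral_gen_neq s_ge2).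
by move/(dihedral_gen_neq s_ge2).
Qed.

(** The first [m] vertices lie on different axes, so each coordinate of an
    element of the generated group is [1] or the positive reflection. *)
Lemma sigma_block m F : m <= n ->
  gen [set sg F' | F' in [set F' | point_of F' < m]] (sg F) -> point_of F < m.
Proof.
move=> mn SF; have [k [b Fkb]] := signed_pointP (point_of F).
pose S : set W := [set w | coord k w = 1 \/ k < m /\ coord k w = d true].
have sS : subgroup_set S.
  have dV : (d true)^-1 = d true by apply: mulg1_eq; exact: dihedral_gen2.
  split=> [|u v]; first by left; rewrite (morph1 (@coordM k)).
  rewrite /S /= coordM (morphV (@coordM k)).
  move=> [->|[km ->]] [->|[km' ->]]; rewrite ?invg1 ?mulg1 ?mul1g ?dV ?dihedral_gen2; by [left|right].
have : S (sg F).
  apply: gen_min sS _ _ SF => _ [F' /= F'm <-].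
  rewrite /S /= coord_sigma /coord_gen; case: eqP => [F'k|_]; last by left.
  have F'n : point_of F' < n by lia.
  by right; move: F'k; rewrite /axis F'n => <-.
rewrite /S /= coord_sigma /coord_gen Fkb axis_signed eqxx sign_signed.
move=> [/(dihedral_gen_neq1 s_ge2)//|[km]].
by case: b {Fkb} => // /(dihedral_gen_neq s_ge2).
Qed.

End VertexGroup.

(** * The order of the orthoplex group *)

(** The walks from [l] represent the [2 (n - l)] cosets of [tail_set l.+1] in
    [tail_set l]. *)
Lemma tail_set_card n d : d <= n -> has_card (tail_set (n := n) (n - d)) (2 ^ d * d`!).
Proof.
elim: d => [|d IHd] dn.
  exists unit, (fun=> 1); split; [by move=> [] []| |by rewrite card_unit].
  apply/seteqP; split=> [_ [_ _ <-]|g gn]; first exact: gen1.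
  exists tt => //; suff : [set 1] g by [].
  apply: gen_min gn => [|a [k /= kn _]]; last by lia.
  by split=> // x y -> ->; rewrite mulgV.
have [F [f [fI fr fc]]] := IHd ltac:(lia).
have e : n - d = (n - d.+1).+1 by lia.
rewrite e in fr; set l := n - d.+1 in fr *.
have ln : l < n.*2 by rewrite /l; lia.
pose x0 : 'I_n.*2 := Ordinal ln.
have fS a : tail_set l.+1 (f a) by rewrite -fr; exists a.
exists (F * 'I_(2 * d.+1))%type, (fun a : F * 'I_(2 * d.+1) => f a.1 * walk_prod n l (l + a.2)); split.
- move=> [a i] [b j] /= ab.
  have pE c (k : 'I_(2 * d.+1)) : move (f c * walk_prod n l (l + k)) x0 = l + k :> nat.
    have kn : l + k < n.*2 by have := ltn_ord k; rewrite /l; lia.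
    rewrite moveM (tail_set_fix (fS c)); last by left.
    by rewrite (@move_walk n l (l + k) x0 (Ordinal kn)) //; lia.
  have ij : i = j by apply: val_inj; have := pE a i; rewrite ab pE /=; lia.
  by subst j; move/mulIg: ab => /fI ->.
- apply/seteqP; split=> [_ [[a i] _ <-]|g lg] /=.
    apply: genM; first exact: tail_setS.
    rewrite /walk_prod big_seq; elim/big_ind: _ => [||j]; [exact: gen1|by move=> ? ?; exact: genM|].
    rewrite mem_index_iota => /andP[lj ji]; apply: sub_gen.
    exists (walk_idx n j) => //=; have := ltn_ord i; rewrite /walk_idx; case: ifP; rewrite /l in lj *; lia.
  have [|v lv [h1 h2 ->]] := @tail_set_walk n l g x0 _ erefl lg; first by rewrite /l; lia.
  have [a _ av] : range f v by rewrite fr.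
  have kd : move g x0 - l < 2 * d.+1 by move: h1 h2; rewrite /l; lia.
  by exists (a, Ordinal kd) => //=; rewrite subnKC // av.
- by rewrite card_prod card_ord fc factS expnS; nia.
Qed.

Lemma orthoplex_card n : has_card [set: orthoplex_group n] (2 ^ n * n`!).
Proof.
have := tail_set_card (leqnn n); rewrite subnn.
by have -> : tail_set (n := n) 0 = setT by apply/seteqP; split=> // g _; exact: tail_set0.
Qed.

Section SemidirectEmbeddings.
Variables (G W : groupType) (to : right_action G W).

Lemma sd_inlM : {morph sd_inl to : g h / g * h}.
Proof. by move=> g h; rewrite /sd_inl [RHS]/mul /= /sd_mul /= ract_one mulg1. Qed.

Lemma sd_inrM : {morph sd_inr to : v w / v * w}.
Proof. by move=> v w; rewrite /sd_inr [RHS]/mul /= /sd_mul /= ract1 mulg1. Qed.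

End SemidirectEmbeddings.

(** * The group of the polytope *)

Section TwistGroup.
Variables (n s : nat).
Hypothesis n_ge2 : 2 <= n.
Local Notation O := (orthoplex_group n).
Local Notation V := (orthoplex_stab n).
Local Notation alpha := (orthoplex_central n).
Local Notation W := (vertex_group V alpha s).
Local Notation sg := (sigma (V := V) alpha s).
Local Notation U := (orthoplex_twist_group n s).
Local Notation rho := (@orthoplex_twist_gen n s).
Local Notation t := (orthoplex_nat_gen n).
Local Notation act := (vertex_group_ract V (@orthoplex_centralP n) s).
Local Notation r := (halving_family rho).
Implicit Types (g h : O) (w : W) (x y : U) (i j k m : 'I_n.+1).

Let n_gt0 : 0 < n. Proof. by lia. Qed.
Local Notation point0 := (point0 n_gt0).
Local Notation point_of := (point_of n_gt0).

Definition twist_inl g : U := sd_inl act g.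
Definition twist_inr w : U := sd_inr act w.
Local Notation il := twist_inl.
Local Notation ir := twist_inr.

Lemma twist_mulE g h v w : ((g, v) : U) * ((h, w) : U) = (g * h, act v h * w).
Proof. by []. Qed.

Lemma twist_act1 g : act 1 g = 1.
Proof. exact: ract_one. Qed.

Lemma twist_inlM : {morph il : g h / g * h}.
Proof. exact: sd_inlM. Qed.

Lemma twist_inrM : {morph ir : v w / v * w}.
Proof. exact: sd_inrM. Qed.

Lemma twistE x : x = il x.1 * ir x.2.
Proof. by case: x => g w; rewrite [RHS](twist_mulE g 1 1 w) twist_act1 mul1g mulg1. Qed.

Lemma twist_inrJ F g : ir (sg F) ^ il g = ir (sg (vertex_act F g)).
Proof.
rewrite [LHS]sd_inrJ; congr (sd_inr _ _).
exact: (vertex_group_act_gen (@orthoplex_centralP n)).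
Qed.

Definition rho0 : U := ir (sg (base_vertex V)).
Local Notation z := rho0.

Lemma rho0K : z * z = 1.
Proof. by rewrite /z -twist_inrM (sigma2 s n_gt0). Qed.

Lemma rho0V : z^-1 = z. Proof. exact: mulg1_eq rho0K. Qed.

Lemma rho_ord0 i : i = 0%N :> nat -> rho i = z.
Proof.
move=> i0; have -> : i = ord0 by apply: val_inj.
by rewrite /orthoplex_twist_gen /twist_gen unlift_none.
Qed.

Lemma rho_pos i : 0 < i -> rho i = il (t i.-1).
Proof.
move=> i0; rewrite /orthoplex_twist_gen /twist_gen; case: unliftP => [j ->|e].
  by rewrite /il (_ : (lift ord0 j).-1 = j) // orthoplex_nat_genE.
by rewrite e in i0.
Qed.

Lemma halving_family0 i : i = 0%N :> nat -> r i = z * il (t 0) * z.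
Proof.
move=> i0; have -> : i = ord0 by apply: val_inj.
rewrite /halving_family eqxx rho_ord0 // rho_pos; last by rewrite inordK.
by rewrite inordK.
Qed.

Lemma halving_familyS i : 0 < i -> r i = il (t i.-1).
Proof.
move=> i0; rewrite /halving_family -val_eqE /=.
by rewrite (_ : (i == 0%N :> nat) = false) ?rho_pos //; lia.
Qed.

Lemma rho0_stab g : V g -> commute z (il g).
Proof.
move=> Vg; rewrite /commute [LHS]conjgC; congr (_ * _); rewrite twist_inrJ.
rewrite (_ : vertex_act _ g = base_vertex V) //; apply/(vertex_actP n_gt0).
by rewrite (point_of_base_vertex n_gt0); apply/(orthoplex_stabP n_gt0).
Qed.

Lemma rho0J g : z * il g * z = (g, sg (vertex_act (base_vertex V) g) * sg (base_vertex V)).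
Proof.
rewrite [z * il g]conjgC twist_inrJ -mulgA -twist_inrM.
by rewrite [LHS](twist_mulE g 1 1 _) twist_act1 mul1g mulg1.
Qed.

Lemma tail_stab (k : nat) : 0 < k -> V (t k).
Proof.
rewrite orthoplex_stabE => k0; have [kn|nk] := ltnP k n.
  by apply: sub_gen; exists k => //=; rewrite k0.
have [[]|[_ ->]] := orthoplex_nat_genP n k; [lia|exact: gen1].
Qed.

Lemma halving_family2 i : r i * r i = 1.
Proof.
have [i0|i0] := posnP i; last by rewrite halving_familyS // -twist_inlM nat_gen2 (morph1 twist_inlM).
rewrite halving_family0 // !mulgA -(mulgA (_ * _) z z) rho0K mulg1 -(mulgA z).
by rewrite -twist_inlM nat_gen2 (morph1 twist_inlM) mulg1 rho0K.
Qed.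

Definition nat_span (Q : pred nat) : set O := gen [set t k | k in [set k | (k < n) && Q k]].

Lemma span_inl (S : pred 'I_n.+1) (Q : pred nat) g :
  (forall i, 0 < i -> Q i.-1 -> S i) -> nat_span Q g -> span r S (il g).
Proof.
move=> QS; pose T := [set g | span r S (il g)]; move: g.
apply: (gen_min (S := T)) => [|_ [k /= /andP[kn Qk] <-]].
  split=> [|g h]; first by rewrite /T /= (morph1 twist_inlM); exact: gen1.
  by rewrite /T /= twist_inlM (morphV twist_inlM); exact: genF.
have kn' : k.+1 < n.+1 by [].
rewrite /T /=; have -> : il (t k) = r (Ordinal kn') by rewrite halving_familyS.
by apply: span_gen; exact: QS.
Qed.

Lemma inl_span (S : pred 'I_n.+1) (Q : pred nat) x :
  (forall i, S i -> 0 < i /\ Q i.-1) -> span r S x ->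
  exists2 g, nat_span Q g & x = il g.
Proof.
move=> SQ; move: x; apply: (span_ind halving_family2) => [|x i _ /SQ[i0 Qi] [g Qg ->]].
  by exists 1; [exact: gen1|rewrite (morph1 twist_inlM)].
exists (g * t i.-1); last by rewrite twist_inlM halving_familyS.
by apply: genM => //; apply: sub_gen; exists i.-1 => //=; rewrite Qi andbT; have := ltn_ord i; lia.
Qed.

Lemma rho0J_gen0 i j : i = 0%N :> nat -> j = 1%N :> nat -> z * r i * z = r j.
Proof.
move=> i0 j1; rewrite halving_family0 // halving_familyS ?j1 //=.
by rewrite !mulgA rho0K mul1g -mulgA rho0K mulg1.
Qed.

Lemma rho0J_gen1 i j : i = 0%N :> nat -> j = 1%N :> nat -> z * r j * z = r i.
Proof. by move=> i0 j1; rewrite (halving_family0 i0) halving_familyS ?j1. Qed.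

Lemma rho0J_gen i : 2 <= i -> z * r i * z = r i.
Proof.
move=> i2; rewrite halving_familyS; last by lia.
have i1 : 0 < i.-1 by lia.
have Vi := tail_stab i1.
by rewrite (rho0_stab Vi) -mulgA rho0K mulg1.
Qed.

Lemma rho0J_inj x y : z * x * z = y -> x = z * y * z.
Proof. by move=> <-; rewrite !mulgA rho0K mul1g -mulgA rho0K mulg1. Qed.

(** Conjugation by [rho_0] exchanges the first two generators of the halving
    group and fixes the others. *)
Lemma span_rho0J (S S' : pred 'I_n.+1) x :
  (forall i j, i = 0%N :> nat -> j = 1%N :> nat -> (S i -> S' j) /\ (S j -> S' i)) ->
  (forall i, 2 <= i -> S i -> S' i) -> span r S x -> span r S' (z * x * z).
Proof.
move=> S01 S2; pose T := [set x | span r S' (z * x * z)]; move: x.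
apply: (gen_min (S := T)) => [|_ [i /= Si <-]].
  split=> [|x y]; first by rewrite /T /= mulg1 rho0K; exact: gen1.
  rewrite /T /= => Sx Sy; have -> : z * (x / y) * z = (z * x * z) / (z * y * z).
    by rewrite !invgM rho0V !mulgA -(mulgA _ z z) rho0K mulg1.
  exact: genF.
rewrite /T /=; have n1 : 1 < n.+1 by lia.
have [i2|i2] := ltnP 1 i; first by rewrite rho0J_gen //; apply: span_gen; exact: S2.
have [i0|i0] := posnP i.
  rewrite (@rho0J_gen0 i (Ordinal n1)) //; apply: span_gen.
  by apply: (S01 i (Ordinal n1) i0 erefl).1.
have i1 : i = 1%N :> nat by lia.
rewrite (@rho0J_gen1 ord0 i) //; apply: span_gen.
by apply: (S01 ord0 i erefl i1).2.
Qed.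

Definition block_prop (m : nat) g : Prop := forall x : 'I_n.*2, move g x < m <-> x < m.

Lemma block_gen (m k : nat) : k < n -> k.+1 <> m -> m <= n -> block_prop m (t k).
Proof. by move=> kn km mn x; rewrite move_gen //; reflect_cases; lia. Qed.

Lemma block_span_act (m : nat) g w : block_prop m g ->
  gen [set sg F | F in [set F | point_of F < m]] w ->
  gen [set sg F | F in [set F | point_of F < m]] (act w g).
Proof.
move=> mg; pose T : set W := [set w | gen [set sg F | F in [set F | point_of F < m]] (act w g)].
move: w; apply: (gen_min (S := T)) => [|_ [F /= Fm <-]].
  have aM : {morph act^~ g : v w / v * w} := @ractM _ _ act g.
  split=> [|v w]; first by rewrite /T /mkset twist_act1; exact: gen1.
  rewrite /T /mkset => gv gw; have -> : act (v / w) g = act v g / act w g.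
    by rewrite aM; congr (_ * _); exact: morphV aM w.
  exact: genF.
apply: sub_gen; exists (vertex_act F g).
  by rewrite /= point_of_act; apply/mg.
by rewrite -(vertex_group_act_gen (@orthoplex_centralP n)).
Qed.

(** An element of the parabolic subgroup without the [m]-th generator, with
    [2 <= m], keeps the face spanned by the first [m] vertices: both of its
    components do so. *)
Lemma cospan_block m x : 2 <= m -> cospan r m x ->
  block_prop m x.1 /\ gen [set sg F | F in [set F | point_of F < m]] x.2.
Proof.
move=> m2; have mn : m <= n by have := ltn_ord m; lia.
move: x; apply: (span_ind halving_family2) => [|x i _ im [bx gx]].
  by split=> [y|]; [rewrite move1|exact: gen1].
have bM g h : block_prop m g -> block_prop m h -> block_prop m (g * h).
  by move=> bg bh y; rewrite moveM bh.
have b0 : block_prop m (t 0) by apply: block_gen; lia.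
have [i0|i0] := posnP i; last first.
  rewrite halving_familyS //.
  have bi : block_prop m (t i.-1).
    by apply: block_gen => //; have := ltn_ord i; move: im; rewrite -val_eqE /=; lia.
  case: x bx gx => g w bg gw; split=> /=; first exact: bM.
  by rewrite mulg1; exact: block_span_act bi gw.
(* the generator [rho_0 t_0 rho_0] equals [t_0 sigma_{e_1} sigma_{e_0}] *)
rewrite halving_family0 // rho0J; case: x bx gx => g w bg gw; split=> /=; first exact: bM.
apply: genM; first exact: block_span_act b0 gw.
apply: genM; apply: sub_gen.
  exists (vertex_act (base_vertex V) (t 0)) => //=.
  by rewrite point_of_act; apply/b0; rewrite point_of_base_vertex /=; lia.
by exists (base_vertex V) => //=; rewrite point_of_base_vertex /=; lia.
Qed.

(** Both subgroups act on the vertices, where the second keeps the first [m]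
    together. *)
Lemma halving_cap_up l m x : l < m -> 2 <= m ->
  span r (fun k => l < k) x -> cospan r m x -> span r (fun k => (l < k) && (k != m)) x.
Proof.
move=> lm m2 lx mx; have [|g lg xg] := @inl_span _ (fun k : nat => l <= k) _ _ lx; first by move=> i li; lia.
have [bg _] := cospan_block m2 mx; rewrite xg /= in bg.
have mn : m <= n by have := ltn_ord m; lia.
have lg' : tail_set l g.
  by apply: gen_sub lg => _ [k /= ? <-]; exists k => //=; lia.
have h := tail_set_block lm mn lg' bg.
rewrite xg; apply: (@span_inl _ (fun k : nat => (l <= k) && (k != m.-1))) => [i i0|].
  by rewrite -val_eqE /=; lia.
by apply: gen_sub h => _ [k /= ? <-]; exists k => //=; lia.
Qed.

Lemma cospan_swap i j x : i = 0%N :> nat -> j = 1%N :> nat ->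
  (cospan r j x -> cospan r i (z * x * z)) /\ (cospan r i x -> cospan r j (z * x * z)).
Proof.
move=> i0 j1; split; apply: span_rho0J => [k l k0 l1|k k2]; rewrite -!val_eqE /=; lia.
Qed.

Lemma cospan_rho0J m x : 2 <= m -> cospan r m x -> cospan r m (z * x * z).
Proof.
by move=> m2; apply: span_rho0J => [k l k0 l1|k k2]; rewrite -!val_eqE /=; lia.
Qed.

Lemma cospan0_inl i x : i = 0%N :> nat -> cospan r i x -> exists g, x = il g.
Proof.
move=> i0 ix; have [|g _ ->] := @inl_span _ xpredT _ _ ix; last by exists g.
by move=> j; rewrite -val_eqE /=; lia.
Qed.

(** Conjugation by [rho_0] exchanges the types [0] and [1], which reduces this to
    [halving_cap_up] with [l = 0]. *)
Lemma halving_cap1m i m x : i = 1%N :> nat -> 2 <= m ->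
  cospan r i x -> cospan r m x -> span r (fun k => (k != i) && (k != m)) x.
Proof.
move=> i1 m2 ix mx; have n0 : 0 < n.+1 by [].
have xE := @rho0J_inj x _ erefl; rewrite xE.
have K0 := (@cospan_swap ord0 i x erefl i1).1 ix.
have Km := cospan_rho0J m2 mx.
have m0 : (ord0 : 'I_n.+1) < m by move=> /=; lia.
have K0' : span r (fun k => (ord0 : 'I_n.+1) < k) (z * x * z).
  by apply: span_sub K0 => k; rewrite -val_eqE /=; lia.
apply: span_rho0J (halving_cap_up m0 m2 K0' Km) => [k l k0 l1|k k2]; rewrite -?val_eqE /=; lia.
Qed.

Hypothesis s_ge2 : 2 <= s.

(** For [g] in [O] the conjugate of [g] by [rho_0] is [g] times
    [sigma_{e_0 g} sigma_{e_0}], which lies in [O] only if [g] fixes [e_0]. *)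
Lemma halving_cap01 i j x : i = 0%N :> nat -> j = 1%N :> nat ->
  cospan r i x -> cospan r j x -> span r (fun k => j < k) x.
Proof.
move=> i0 j1 ix jx; have [g xg] := cospan0_inl i0 ix.
have [h] := cospan0_inl i0 ((cospan_swap x i0 j1).1 jx).
rewrite xg rho0J => -[_ e].
have {e} e : vertex_act (base_vertex V) g = base_vertex V.
  apply: (sigma_inj n_gt0 s_ge2).
  by rewrite -[LHS]mulg1 -[X in _ * X](sigma2 s n_gt0 (base_vertex V)) mulgA e mul1g.
have Vg : tail_set 1 g.
  rewrite -orthoplex_stabE; apply/(orthoplex_stabP n_gt0).
  by have /(vertex_actP n_gt0) := e; rewrite point_of_base_vertex.
apply: (@span_inl _ (fun k : nat => 0 < k)) => [k k0|]; first by lia.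
by apply: gen_sub Vg => _ [k /= ? <-]; exists k => //=; lia.
Qed.

(** With [x = g] and [y] the conjugate by [rho_0] of [h], for [g] and [h] in [O],
    the quotient [x / y] keeps the face [e_0, ..., e_{m-1}] only if [h^-1] sends
    [e_0] into it; dividing [h^-1] by the walk to that vertex gives [v]. *)
Lemma halving_triangle i j m x y : i = 0%N :> nat -> j = 1%N :> nat -> 2 <= m ->
  cospan r i x -> cospan r j y -> cospan r m (x / y) ->
  exists v, span r (fun k => j < k) v /\ cospan r m (v / y).
Proof.
move=> i0 j1 m2 ix jy mxy; have mn : m <= n by have := ltn_ord m; lia.
have [g xg] := cospan0_inl i0 ix.
have [h yh] := cospan0_inl i0 ((cospan_swap y i0 j1).1 jy).
have yE : y^-1 = z * il h^-1 * z.
  by rewrite (rho0J_inj yh) !invgM rho0V (morphV twist_inlM) mulgA.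
have h0m : move h^-1 point0 < m.
  have [_] := cospan_block m2 mxy.
  rewrite xg yE rho0J [_ * _](twist_mulE g _ 1 _) twist_act1 mul1g /= => sF.
  have : gen [set sg F | F in [set F | point_of F < m]] (sg (vertex_act (base_vertex V) h^-1)).
    rewrite -[sg _]mulg1 -[X in _ * X](sigma2 s n_gt0 (base_vertex V)) mulgA.
    apply: genM => //; apply: sub_gen; exists (base_vertex V) => //=.
    by rewrite point_of_base_vertex /=; lia.
  by move/(sigma_block s_ge2 mn); rewrite point_of_act point_of_base_vertex.
have [v v1 [_ _ hv]] := tail_set_walk n_gt0 (erefl : point0 = 0%N :> nat) (tail_set0 h^-1).
set p := nat_of_ord _ in h0m hv.
(* [h^-1] is [v] times the walk to the vertex [p], and [p < m] *)
exists (il v^-1); split.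
  apply: (@span_inl _ (fun k : nat => 0 < k)) => [k k0|]; first by lia.
  by apply: genV; apply: gen_sub v1 => _ [k /= ? <-]; exists k => //=; lia.
have Vv : V v by rewrite orthoplex_stabE.
rewrite yE hv twist_inlM !mulgA -(mulgA _ z) (rho0_stab Vv) !mulgA.
rewrite -twist_inlM mulVg (morph1 twist_inlM) mul1g.
apply: cospan_rho0J => //; apply: (@span_inl _ (fun k : nat => k < m.-1)) => [k k0|].
  by rewrite -val_eqE /=; lia.
rewrite /walk_prod big_seq; elim/big_ind: _ => [||k]; [exact: gen1|by move=> ? ?; exact: genM|].
rewrite mem_index_iota => kp; rewrite walk_lt; last by lia.
by apply: sub_gen; exists k => //=; lia.
Qed.

Lemma halving_family_commute l : 2 <= l -> forall i j, i < l -> l < j -> commute (r i) (r j).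
Proof.
move=> l2 i j il' lj; have ct : commute (il (t i.-1)) (il (t j.-1)).
  by rewrite /commute -!twist_inlM; congr (il _); apply: nat_gen_commute; lia.
rewrite (halving_familyS (i := j)); last by lia.
have [i0|i0] := posnP i; last by rewrite halving_familyS.
rewrite halving_family0 //; rewrite i0 in ct.
have j1 : 0 < j.-1 by lia.
have cz : commute (il (t j.-1)) z := commute_sym (rho0_stab (tail_stab j1)).
exact/commute_sym/(commuteM (commuteM cz (commute_sym ct)) cz).
Qed.

Lemma twist_inl_inj : injective il.
Proof. by move=> g h []. Qed.

Lemma halving_family_neq1 i : r i <> 1.
Proof.
have tn1 (k : nat) : k < n -> t k <> 1.
  move=> kn tk; have kn2 : k < n.*2 by lia.
  have := move_gen (Ordinal kn2) kn; rewrite tk move1 /=.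
  by reflect_cases; lia.
have [i0|i0] := posnP i.
  rewrite halving_family0 // => /rho0J_inj; rewrite mulg1 rho0K -(morph1 twist_inlM).
  by move/twist_inl_inj; apply: tn1.
rewrite halving_familyS // -(morph1 twist_inlM) => /twist_inl_inj.
by apply: tn1; have := ltn_ord i; lia.
Qed.

End TwistGroup.

(** * The extra relation *)

(** The second half of the long word inverts a part of the first half. *)
Lemma prod_rev_invol (G : groupType) (f : nat -> G) m :
  (forall k, f k * f k = 1) -> \prod_(1 <= k < m) f (m - k) = (\prod_(1 <= k < m) f k)^-1.
Proof.
move=> f2; case: m => [|m]; first by rewrite !big_geq // invg1.
elim: m => [|m IHm]; first by rewrite !big_geq // invg1.
rewrite [in RHS]big_nat_recr //= invgM (mulg1_eq (f2 _)) -IHm.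
rewrite big_ltn // subSS subn0; congr (_ * _).
by rewrite big_add1.
Qed.

Section HalvingWord.
Variables (G : groupType) (n : nat) (g : 'I_n.+1 -> G).
Hypothesis n_ge2 : 2 <= n.
Hypothesis g2 : forall i, g i * g i = 1.

(** The long word is [g_0 f g_1] for the involution [f] below. *)
Definition halving_flip : G :=
  g (inord n) ^ (\prod_(2 <= k < n) g (inord k))^-1.

Lemma halving_flip2 : halving_flip * halving_flip = 1.
Proof. by rewrite /halving_flip -conjMg g2 conj1g. Qed.

Lemma halving_wordE : halving_word g = g ord0 * halving_flip * g (inord 1).
Proof.
rewrite /halving_word (@prod_rev_invol _ (fun k => g (inord k))) // big_nat_recr //=.
rewrite (@big_ltn _ _ _ 1) // invgM (mulg1_eq (g2 _)) /halving_flip /conjg invgK.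
by rewrite !mulgA.
Qed.

End HalvingWord.

Lemma halving_word_morph (G H : groupType) (f : G -> H) n (g : 'I_n.+1 -> G) :
  {morph f : x y / x * y} -> f (halving_word g) = halving_word (f \o g).
Proof.
by move=> fM; rewrite /halving_word !fM !(big_morph f fM (morph1 fM)).
Qed.

Lemma involX_swap (G : groupType) (x y : G) m : x * x = 1 -> y * y = 1 ->
  (x * y) ^+ m = 1 -> (y * x) ^+ m = 1.
Proof.
move=> x2 y2 xy; have -> : y * x = (x * y)^-1 by rewrite invgM !(mulg1_eq x2, mulg1_eq y2).
by rewrite expVgn xy invg1.
Qed.

Lemma conjXg_invol (G : groupType) (z x : G) m : z * z = 1 -> (z * x * z) ^+ m = z * x ^+ m * z.
Proof.
move=> z2; have e y : z * y * z = y ^ z by rewrite /conjg (mulg1_eq z2) mulgA.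
by rewrite !e conjXg.
Qed.

Section HalvingRelations.
Variables (n s : nat).
Hypothesis n_ge3 : 3 <= n.
Local Notation O := (orthoplex_group n).
Local Notation V := (orthoplex_stab n).
Local Notation alpha := (orthoplex_central n).
Local Notation W := (vertex_group V alpha s).
Local Notation sg := (sigma (V := V) alpha s).
Local Notation U := (orthoplex_twist_group n s).
Local Notation rho := (@orthoplex_twist_gen n s).
Local Notation t := (orthoplex_nat_gen n).
Local Notation r := (halving_family rho).
Local Notation il := (@twist_inl n s).
Local Notation ir := (@twist_inr n s).
Local Notation z := (rho0 n s).
Let n_ge2 : 2 <= n. Proof. by lia. Qed.
Let n_gt0 : 0 < n. Proof. by lia. Qed.
Local Notation point0 := (point0 n_gt0).
Local Notation point_of := (point_of n_gt0).

Lemma halving_coxeter_shift (i j : 'I_n.+1) : 0 < i -> 0 < j ->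
  halving_coxeter i j = if i.-1 == j.-1 then 1%N else
    if (i.-1.+1 == j.-1) || (j.-1.+1 == i.-1) then if maxn i.-1 j.-1 == n.-1 then 4 else 3 else 2.
Proof.
move=> i0 j0; rewrite /halving_coxeter -val_eqE /=.
by have := ltn_ord i; have := ltn_ord j => jn in'; do !case: ifP; lia.
Qed.

Lemma halving_coxeter0 (i j k : 'I_n.+1) : i = 0%N :> nat -> k = 1%N :> nat -> 2 <= j ->
  halving_coxeter i j = halving_coxeter k j.
Proof.
move=> i0 k1 j2; rewrite /halving_coxeter -!val_eqE /= i0 k1.
by have := ltn_ord j => jn; do !case: ifP; lia.
Qed.

Lemma halving_coxeterC (i j : 'I_n.+1) : halving_coxeter i j = halving_coxeter j i.
Proof. by rewrite /halving_coxeter eq_sym minnC maxnC. Qed.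

Lemma point_of_base_gen0 : point_of (vertex_act (base_vertex V) (t 0)) = 1%N :> nat.
Proof. by rewrite point_of_act point_of_base_vertex move_gen. Qed.

Lemma halving_family_rel (i j : 'I_n.+1) : (r i * r j) ^+ halving_coxeter i j = 1.
Proof.
have r2 := @halving_family2 n s n_ge2.
wlog ij : i j / i <= j => [h|].
  have [/h//|/ltnW/h ji] := leqP i j.
  by apply: involX_swap => //; rewrite halving_coxeterC.
have [eij|nij] := eqVneq i j; first by rewrite eij /halving_coxeter eqxx expg1 r2.
have {nij}ij : i < j by move: nij; rewrite -val_eqE /=; lia.
have tE (k l : 'I_n.+1) : 0 < k -> 0 < l -> (il (t k.-1) * il (t l.-1)) ^+ halving_coxeter k l = 1.
  move=> k0 l0; rewrite -(twist_inlM s) halving_coxeter_shift //.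
  rewrite -(morphX _ (@twist_inlM n s)) nat_genX ?(morph1 (@twist_inlM n s)) //; have := ltn_ord k; have := ltn_ord l; lia.
have [i0|i0] := posnP i; last by rewrite !halving_familyS ?tE //; lia.
rewrite (halving_family0 s n_ge2 i0) halving_familyS //; last by lia.
have [j1|j2] : j = 1%N :> nat \/ 2 <= j by lia.
  rewrite j1 (_ : halving_coxeter i j = 2); last first.
    by rewrite /halving_coxeter -val_eqE /= i0 j1.
  have -> : z * il (t 0) * z * il (t 1.-1) = ir (sg (base_vertex V)) * ir (sg (vertex_act (base_vertex V) (t 0))).
    rewrite -twist_inrJ /conjg -(morphV (@twist_inlM n s)) nat_genV !mulgA; by [].
  rewrite -twist_inrM expg2 -twist_inrM.
  have c : commute (sg (base_vertex V)) (sg (vertex_act (base_vertex V) (t 0))).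
    apply: (sigma_commute s (n_gt0 := n_gt0)) => /(congr1 val) /=.
    by rewrite point_of_base_gen0 point_of_base_vertex /=; lia.
  rewrite mulgA -(mulgA (sg _)) -c mulgA (sigma2 s n_gt0) mul1g (sigma2 s n_gt0).
  exact: (morph1 (@twist_inrM n s)).
have n1 : 1 < n.+1 by lia.
rewrite (@halving_coxeter0 i j (Ordinal n1)) //.
have j1 : 0 < j.-1 by lia.
have Vj := tail_stab n_ge2 j1.
have -> : z * il (t 0) * z * il (t j.-1) = z * (il (t 0) * il (t j.-1)) * z.
  by rewrite -mulgA (rho0_stab s n_ge2 Vj) !mulgA.
rewrite conjXg_invol ?rho0K //.
have j0 : 0 < j by lia.
have := tE (Ordinal n1) j isT j0; rewrite /= => ->.
by rewrite mulg1 rho0K.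
Qed.

(** The sign change of the axis of [e_1]; its conjugate [beta] by the first
    generator is the sign change of the axis of [e_0]. *)
Definition orthoplex_flip : O := t n.-1 ^ (\prod_(1 <= k < n.-1) t k)^-1.
Local Notation gamma := orthoplex_flip.
Local Notation beta := (t 0 * gamma * t 0).

Lemma orthoplex_flip_stab : V gamma.
Proof.
have Vt (k : nat) : 0 < k -> V (t k) := @tail_stab n n_ge2 k.
have P : V (\prod_(1 <= k < n.-1) t k).
  rewrite big_seq; elim/big_ind: _ => [||k]; [exact: gen1|by move=> ? ?; exact: genM|].
  by rewrite mem_index_iota => /andP[k0 _]; exact: Vt.
have tn : V (t n.-1) by apply: Vt; lia.
rewrite /gamma /conjg invgK; apply: genM => //; apply: genM => //; exact: genV.
Qed.

Lemma orthoplex_flip2 : gamma * gamma = 1.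
Proof. by rewrite /gamma -conjMg nat_gen2 conj1g. Qed.

Lemma orthoplex_flip_move (x : 'I_n.*2) : x = 1%N :> nat -> move gamma x = rev_ord x.
Proof.
move=> x1; have yn : n.-1 < n.*2 by lia.
pose y := Ordinal yn; have Ax : move (\prod_(1 <= k < n.-1) t k) x = y.
  rewrite -(@move_walk n 1 n.-1 x y) //; last by lia.
  by congr move; apply: eq_big_nat => k kn; rewrite walk_lt //; lia.
rewrite /gamma /conjg invgK moveM Ax moveM.
have -> : move (t n.-1) y = rev_ord y.
  by apply: val_inj; rewrite /= move_gen /=; [reflect_cases|]; lia.
by rewrite move_rev -Ax moveK.
Qed.

Lemma orthoplex_gen0_move (x y : 'I_n.*2) : x = 0%N :> nat -> y = 1%N :> nat ->
  move (t 0) x = y /\ move (t 0) y = x.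
Proof.
by move=> x0 y1; split; apply: val_inj; rewrite /= move_gen //; reflect_cases; lia.
Qed.

Lemma antipode_flip : vertex_act (base_vertex V) beta = vertex_act (base_vertex V) alpha.
Proof.
apply: (@point_of_inj n n_gt0); rewrite (point_of_antipode n_gt0) point_of_act.
rewrite point_of_base_vertex; have n2 : 1 < n.*2 by lia.
have [e0 e1] := @orthoplex_gen0_move point0 (Ordinal n2) erefl erefl.
by rewrite (moveM (_ * gamma)) (moveM _ gamma) e0 orthoplex_flip_move // move_rev e1.
Qed.

Lemma neighbour_flip : vertex_act (vertex_act (base_vertex V) (t 0)) beta =
  vertex_act (base_vertex V) (t 0).
Proof.
apply: (@point_of_inj n n_gt0); rewrite !point_of_act.
rewrite point_of_base_vertex; have n2 : 1 < n.*2 by lia.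
have [e0 e1] := @orthoplex_gen0_move point0 (Ordinal n2) erefl erefl.
rewrite (moveM (_ * gamma)) (moveM _ gamma) e0 e1.
by have /(orthoplex_stabP n_gt0) -> := orthoplex_flip_stab.
Qed.

Lemma halving_family_inord k : 0 < k -> k <= n -> r (inord k) = il (t k.-1).
Proof.
move=> k0 kn; have e : (inord k : 'I_n.+1) = k :> nat by rewrite inordK.
by rewrite halving_familyS // e.
Qed.

Lemma halving_flip_inl : halving_flip r = il gamma.
Proof.
have iJ g h : il g ^ il h = il (g ^ h).
  by rewrite /conjg -(morphV (@twist_inlM n s)) -!(twist_inlM s).
rewrite /halving_flip halving_family_inord //; have -> : \prod_(2 <= k < n) r (inord k) = il (\prod_(1 <= k < n.-1) t k).
  rewrite (big_morph il (@twist_inlM n s) (morph1 (@twist_inlM n s))).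
  rewrite [LHS]big_add1 /=.
    rewrite (@eq_big_nat _ _ _ 1 n.-1 _ (fun k => il (t k))) // => k kn.
  by rewrite halving_family_inord //; lia.
by rewrite -(morphV (@twist_inlM n s)) iJ.
Qed.

(** The long word is [sigma_{e_0} sigma_{e_1} beta].  As [beta] negates [e_0] and
    fixes [e_1], the square of the word is [sigma_{e_0} sigma_{-e_0}], whose
    [s]-th power is [1]. *)
Lemma halving_word_rel : halving_word r ^+ (2 * s) = 1.
Proof.
have r2 := @halving_family2 n s n_ge2.
pose F0 := base_vertex V; pose F1 := vertex_act F0 (t 0).
have wE : halving_word r = ir (sg F0) * ir (sg F1) * il beta.
  rewrite halving_wordE // halving_flip_inl (halving_family0 s n_ge2 (i := ord0)) //.
  rewrite halving_family_inord //=.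
  rewrite -[ir (sg F1)]twist_inrJ /conjg -(morphV (@twist_inlM n s)) nat_genV.
  rewrite (twist_inlM s (_ * gamma)) (twist_inlM s _ gamma) !mulgA; do 2 congr (_ * _).
  have e : il (t 0) * il (t 0) = 1.
    by rewrite -(twist_inlM s) nat_gen2 (morph1 (@twist_inlM n s)).
  by rewrite -[RHS]mulgA e mulg1.
have beta2 : beta * beta = 1.
  move: orthoplex_flip2; generalize gamma => c c2.
  by rewrite !mulgA -(mulgA _ (t 0) (t 0)) nat_gen2 mulg1 -(mulgA (t 0) c) c2 mulg1 nat_gen2.
have c1 : commute (sg F1) (sg (vertex_act F0 alpha)).
  apply: (sigma_commute s (n_gt0 := n_gt0)) => /(congr1 val) /=.
  rewrite (point_of_antipode n_gt0) /= point_of_base_gen0 point_of_base_vertex /=; lia.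
have w2 : halving_word r ^+ 2 = ir (sg F0 * sg (vertex_act F0 alpha)).
  have bV : (il beta)^-1 = il beta.
    by rewrite -(morphV (@twist_inlM n s)) (mulg1_eq beta2).
  have bJ F : il beta * ir (sg F) = ir (sg (vertex_act F beta)) * il beta.
    by rewrite conjgCV bV twist_inrJ.
  have b2 : il beta * il beta = 1 by rewrite -{1}bV mulVg.
  have := bJ F1; have := bJ F0; rewrite antipode_flip neighbour_flip expg2 wE.
  move: (il beta) b2 => b b2 bF0 bF1; rewrite !twist_inrM.
  rewrite -!mulgA (mulgA b) bF0 -!mulgA (mulgA b (ir (sg F1))) bF1 -!mulgA b2 mulg1.
  have F11 : ir (sg F1) * ir (sg F1) = 1.
    by rewrite -twist_inrM (sigma2 s n_gt0) (morph1 (@twist_inrM n s)).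
  have {}c1 : ir (sg F1) * ir (sg (vertex_act F0 alpha)) = ir (sg (vertex_act F0 alpha)) * ir (sg F1).
    by rewrite -!twist_inrM c1.
  by rewrite (mulgA (ir (sg F1))) c1 -mulgA F11 mulg1.
rewrite expgnA w2; have := coxeter_genX (vertex_coxeter alpha s) F0 (vertex_act F0 alpha).
rewrite (vertex_coxeterE s n_gt0) point_of_antipode (negPf (rev_ord_neq n_gt0 _)) eqxx => e.
by rewrite -(morphX _ (@twist_inrM n s)) e (morph1 (@twist_inrM n s)).
Qed.

End HalvingRelations.

(** * Adding relators *)

Section AddedRelators.
Variables (I : choiceType) (R S : set (word I)).

Lemma normal_closureJ (G : groupType) (A : set G) x y :
  normal_closure A x -> normal_closure A (x ^ y).
Proof.
pose T := [set x | normal_closure A (x ^ y)]; move: x.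
apply: (gen_min (S := T)) => [|_ [a [g [Aa ->]]]].
  split=> [|u v]; first by rewrite /T /= conj1g; exact: gen1.
  by rewrite /T /= conjMg conjVg; exact: genF.
by rewrite /T /= -conjgM; apply: sub_gen; exists a, (g * y).
Qed.

Lemma word_class_nil : word_class R [::] = 1.
Proof. by []. Qed.

(** The kernel of the map to the group with the relators [S] added: the normal
    closure absorbs the steps that use [S], and conjugation accounts for words
    placed next to them. *)
Lemma word_congr_added (A : set (presented_group R)) u v :
  (forall w, S w -> A (word_class R w)) -> word_congr (R `|` S) u v ->
  normal_closure A (word_class R u / word_class R v).
Proof.
move=> SA; elim=> {u v}.
- by move=> u; rewrite mulgV; exact: gen1.
- by move=> u v _ /genV; rewrite invgF.
- by move=> v u w _ uv _ vw; have := genM uv vw; rewrite divgKA.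
- move=> u u' v v' _ uu _ vv; rewrite !word_classM.
  have := genM (normal_closureJ (word_class R u)^-1 vv) uu.
  by rewrite /conjg invgK invgM !mulgA mulgVK.
- move=> a; rewrite (_ : word_class R [:: a; _] = word_class R [::]) ?mulgV; first exact: gen1.
  exact/word_classP/word_congr_inv.
- move=> r [Rr|Sr].
    rewrite (_ : word_class R r = word_class R [::]) ?mulgV; first exact: gen1.
    exact/word_classP/word_congr_rel.
  have -> : word_class R r / word_class R [::] = word_class R r ^ 1.
    by rewrite word_class_nil conjg1 divg1.
  by apply: sub_gen; exists (word_class R r), 1; split=> //; exact: SA.
Qed.

End AddedRelators.

Definition flat_word (I : Type) (l : seq I) : word I := [seq (i, false) | i <- l].

Lemma eval_flat_word (I : Type) (G : groupType) (f : I -> G) l :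
  eval_word f (flat_word l) = \prod_(i <- l) f i.
Proof. by rewrite /eval_word big_map. Qed.

Lemma eval_flat_wordX (I : Type) (G : groupType) (f : I -> G) l m :
  eval_word f (flat_word (flatten (nseq m l))) = (\prod_(i <- l) f i) ^+ m.
Proof.
rewrite eval_flat_word; elim: m => [|m IHm]; first by rewrite big_nil.
by rewrite /= big_cat IHm expgS.
Qed.

Definition halving_letters n : seq 'I_n.+1 :=
  ord0 :: [seq inord k | k <- index_iota 2 n.+1] ++ [seq inord (n - k) | k <- index_iota 1 n].

Lemma halving_lettersE (G : groupType) n (g : 'I_n.+1 -> G) :
  \prod_(i <- halving_letters n) g i = halving_word g.
Proof. by rewrite /halving_letters big_cons big_cat !big_map /= mulgA. Qed.

(** * The group with the extra relation, and its extension by a swap *)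

Section TwistImage.
Variables (n s : nat).
Hypothesis n_ge3 : 3 <= n.
Let n_ge2 : 2 <= n. Proof. by lia. Qed.
Let n_gt0 : 0 < n. Proof. by lia. Qed.
Implicit Types (i j k : 'I_n.+1).

Definition long_relator : word 'I_n.+1 :=
  flat_word (flatten (nseq (2 * s) (halving_letters n))).

(** The relations of the halving group: those of its Coxeter diagram and the
    power of the long word. *)
Definition halving_relators : set (word 'I_n.+1) :=
  coxeter_rel (@halving_coxeter n) `|` [set long_relator].

Local Notation Q := (presented_group halving_relators).
Local Notation q := (pres_gen halving_relators).

Lemma halving_presP (G : groupType) (f : 'I_n.+1 -> G) :
  (forall i j, (f i * f j) ^+ halving_coxeter i j = 1) -> halving_word f ^+ (2 * s) = 1 ->
  forall w, halving_relators w -> eval_word f w = 1.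
Proof.
move=> f1 f2 w [[i [j ->]]|->]; first by rewrite eval_coxeter_rel.
by rewrite eval_flat_wordX halving_lettersE.
Qed.

Lemma relator_genX i j : (q i * q j) ^+ halving_coxeter i j = 1.
Proof. by rewrite -eval_coxeter_rel; apply: pres_rel; left; exists i, j. Qed.

Lemma relator_long_word : halving_word q ^+ (2 * s) = 1.
Proof. by rewrite -halving_lettersE -eval_flat_wordX; apply: pres_rel; right. Qed.

Lemma relator_gen2 i : q i * q i = 1.
Proof. by have := relator_genX i i; rewrite /halving_coxeter eqxx expg1. Qed.

Definition swap01 i : 'I_n.+1 :=
  if i == 0%N :> nat then inord 1 else if i == 1%N :> nat then ord0 else i.

Lemma swap01_0 : swap01 ord0 = inord 1. Proof. by []. Qed.
Lemma swap01_1 : swap01 (inord 1) = ord0.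
Proof. by rewrite /swap01 inordK //; lia. Qed.
Lemma swap01_ge i : 2 <= i -> swap01 i = i.
Proof. by rewrite /swap01; do 2 case: eqP => [->|_] //. Qed.

Lemma swap01P i : (i = ord0 /\ swap01 i = inord 1) \/ (i = inord 1 /\ swap01 i = ord0) \/
  (2 <= i /\ swap01 i = i).
Proof.
have [i2|i2] := leqP 2 i; first by right; right; split=> //; exact: swap01_ge.
have [i0|i0] := posnP i.
  have e : i = ord0 by apply: val_inj.
  by left; rewrite e.
have e : i = inord 1 by apply: val_inj; rewrite /= inordK; lia.
by right; left; rewrite e swap01_1.
Qed.

Lemma swap01K : involutive swap01.
Proof.
by move=> i; have [[-> ->]|[[-> ->]|[i2 e]]] := swap01P i; rewrite ?swap01_1 ?swap01_0 ?e.
Qed.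

Lemma halving_coxeter_swap i j : halving_coxeter (swap01 i) (swap01 j) = halving_coxeter i j.
Proof.
have v1 : (inord 1 : 'I_n.+1) = 1%N :> nat by rewrite inordK //; lia.
rewrite /halving_coxeter -!val_eqE /=; have := ltn_ord i; have := ltn_ord j => jn in'.
have [[-> ->]|[[-> ->]|[i2 ->]]] := swap01P i;
  have [[-> ->]|[[-> ->]|[j2 ->]]] := swap01P j; rewrite ?v1 /=; do ?case: ifP => *; lia.
Qed.

Lemma halving_flip_swap (G : groupType) (f : 'I_n.+1 -> G) :
  halving_flip (f \o swap01) = halving_flip f.
Proof.
have v m : 2 <= m -> m <= n -> (f \o swap01) (inord m) = f (inord m).
  by move=> m2 mn; rewrite /comp swap01_ge // inordK.
rewrite /halving_flip v //; congr (_ ^ _^-1).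
by apply: eq_big_nat => m mn; rewrite v //; lia.
Qed.

(** The swap turns the long word [q_0 f q_1] into [q_1 f q_0], its inverse. *)
Lemma presented_swap_rel w : halving_relators w -> eval_word (q \o swap01) w = 1.
Proof.
apply: halving_presP => [i j|]; first by rewrite /= -(halving_coxeter_swap i j) relator_genX.
rewrite halving_wordE //; last by move=> i; exact: relator_gen2.
rewrite halving_flip_swap /= swap01_0 swap01_1.
have := relator_long_word; rewrite halving_wordE //; last exact: relator_gen2.
have f2 := halving_flip2 relator_gen2.
move: (halving_flip q) f2 => f f2 h; apply: invg_inj; rewrite invg1 -expVgn !invgM.
by rewrite (mulg1_eq f2) !(mulg1_eq (relator_gen2 _)) mulgA.
Qed.

Definition presented_swap (x : Q) : Q := pres_lift (q \o swap01) x.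

Lemma presented_swapM : {morph presented_swap : x y / x * y}.
Proof. exact: pres_liftM presented_swap_rel. Qed.

Lemma presented_swap_gen i : presented_swap (q i) = q (swap01 i).
Proof. exact: (pres_lift_gen presented_swap_rel). Qed.

Lemma presented_swapK : involutive presented_swap.
Proof.
apply: (pres_ind_morph (p := presented_swap \o presented_swap) (q := id)) => //.
  by move=> x y /=; rewrite !presented_swapM.
by move=> i /=; rewrite !presented_swap_gen swap01K.
Qed.

(** The symmetric group on [bool] serves as the group of order two that acts by
    the swap. *)
Definition swap_act (x : Q) (p : {perm bool}) : Q := if odd_perm p then presented_swap x else x.

Lemma swap_act1 x : swap_act x 1 = x.
Proof. by rewrite /swap_act odd_perm1. Qed.

Lemma swap_actA x p p' : swap_act x (p * p') = swap_act (swap_act x p) p'.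
Proof.
by rewrite /swap_act odd_permM; case: (odd_perm p); case: (odd_perm p'); rewrite /= ?presented_swapK.
Qed.

Lemma swap_actM p : {morph swap_act^~ p : x y / x * y}.
Proof. by move=> x y; rewrite /swap_act; case: odd_perm; rewrite ?presented_swapM. Qed.

Definition swap_ract : right_action {perm bool} Q := RightAction swap_act1 swap_actA swap_actM.

Local Notation E := (semidirect swap_ract).
Definition theta : E := sd_inl swap_ract (tperm true false).
Definition presented_inr (x : Q) : E := sd_inr swap_ract x.

Lemma presented_inrM : {morph presented_inr : x y / x * y}.
Proof. exact: sd_inrM. Qed.

Lemma theta2 : theta * theta = 1.
Proof. by rewrite /theta -sd_inlM tperm2; exact: morph1 (@sd_inlM _ _ swap_ract). Qed.

Lemma presented_inrJ x : presented_inr x ^ theta = presented_inr (presented_swap x).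
Proof. by rewrite [LHS]sd_inrJ; congr (sd_inr _ _); rewrite /= /swap_act odd_tperm. Qed.

Lemma presented_inr_inj : injective presented_inr.
Proof. by move=> x y []. Qed.

Local Notation O := (orthoplex_group n).
Local Notation V := (orthoplex_stab n).
Local Notation alpha := (orthoplex_central n).
Local Notation W := (vertex_group V alpha s).
Local Notation sg := (sigma (V := V) alpha s).
Local Notation U := (orthoplex_twist_group n s).
Local Notation t := (orthoplex_nat_gen n).
Implicit Types (F : vertex V) (g h : O).

Definition orthoplex_image_gen (i : 'I_n) : Q := q (lift ord0 i).

Lemma orthoplex_image_rel w : coxeter_rel (@orthoplex_coxeter n) w ->
  eval_word orthoplex_image_gen w = 1.
Proof.
move=> [i [j ->]]; rewrite eval_coxeter_rel.
have -> : orthoplex_coxeter i j = halving_coxeter (lift ord0 i) (lift ord0 j).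
  by rewrite halving_coxeter_shift // /orthoplex_coxeter -val_eqE /=.
exact: relator_genX.
Qed.

Definition orthoplex_image g : E := presented_inr (pres_lift orthoplex_image_gen g).
Local Notation pO := orthoplex_image.

Lemma orthoplex_imageM : {morph pO : g h / g * h}.
Proof. by move=> g h; rewrite /pO (pres_liftM orthoplex_image_rel) presented_inrM. Qed.

Lemma orthoplex_image_t (k : nat) : k < n -> pO (t k) = presented_inr (q (inord k.+1)).
Proof.
move=> kn; rewrite (orthoplex_nat_genE (Ordinal kn) : t k = _) /pO.
rewrite [pres_lift _ _](pres_lift_gen orthoplex_image_rel); congr (presented_inr (q _)).
by apply: val_inj; rewrite /= inordK.
Qed.

Lemma presented_inr_gen2 i : presented_inr (q i) * presented_inr (q i) = 1.
Proof. by rewrite -presented_inrM relator_gen2; exact: morph1 presented_inrM. Qed.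

Lemma presented_inr_thetaJ i : theta * presented_inr (q i) * theta = presented_inr (q (swap01 i)).
Proof.
by rewrite -presented_swap_gen -presented_inrJ /conjg (mulg1_eq theta2) mulgA.
Qed.

(** The stabilizer of the base vertex is generated by the generators from the
    second on, whose images the swap fixes. *)
Lemma theta_stab g : V g -> commute theta (pO g).
Proof.
rewrite orthoplex_stabE; pose T := [set g | commute theta (pO g)]; move: g.
apply: (gen_min (S := T)) => [|_ [k /= /andP[k0 kn] <-]].
  split=> [|g h]; first by rewrite /T /= (morph1 orthoplex_imageM); exact: commute1.
  rewrite /T /= orthoplex_imageM (morphV orthoplex_imageM) => cg ch.
  by apply: commuteM => //; exact: commuteV.
rewrite /T /= orthoplex_image_t //; have := presented_inr_thetaJ (inord k.+1).
rewrite swap01_ge ?inordK // => /(congr1 (fun x => x * theta)).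
by rewrite -mulgA theta2 mulg1.
Qed.

(** The image of [sigma_F]: the reflection in the base vertex goes to [theta], and
    [F] is the image of the base vertex under the walk to it. *)
Definition reflection_image F : E := theta ^ pO (walk_prod n 0 (point_of n_gt0 F)).
Local Notation tau := reflection_image.

Lemma reflection_image_base g : tau (vertex_act (base_vertex V) g) = theta ^ pO g.
Proof.
rewrite /tau; set h := walk_prod _ _ _.
have Vgh : V (g / h).
  apply/rcosetE/(rcoset_stabP n_gt0).
  have := vertex_atK n_gt0 (point_of n_gt0 (vertex_act (base_vertex V) g)).
  by rewrite /vertex_at -/h !(point_of_base n_gt0).
rewrite -[in RHS](mulgVK h g) orthoplex_imageM conjgM; congr (_ ^ _).
by rewrite /conjg (theta_stab Vgh) mulKg.
Qed.

Lemma reflection_image_base0 : tau (base_vertex V) = theta.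
Proof.
rewrite -[base_vertex V]vertex_act1 reflection_image_base (morph1 orthoplex_imageM).
exact: conjg1.
Qed.

Lemma reflection_image_act F g : tau (vertex_act F g) = tau F ^ pO g.
Proof.
have [h ->] := vertexP F.
by rewrite -vertex_actM !reflection_image_base orthoplex_imageM conjgM.
Qed.

Lemma halving_flip_image : pO (orthoplex_flip n) = presented_inr (halving_flip q).
Proof.
have pJ g h : pO (g ^ h) = pO g ^ pO h.
  by rewrite /conjg !orthoplex_imageM (morphV orthoplex_imageM).
have iJ x y : presented_inr (x ^ y) = presented_inr x ^ presented_inr y by rewrite /conjg !presented_inrM (morphV presented_inrM).
rewrite /orthoplex_flip /halving_flip pJ iJ (morphV orthoplex_imageM) (morphV presented_inrM).
have nn : n.-1 < n by lia.
rewrite (orthoplex_image_t nn) prednK //.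
congr (_ ^ _^-1); rewrite (big_morph presented_inr presented_inrM (morph1 presented_inrM)).
rewrite (big_morph pO orthoplex_imageM (morph1 orthoplex_imageM)) [RHS]big_add1 /=.
by apply: eq_big_nat => k kn; rewrite orthoplex_image_t //; lia.
Qed.

Lemma presented_inr_commute01 : commute (presented_inr (q ord0)) (presented_inr (q (inord 1))).
Proof.
have := relator_genX ord0 (inord 1); rewrite (_ : halving_coxeter _ _ = 2); last first.
  by rewrite /halving_coxeter -val_eqE /= inordK //; lia.
rewrite expg2 => /mulg1_eq; rewrite invgM !(mulg1_eq (relator_gen2 _)) => e.
by rewrite /commute -!presented_inrM e.
Qed.

(** If [F] is the antipode of the base vertex, the product on the left is the
    square of the long word.  If [F] is any other vertex than these two, the walk
    to it is the first generator followed by an element that commutes with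
    [theta], so the product is conjugate to [q_0 q_1]. *)
Lemma theta_image_rel F :
  (theta * tau F) ^+ vertex_coxeter alpha s (base_vertex V) F = 1.
Proof.
rewrite (vertex_coxeterE s n_gt0) point_of_base_vertex.
have nat_genV : theta^-1 = theta := mulg1_eq theta2.
case: eqP => [F0|F0].
  have -> : F = base_vertex V.
    by apply: (@point_of_inj n n_gt0); rewrite F0 point_of_base_vertex.
  by rewrite reflection_image_base0 expg1 theta2.
have x1E : pO (t 0) = presented_inr (q (inord 1)) by rewrite orthoplex_image_t.
have x0E : theta * presented_inr (q (inord 1)) * theta = presented_inr (q ord0).
  by rewrite presented_inr_thetaJ swap01_1.
case: eqP => [Fr|Fr].
  have -> : F = vertex_act (base_vertex V) (t 0 * orthoplex_flip n * t 0).
    apply: (@point_of_inj n n_gt0); rewrite Fr antipode_flip //.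
    by rewrite point_of_antipode point_of_base_vertex.
  have c := theta_stab (orthoplex_flip_stab n_ge3).
  have := relator_long_word; rewrite halving_wordE //; last exact: relator_gen2.
  rewrite reflection_image_base (orthoplex_imageM (_ * orthoplex_flip n)).
  rewrite (orthoplex_imageM _ (orthoplex_flip n)) x1E; move: c.
  rewrite halving_flip_image expgnA => c e.
  have {}e : ((presented_inr (q ord0) * presented_inr (halving_flip q) * presented_inr (q (inord 1))) ^+ 2) ^+ s = 1.
    by rewrite -!presented_inrM -!(morphX _ presented_inrM) e (morph1 presented_inrM).
  rewrite -[RHS]e; congr (_ ^+ s).
  have f2 : presented_inr (halving_flip q) * presented_inr (halving_flip q) = 1.
    by rewrite -presented_inrM halving_flip2 ?(morph1 presented_inrM) // => i; exact: relator_gen2.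
  have y2 := presented_inr_gen2 (inord 1); have xy := presented_inr_commute01.
  rewrite -x0E in xy *; move: (presented_inr (halving_flip q)) (presented_inr (q (inord 1))) c f2 y2 xy.
  move=> f y c f2 y2 xy {e x0E x1E}.
  rewrite /conjg !invgM (mulg1_eq f2) (mulg1_eq y2) expg2 !mulgA.
  (* [f] commutes with [theta], and [y] with its conjugate by [theta] *)
  have k : theta * f * theta = f by rewrite c -mulgA theta2 mulg1.
  transitivity (theta * y * (theta * f * theta) * y * theta * y * f * y).
    by rewrite k.
  transitivity (theta * y * theta * f * (theta * y * theta * y) * f * y).
    by rewrite !mulgA.
  by rewrite xy !mulgA.
have p1 : 1 <= point_of n_gt0 F.
  by rewrite lt0n; apply/eqP => e; apply: F0; apply: val_inj.
have [pn pr] : point_of n_gt0 F < n.*2 /\ point_of n_gt0 F <> n.*2.-1 :> nat.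
  by split=> // e; apply: Fr; apply: val_inj; rewrite /= e; lia.
have -> : F = vertex_act (base_vertex V) (t 0 * walk_prod n 1 (point_of n_gt0 F)).
  rewrite -[LHS](point_ofK n_gt0) /vertex_at; congr (vertex_act _ _).
  by rewrite /walk_prod big_ltn // walk_lt.
have Vw : V (walk_prod n 1 (point_of n_gt0 F)).
  rewrite /walk_prod big_seq; elim/big_ind: _ => [||k]; [exact: gen1|by move=> ? ?; exact: genM|].
  rewrite mem_index_iota => kp; apply: (@tail_stab n n_ge2 (walk_idx n k)).
  by rewrite /walk_idx; case: ifP; lia.
have cw := theta_stab Vw.
rewrite reflection_image_base orthoplex_imageM conjgM.
have {1}-> : theta = theta ^ pO (walk_prod n 1 (point_of n_gt0 F)).
  by rewrite /conjg cw mulKg.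
rewrite -conjMg -conjXg; apply/eqP; rewrite conjg_eq1; apply/eqP.
have -> : theta * theta ^ pO (t 0) = presented_inr (q ord0) * presented_inr (q (inord 1)).
  by rewrite /conjg x1E (mulg1_eq (presented_inr_gen2 _)) -x0E !mulgA.
rewrite expg2 {1}presented_inr_commute01 mulgA -(mulgA _ (presented_inr (q ord0)) (presented_inr (q ord0))).
by rewrite presented_inr_gen2 mulg1 presented_inr_gen2.
Qed.

Lemma reflection_image_rel w : coxeter_rel (vertex_coxeter alpha s) w ->
  eval_word tau w = 1.
Proof.
move=> [F [F' ->]]; rewrite eval_coxeter_rel.
have [h ->] := vertexP F; have -> : F' = vertex_act (vertex_act F' h^-1) h.
  by rewrite -vertex_actM mulVg vertex_act1.
move: (vertex_act F' h^-1) => F''.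
rewrite (vertex_coxeter_act (@orthoplex_centralP n)) !reflection_image_act.
by rewrite -conjMg -conjXg reflection_image_base0 theta_image_rel conj1g.
Qed.

Definition vertex_image (w : W) : E := pres_lift tau w.

Lemma vertex_imageM : {morph vertex_image : v w / v * w}.
Proof. exact: pres_liftM reflection_image_rel. Qed.

Lemma vertex_image_sigma F : vertex_image (sg F) = tau F.
Proof. exact: (pres_lift_gen reflection_image_rel). Qed.

Lemma vertex_image_act w g :
  vertex_image (vertex_group_ract V (@orthoplex_centralP n) s w g) = vertex_image w ^ pO g.
Proof.
move: w; apply: (pres_ind_morph
  (p := fun w => vertex_image (vertex_group_ract V (@orthoplex_centralP n) s w g))
  (q := fun w => vertex_image w ^ pO g)).
- by move=> v w; rewrite ractM vertex_imageM.
- by move=> v w; rewrite vertex_imageM conjMg.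
move=> F; rewrite [X in vertex_image X](vertex_group_act_gen (@orthoplex_centralP n)).
by rewrite vertex_image_sigma reflection_image_act -vertex_image_sigma.
Qed.

(** The morphism that sends [rho_0] to [theta] and the other generators of the
    group of the polytope to those of [Q]. *)
Definition twist_image (x : U) : E := pO x.1 * vertex_image x.2.

Lemma twist_imageM : {morph twist_image : x y / x * y}.
Proof.
move=> [g v] [h w]; rewrite /twist_image /= orthoplex_imageM vertex_imageM.
rewrite [X in X * vertex_image w]vertex_image_act.
by rewrite /conjg -!mulgA (mulgA (pO h) (pO h)^-1) mulgV mul1g.
Qed.

Lemma twist_image_gen i : twist_image (halving_family (@orthoplex_twist_gen n s) i) = presented_inr (q i).
Proof.
have Pil g : twist_image (twist_inl s g) = pO g.
  by rewrite /twist_image /= (morph1 vertex_imageM) mulg1.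
have [i0|i0] := posnP i; last first.
  rewrite halving_familyS // Pil orthoplex_image_t; last by have := ltn_ord i; lia.
  by congr (presented_inr (q _)); apply: val_inj; rewrite /= inordK prednK.
have Pz : twist_image (rho0 n s) = theta.
  rewrite /twist_image /= (morph1 orthoplex_imageM) mul1g vertex_image_sigma.
  exact: reflection_image_base0.
rewrite (halving_family0 s n_ge2 i0) !twist_imageM Pz Pil orthoplex_image_t //.
by rewrite presented_inr_thetaJ swap01_1; congr (presented_inr (q _)); apply: val_inj.
Qed.

(** [twist_image] sends the generators of the halving group to those of [Q], so
    it detects triviality in [Q]. *)
Lemma halving_word_trivial (w : word 'I_n.+1) :
  eval_word (halving_family (@orthoplex_twist_gen n s)) w = 1 -> word_congr halving_relators w [::].
Proof.
move=> w1; apply/word_classP; rewrite word_class_nil; apply: presented_inr_inj.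
rewrite (morph1 presented_inrM) -(morph1 twist_imageM) -w1 word_class_eval /eval_word.
rewrite (big_morph presented_inr presented_inrM (morph1 presented_inrM)) (big_morph _ twist_imageM (morph1 twist_imageM)).
apply: eq_bigr => -[i b] _; rewrite /eval_letter /=.
by case: b; rewrite ?(morphV presented_inrM) ?(morphV twist_imageM) twist_image_gen.
Qed.

End TwistImage.

(** * The order of the halving group *)

Lemma has_card_eq (T : Type) (A : set T) m : has_card A m -> (A #= `I_m)%card.
Proof.
move=> [F [f [fI <- <-]]]; have h1 : (range f #= [set: F])%card.
  by apply: inj_card_eq => x y _ _; exact: fI.
apply: card_eq_trans h1 _; rewrite card_eq_sym.
have <- : range (fun x : F => nat_of_ord (enum_rank x)) = `I_#|F|.
  apply/seteqP; split=> [_ [x _ <-]|k kF]; first exact: ltn_ord.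
  by exists (enum_val (Ordinal kF)) => //; rewrite enum_valK.
by apply: inj_card_eq => x y _ _ /val_inj/enum_rank_inj.
Qed.

(** The two halves are in bijection under right multiplication by [z]. *)
Lemma has_card_half (G : groupType) (K : set G) (z : G) m :
  has_card [set: G] (m * 2) -> (forall x, K (x * z) <-> ~ K x) -> has_card K m.
Proof.
move=> [F [f [fI fT fc]]] Kz.
have /choice[a aP] : forall x : F, exists y, f y = f x * z.
  move=> x; have : range f (f x * z) by rewrite fT.
  by move=> [y _ <-]; exists y.
have aI : injective a by move=> x y e; apply: fI; apply: (@mulIg _ z); rewrite -!aP e.
pose P := [set x | `[< K (f x) >]]%SET.
have aPP x : (a x \in P) = (x \notin P).
  by rewrite !finset.inE aP; apply/asboolP/asboolPn => /Kz.
have Pc : #|P| = #|~: P|.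
  apply/eqP; rewrite eqn_leq; apply/andP; split.
    rewrite -(card_imset P aI); apply/subset_leq_card/fintype.subsetP => _ /imsetP[x Px ->].
    by rewrite finset.in_setC aPP Px.
  rewrite -(card_imset (~: P)%SET aI); apply/subset_leq_card/fintype.subsetP => _ /imsetP[x Px ->].
  by rewrite aPP -finset.in_setC.
exists {x | x \in P}, (fun x => f (val x)); split.
- by move=> x y /fI/val_inj.
- apply/seteqP; split=> [_ [[x Px] _ <-]|x Kx] /=.
    by move: Px; rewrite finset.inE => /asboolP.
  have [y _ yx] : range f x by rewrite fT.
  have Py : y \in P by rewrite finset.inE yx; apply/asboolP.
  by exists (exist _ y Py).
- have -> : #|{: {x | x \in P}}| = #|P| by rewrite card_sig; exact: eq_card.
  by have := cardsC P; rewrite -Pc fc; lia.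
Qed.

Lemma halving_orderE n s : 0 < n ->
  ((2 ^ n * n`! * (s * 2) ^ n)./2 = (4 * s) ^ n.-1 * (2 * s) * n`!)%N.
Proof.
case: n => // m _; rewrite /= !expnMn !expnS (_ : 4 = 2 * 2)%N // expnMn.
set f := m.+1`!; set a := (2 ^ m)%N; set b := (s ^ m)%N.
rewrite (_ : _ * _ = (a * a * b * (2 * s) * f).*2)%N ?doubleK //; nia.
Qed.

Section HalvingOrder.
Variables (n s : nat).
Hypothesis n_ge2 : 2 <= n.
Hypothesis s_ge2 : 2 <= s.
Local Notation O := (orthoplex_group n).
Local Notation V := (orthoplex_stab n).
Local Notation alpha := (orthoplex_central n).
Local Notation W := (vertex_group V alpha s).
Local Notation sg := (sigma (V := V) alpha s).
Local Notation U := (orthoplex_twist_group n s).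
Local Notation r := (halving_family (@orthoplex_twist_gen n s)).
Local Notation z := (rho0 n s).
Local Notation act := (vertex_group_ract V (@orthoplex_centralP n) s).
Let n_gt0 : 0 < n. Proof. by lia. Qed.

Lemma twist_card : has_card [set: U] (2 ^ n * n`! * (s * 2) ^ n).
Proof.
have [F [f [fI fT fc]]] := orthoplex_card n.
have [F' [f' [fI' fT' fc']]] := vertex_group_card n_gt0 s_ge2.
exists (F * F')%type, (fun x => (f x.1, f' x.2) : U); split.
- by move=> [a b] [a' b'] /= [/fI -> /fI' ->].
- apply/seteqP; split=> // -[g w] _.
  have [a _ <-] : range f g by rewrite fT.
  have [b _ <-] : range f' w by rewrite fT'.
  by exists (a, b).
- by rewrite card_prod fc fc'.
Qed.

(** The parity of the number of vertex reflections in a word, which is well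
    defined since all relators have even length. *)
Definition vertex_parity (w : W) : {perm bool} := pres_lift (fun=> tperm true false) w.

Lemma vertex_parity_rel w : coxeter_rel (vertex_coxeter (V := V) alpha s) w ->
  eval_word (fun=> tperm true false : {perm bool}) w = 1.
Proof.
move=> [F [F' ->]]; rewrite eval_coxeter_rel tperm2; elim: (vertex_coxeter _ _ _ _) => // m IHm.
by rewrite expgS IHm mulg1.
Qed.

Lemma vertex_parityM : {morph vertex_parity : v w / v * w}.
Proof. exact: pres_liftM vertex_parity_rel. Qed.

Lemma vertex_parity_sigma F : vertex_parity (sg F) = tperm true false.
Proof. exact: (pres_lift_gen vertex_parity_rel). Qed.

Lemma vertex_parity_act w g : vertex_parity (act w g) = vertex_parity w.
Proof.
move: w; apply: (pres_ind_morph (p := fun w => vertex_parity (act w g)) (q := vertex_parity)).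
- by move=> v w; rewrite ractM vertex_parityM.
- exact: vertex_parityM.
move=> F; rewrite [X in vertex_parity X](vertex_group_act_gen (@orthoplex_centralP n)).
by rewrite !vertex_parity_sigma.
Qed.

Definition twist_parity (x : U) : {perm bool} := vertex_parity x.2.

Lemma twist_parityM : {morph twist_parity : x y / x * y}.
Proof.
move=> [g v] [h w]; rewrite /twist_parity /= vertex_parityM.
by congr (_ * _); exact: vertex_parity_act.
Qed.

Lemma rho0_parity : twist_parity z = tperm true false.
Proof. exact: vertex_parity_sigma. Qed.

Lemma halving_parity x : gen (range r) x -> twist_parity x = 1.
Proof.
have inl1 g : twist_parity (twist_inl s g) = 1 by exact: morph1 vertex_parityM.
pose T := [set x | twist_parity x = 1]; move: x; apply: (gen_min (S := T)).
  split=> [|x y]; first exact: morph1 twist_parityM.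
  by rewrite /T /= twist_parityM (morphV twist_parityM) => -> ->; rewrite mulgV.
move=> _ [i _ <-]; rewrite /T /=; have [i0|i0] := posnP i.
  rewrite (halving_family0 s n_ge2 i0) !twist_parityM inl1 mulg1.
  by rewrite rho0_parity tperm2.
by rewrite halving_familyS.
Qed.

Lemma rho0_notin : ~ gen (range r) z.
Proof.
move=> /halving_parity; rewrite rho0_parity => /(congr1 (fun p : {perm bool} => p true)).
by rewrite tpermL perm1.
Qed.

Lemma halving_rho0J x : gen (range r) x -> gen (range r) (z * x * z).
Proof.
pose T := [set x | gen (range r) (z * x * z)]; move: x.
have zz := @rho0K n s n_ge2.
apply: (gen_min (S := T)) => [|_ [i _ <-]].
  split=> [|x y]; first by rewrite /T /= mulg1 zz; exact: gen1.
  rewrite /T /= => Sx Sy; have -> : z * (x / y) * z = (z * x * z) / (z * y * z).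
    by rewrite !invgM (mulg1_eq zz) !mulgA -(mulgA _ z z) zz mulg1.
  exact: genF.
rewrite /T /=; have [i2|i2] := leqP 2 i.
  by rewrite rho0J_gen //; apply: sub_gen; exists i.
have n1 : 1 < n.+1 by lia.
have [i0|i0] := posnP i.
  by rewrite (@rho0J_gen0 n s n_ge2 i (Ordinal n1)) //; apply: sub_gen; exists (Ordinal n1).
rewrite (@rho0J_gen1 n s n_ge2 ord0 i) //; last by lia.
by apply: sub_gen; exists ord0.
Qed.

(** The union of [H] and [H rho_0] is stable under right multiplication by [H],
    which [rho_0] normalizes, and by [rho_0], and these generate the group. *)
Lemma twist_cover x : gen (range r) x \/ gen (range r) (x * z).
Proof.
have zz := @rho0K n s n_ge2.
pose C := [set x | gen (range r) x \/ gen (range r) (x * z)].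
have CH y h : C y -> gen (range r) h -> C (y * h).
  move=> [Hy|Hyz] Hh; first by left; exact: genM.
  right; have -> : y * h * z = (y * z) * (z * h * z) by rewrite !mulgA -(mulgA y z z) zz mulg1.
  by apply: genM => //; exact: halving_rho0J.
have Cz y : C y -> C (y * z).
  by move=> [Hy|Hyz]; [right; rewrite -mulgA zz mulg1|left].
have Hil g : gen (range r) (twist_inl s g).
  apply: (pres_ind (S := [set g | gen (range r) (twist_inl s g)])).
    split=> [|g1 g2] /=; first by rewrite (morph1 (@twist_inlM n s)); exact: gen1.
    by rewrite (@twist_inlM n s) (morphV (@twist_inlM n s)); exact: genF.
  move=> i /=; have -> : pres_gen _ i = orthoplex_nat_gen n i by rewrite orthoplex_nat_genE.
  have -> : twist_inl s (orthoplex_nat_gen n i) = r (lift ord0 i).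
    by rewrite halving_familyS.
  by apply: sub_gen; exists (lift ord0 i).
have Cir w : forall y, C y -> C (y * twist_inr w).
  have A2 a : range (pres_gen (coxeter_rel (vertex_coxeter (V := V) alpha s))) a -> a * a = 1.
    by move=> [F _ <-]; exact: (sigma2 s n_gt0).
  apply: (gen_invol_ind A2 (P := fun w => forall y, C y -> C (y * twist_inr w))) (pres_gen_span w).
    by move=> y Cy; rewrite (morph1 (@twist_inrM n s)) mulg1.
  move=> v _ _ [F _ <-] IHv y Cy; rewrite (@twist_inrM n s) mulgA.
  have [g ->] := vertexP F; have e := twist_inrJ s (base_vertex V) g.
  rewrite -[twist_inr (pres_gen _ _)]e /conjg !mulgA.
  exact: (CH _ _ (Cz _ (CH _ _ (IHv y Cy) (genV (Hil g)))) (Hil g)).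
by rewrite (twistE x); apply: Cir; left; exact: Hil.
Qed.

Lemma halving_set_card : has_card (gen (range r)) (2 ^ n * n`! * (s * 2) ^ n)./2%N.
Proof.
apply: (has_card_half (z := z)).
  have e : (2 ^ n * n`! * (s * 2) ^ n = (2 ^ n.-1 * n`! * (s * 2) ^ n).*2)%N.
    by rewrite -{1}(prednK n_gt0) expnS; lia.
  by rewrite e doubleK muln2 -e; exact: twist_card.
move=> x; have [Hx|Hxz] := twist_cover x.
  by split=> // Hxz; case: rho0_notin; exact: genMl Hx Hxz.
split=> // _ Hx; case: rho0_notin; exact: genMl Hx Hxz.
Qed.

Lemma halving_card : ([set: halving_group (@orthoplex_twist_gen n s)] #=
  `I_((4 * s) ^ n.-1 * (2 * s) * n`!)%N)%card.
Proof.
have [F [f [fI fH fc]]] := halving_set_card; apply: has_card_eq.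
have fin x : f x \in gen (range r) by apply/mem_set; rewrite -fH; exists x.
exists F, (fun x => exist _ (f x) (fin x) : halving_group _); split.
- by move=> x y /(congr1 val) /fI.
- apply/seteqP; split=> // h _; have [x _ xh] : range f (val h).
    by rewrite fH; apply/set_mem; exact: (valP h).
  by exists x => //; apply: val_inj.
- by rewrite fc halving_orderE.
Qed.

End HalvingOrder.

(** * The halving group *)

Section HalvingGroup.
Variables (n s : nat).
Hypothesis n_ge3 : 3 <= n.
Hypothesis s_ge2 : 2 <= s.
Let n_ge2 : 2 <= n. Proof. by lia. Qed.
Local Notation rho := (@orthoplex_twist_gen n s).
Local Notation r := (halving_family rho).
Local Notation H := (halving_group rho).
Local Notation h := (halving_gen rho).
Local Notation U := (orthoplex_twist_group n s).
Implicit Types (i j k l m : 'I_n.+1) (x y : H).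

Definition halving_val x : U := val x.
Local Notation hval := halving_val.

Lemma halving_valM : {morph hval : x y / x * y}.
Proof. exact: valM. Qed.

Lemma halving_val_inj : injective hval.
Proof. exact: val_inj. Qed.

Lemma span_val (S : pred 'I_n.+1) x : span h S x <-> span r S (hval x).
Proof.
split.
  pose T := [set x : H | span r S (hval x)]; move: x.
  apply: (gen_min (S := T)) => [|_ [i Si <-]]; last exact: span_gen.
  split=> [|x y]; first by rewrite /T /= (morph1 halving_valM); exact: gen1.
  by rewrite /T /= halving_valM (morphV halving_valM); exact: genF.
move=> Sx; suff [y /halving_val_inj <- //] : exists2 y : H, hval y = hval x & span h S y.
pose T := [set u : U | exists2 y : H, hval y = u & span h S y].
have sT : subgroup_set T.
  split=> [|_ _ [y <- Sy] [y' <- Sy']].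
    by exists 1; [exact: morph1 halving_valM|exact: gen1].
  exists (y / y'); last exact: genF.
  by rewrite halving_valM (morphV halving_valM).
have Tr : [set r j | j in [set j | S j]] `<=` T.
  by move=> _ [i Si <-]; exists (h i) => //; exact: span_gen.
exact: (gen_min sT Tr Sx).
Qed.

Lemma halving_gen2 i : h i * h i = 1.
Proof. by apply: halving_val_inj; rewrite halving_valM (morph1 halving_valM); exact: halving_family2. Qed.

Lemma halving_gen_neq1 i : h i <> 1.
Proof.
move=> /(congr1 hval); rewrite (morph1 halving_valM).
exact: halving_family_neq1.
Qed.

Lemma halving_span x : span h xpredT x.
Proof.
apply/span_val; have : gen (range r) (hval x) by apply/set_mem; exact: (valP x).
by apply: gen_sub => _ [i _ <-]; exists i.
Qed.

Lemma halving_commute l : 2 <= l -> forall i j, i < l -> l < j -> commute (h i) (h j).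
Proof.
move=> l2 i j il lj; apply: halving_val_inj; rewrite !halving_valM.
exact: halving_family_commute l2 i j il lj.
Qed.

Lemma halving_cospan_cap (J : {set 'I_n.+1}) x :
  (forall j, j \in J -> cospan h j x) -> span h (fun k => k \notin J) x.
Proof.
apply: cospan_cap; [exact: halving_gen2|exact: halving_commute|exact: halving_span| | |].
- move=> l m y lm m2 /span_val ly /span_val my; apply/span_val.
  exact: halving_cap_up.
- move=> i j y i0 j1 /span_val iy /span_val jy; apply/span_val.
  exact: halving_cap01 i0 j1 iy jy.
- move=> i m y i1 m2 /span_val iy /span_val my; apply/span_val.
  exact: halving_cap1m.
Qed.

Lemma halving_cosets_meet (J : {set 'I_n.+1}) (y : 'I_n.+1 -> H) :
  (forall i j, i \in J -> j \in J -> exists z, cospan h i (z / y i) /\ cospan h j (z / y j)) ->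
  exists z, forall j, j \in J -> cospan h j (z / y j).
Proof.
apply: cosets_meet; [exact: halving_gen2|exact: halving_commute|].
move=> i j m g g' i0 j1 m2 /span_val ig /span_val jg /span_val mg.
have [|v [jv mv]] := halving_triangle n_ge2 s_ge2 i0 j1 m2 ig jg.
  by move: mg; rewrite halving_valM (morphV halving_valM).
have vH : v \in gen (range r).
  by apply/mem_set; apply: gen_sub jv => _ [k _ <-]; exists k.
pose v' : H := exist _ v vH; exists v'; split; first exact/span_val.
by apply/span_val; rewrite halving_valM (morphV halving_valM).
Qed.

Lemma halving_gen_rel i j : (h i * h j) ^+ halving_coxeter i j = 1.
Proof.
apply: halving_val_inj; rewrite (morph1 halving_valM).
by rewrite (morphX _ halving_valM) halving_valM; exact: halving_family_rel.
Qed.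

Lemma halving_gen_word : halving_word h ^+ (2 * s) = 1.
Proof.
apply: halving_val_inj; rewrite (morph1 halving_valM).
rewrite (morphX _ halving_valM) (halving_word_morph h halving_valM); exact: halving_word_rel.
Qed.

Local Notation C := (coxeter_group (@halving_coxeter n)).
Local Notation c := (coxeter_gen (@halving_coxeter n)).

Definition halving_quotient (x : C) : H := pres_lift h x.

Lemma halving_coxeter_rel w : coxeter_rel (@halving_coxeter n) w -> eval_word h w = 1.
Proof. by move=> [i [j ->]]; rewrite eval_coxeter_rel halving_gen_rel. Qed.

Lemma halving_quotientM : {morph halving_quotient : x y / x * y}.
Proof. exact: pres_liftM halving_coxeter_rel. Qed.

Lemma halving_quotient_gen i : halving_quotient (c i) = h i.
Proof. exact: (pres_lift_gen halving_coxeter_rel). Qed.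

Lemma halving_quotient_surj x : exists y : C, halving_quotient y = x.
Proof.
pose T := [set x : H | exists y : C, halving_quotient y = x].
have sT : subgroup_set T.
  split=> [|_ _ [y <-] [y' <-]]; first by exists 1; exact: morph1 halving_quotientM.
  by exists (y / y'); rewrite halving_quotientM (morphV halving_quotientM).
apply: (gen_min sT) (halving_span x) => _ [i _ <-].
by exists (c i); exact: halving_quotient_gen.
Qed.

(** A word trivial in the halving group is trivial in the group with the extra
    relator, and then [word_congr_added] applies. *)
Lemma halving_quotient_ker : [set x : C | halving_quotient x = 1] =
  normal_closure [set halving_word c ^+ (2 * s)%N].
Proof.
apply/seteqP; split=> [x /= x1|].
  have [w xw] : exists w, word_class _ w = x by eexists; exact: word_class_repr.
  rewrite -{}xw in x1 *.
  have w1 : eval_word r w = 1.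
    rewrite -(morph1 halving_valM) -x1 [halving_quotient _](pres_lift_class halving_coxeter_rel) /eval_word.
    rewrite (big_morph _ halving_valM (morph1 halving_valM)); apply: eq_bigr => -[i b] _.
    by rewrite /eval_letter /=; case: b; rewrite ?(morphV halving_valM).
  have := halving_word_trivial n_ge3 w1.
  move/(word_congr_added (A := [set halving_word c ^+ (2 * s)%N])).
  rewrite word_class_nil divg1; apply=> _ ->.
  by rewrite /= word_class_eval eval_flat_wordX halving_lettersE.
apply: gen_min => [|_ [_ [g [-> ->]]] /=].
  split=> [|x y] /=; first exact: morph1 halving_quotientM.
  by rewrite halving_quotientM (morphV halving_quotientM) => -> ->; rewrite mulgV.
rewrite /conjg !halving_quotientM (morphX _ halving_quotientM) (halving_word_morph c halving_quotientM).
have -> : halving_word (halving_quotient \o c) = halving_word h.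
  by congr halving_word; apply/funext => i; exact: halving_quotient_gen.
by rewrite halving_gen_word mul1g (morphV halving_quotientM) mulVg.
Qed.

End HalvingGroup.


Theorem proposition3p6 (n s : nat) (n_ge3 : (3 <= n)%N) (s_ge2 : (2 <= s)%N) :
  let rho := @orthoplex_twist_gen n s in
  let H := halving_group rho in
  let C := coxeter_group (@halving_coxeter n) in
  let c := coxeter_gen (@halving_coxeter n) in
  [/\ regular_hypertope (halving_system rho),
      automorphism_group_via (@halving_translate _ n rho),
      ([set: H] #= `I_((4 * s) ^ n.-1 * (2 * s) * n`!)%N)%card &
      exists phi : {multiplicative C -> H},
        [/\ forall i, phi (c i) = halving_gen rho i,
            forall h : H, exists x : C, phi x = h &
            [set x : C | phi x = 1] =
              normal_closure [set halving_word c ^+ (2 * s)%N]]].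
Proof.
move=> rho H C c; have n_ge2 : 2 <= n by lia.
split.
- apply: (@coset_hypertope n H (halving_gen rho)).
  + exact: halving_gen2.
  + exact: halving_gen_neq1.
  + by move=> J x; exact: halving_cospan_cap.
  + by move=> J y; exact: halving_cosets_meet.
- apply: (@coset_automorphism_group n H (halving_gen rho)).
  + exact: halving_gen2.
  + exact: halving_gen_neq1.
  + exact: halving_span.
  + by move=> J x; exact: halving_cospan_cap.
  + by move=> J y; exact: halving_cosets_meet.
- exact: halving_card.
pose f := @halving_quotient n s : C -> H.
have fM : {morph f : x y / x * y} by exact: halving_quotientM.
pose mix := isMultiplicative.Build C H f fM.
pose phi : {multiplicative C -> H} := HB.pack f mix.
exists phi; split.
- by move=> i; exact: halving_quotient_gen.
- by move=> h; exact: halving_quotient_surj.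
- exact: halving_quotient_ker.
Qed.
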